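(* Let $M$ be a locally compact separable metric space, let $(\nu_t:t\geq 0)$ be a Feller convolution semigroup in the space of kernels on $M$, and let $\mathfrak{p}:E\to E$ be a common idempotent measurable presentation of the measures $\nu_t$, i.e. $\mathfrak{p}$ is a measurable presentation of every $\nu_t$, $t\geq 0$, and $\mathfrak{p}\circ\mathfrak{p}=\mathfrak{p}$. There exists a stochastic flow of kernels $K=(K_{s,t}:-\infty<s\leq t<\infty)$ in $M$, defined on some probability space $(\Omega,\mathcal{A},\mathsf{P})$, such that (1) for all $s\leq t$ the law of $K_{s,t}$ coincides with $\nu_{t-s}$; (2) the mapping $(s,t,\omega)\mapsto K_{s,t}(\omega)\in E$, defined on $\{(s,t)\in\mathbb{R}^2:s\leq t\}\times\Omega$, is jointly measurable; (3) $K_{s,s}(\omega)(x)=\delta_x$ for all $s\in\mathbb{R}$, $x\in M$, $\omega\in\Omega$; (4) $\mathfrak{p}(K_{s,t}(\omega))=K_{s,t}(\omega)$ for all $s\leq t$ and $\omega\in\Omega$.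
   Context: $C_0(M)$ is the space of continuous functions on $M$ vanishing at infinity; $\mathcal{P}(M)$ is the space of Borel probability measures on $M$ with the topology of weak convergence and its Borel $\sigma$-field. Kernels: a kernel on $M$ is a measurable mapping $K:M\to\mathcal{P}(M)$; $E$ is the set of all kernels on $M$, and $\mathcal{E}$ is the smallest $\sigma$-field on $E$ making all mappings $K\mapsto K(x)\in\mathcal{P}(M)$, $x\in M$, measurable. We write $K_1K_2(x)=\int_M K_2(y)K_1(x,dy)$ and $Kf(x)=\int_M f(y)K(x,dy)$. Measurability of maps into $E$ is with respect to $\mathcal{E}$. Regular measures: a probability measure $\nu$ on $(E,\mathcal{E})$ is regular if there is a mapping $\mathfrak{p}:E\to E$ such that $E\times M\ni(K,x)\mapsto\mathfrak{p}(K)(x)\in\mathcal{P}(M)$ is measurable and, for every $x\in M$, $\mathfrak{p}(K)(x)=K(x)$ for $\nu$-a.a. $K$. Such a $\mathfrak{p}$ is called a measurable presentation of $\nu$. For regular $\nu_1,\nu_2$ and a measurable presentation $\mathfrak{p}$ of $\nu_2$, the convolution $\nu_1*\nu_2$ is the distribution of $(K_1,K_2)\mapsto K_1\mathfrak{p}(K_2)$ under $\nu_1\otimes\nu_2$ (it does not depend on the choice of $\mathfrak{p}$). A Feller convolution semigroup in the space of kernels on $M$ is a family $(\nu_t:t\geq 0)$ of regular probability measures on $(E,\mathcal{E})$ such that: (1) $\nu_t*\nu_s=\nu_{t+s}$ for all $t,s\geq 0$; (2) for all $f\in C_0(M)$ and $\varepsilon>0$, $\lim_{t\to 0+}\sup_{x\in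 M}\nu_t\{K:|Kf(x)-f(x)|\geq\varepsilon\}=0$; (3) for all $f\in C_0(M)$, $t\geq 0$, $x\in M$, $\varepsilon>0$, $\lim_{y\to x}\nu_t\{K:|Kf(y)-Kf(x)|\geq\varepsilon\}=0$ and $\lim_{y\to\infty}\nu_t\{K:|Kf(y)|\geq\varepsilon\}=0$. A stochastic flow of kernels in $M$ is a family $(K_{s,t}:-\infty<s\leq t<\infty)$ of random elements in $(E,\mathcal{E})$ defined on a common probability space $(\Omega,\mathcal{A},\mathsf{P})$ such that: (1) the law of $K_{s,t}$ is regular and coincides with the law of $K_{0,t-s}$; (2) for all $r\leq s\leq t$, $x\in M$ and any measurable presentation $\mathfrak{p}_{t-s}$ of the law of $K_{s,t}$, $K_{r,t}(x)=K_{r,s}\mathfrak{p}_{t-s}(K_{s,t})(x)$ $\mathsf{P}$-a.s.; (3) if $t_1\leq\ldots\leq t_n$, then $K_{t_1,t_2},\ldots,K_{t_{n-1},t_n}$ are mutually independent; (4) for all $f\in C_0(M)$ and $\varepsilon>0$, $\lim_{t\to0+}\sup_{x\in M}\mathsf{P}\{|K_{0,t}f(x)-f(x)|\geq\varepsilon\}=0$; (5) for all $f\in C_0(M)$, $x\in M$, $t\geq 0$, $\varepsilon>0$, $\lim_{y\to x}\mathsf{P}\{|K_{0,t}f(y)-K_{0,t}f(x)|\geq\varepsilon\}=0$ and $\lim_{y\to\infty}\mathsf{P}\{|K_{0,t}f(y)|\geq\varepsilon\}=0$. *)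

(* Defs.v *)
From HB Require Import structures.
From mathcomp Require Import all_boot all_order all_algebra.
From mathcomp Require Import all_classical all_reals all_analysis.
From mathcomp Require Import measurable_realfun giry.
From mathcomp Require Import lra.

Set Implicit Arguments.
Unset Strict Implicit.
Unset Printing Implicit Defensive.

Import Order.TTheory GRing.Theory Num.Theory.
Import numFieldNormedType.Exports.

Local Open Scope classical_set_scope.
Local Open Scope ring_scope.

HB.mixin Record isLocallyCompactSeparable (R : realType) M & Metric R M := {
  locally_compactT : locally_compact [set: M];
  separableT : exists2 D : set M, countable D & dense D
}.

(* [Pointed] only says that the space is nonempty; it is there because every
   [measurableType] of the library is pointed. *)
#[short(type="lcsMetricType")]
HB.structure Definition LCSMetric (R : realType) :=
  { M of Metric R M & Pointed M & isLocallyCompactSeparable R M }.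

Notation borel T := (g_sigma_algebraType (@open T)).

(* A [probability] of the library is a function on all subsets, whose values on
   non-measurable sets are arbitrary. Hence two probability measures are
   identified by [measure_eq], written [mu ≡μ nu] (agreement on measurable
   sets), and never by [=]. The weak topology, the sigma-field [prob] and the
   sigma-field of [kernels] below do not separate ≡μ-equal measures. *)

Section probability_measures.
Context {R : realType} (M : lcsMetricType R).

Definition Cb : Type := { f : M -> R | continuous f /\ bounded_fun f }.

(* The coarsest topology making all the maps mu |-> \int f dmu continuous, f
   bounded and continuous. *)
Definition weak_probability : ptopologicalType := initial_topology
  (fun (mu : probability (borel M) R) =>
     (fun f : Cb => \int[mu]_x (sval f x)) : {ptws Cb -> R}).

Definition prob : measurableType (@open weak_probability).-sigma :=
  borel weak_probability.

End probability_measures.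

Section measurability.
Context {R : realType}.

Lemma continuous_measurable_borel (T : ptopologicalType) (f : T -> R) :
  continuous f -> measurable_fun [set: borel T] f.
Proof.
move=> /continuousP cf; apply: (measurability _ (RGenOpens.measurableE R)).
move=> _ [_ [a [b ->] <-]]; rewrite setTI; apply: sub_sigma_algebra.
exact/cf/interval_open.
Qed.

Variable M : lcsMetricType R.
Implicit Types (f : M -> R) (mu : probability (borel M) R).

Lemma integrable_Cb mu f : continuous f -> bounded_fun f ->
  mu.-integrable [set: borel M] (EFin \o f).
Proof.
move=> cf bf; apply: measurable_bounded_integrable => //.
- by rewrite (le_lt_trans (probability_le1 _ _)) ?ltry.
- exact: continuous_measurable_borel.
Qed.

Lemma measurable_weak_integral f : continuous f -> bounded_fun f ->
  measurable_fun [set: prob M]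
    (fun mu : prob M => \int[(mu : probability (borel M) R)]_x f x).
Proof.
move=> cf bf; apply: (@continuous_measurable_borel (weak_probability M)).
pose F : Cb M := exist _ f (conj cf bf).
have evF (p : {ptws Cb M -> R}) : {for p, continuous (fun g : {ptws Cb M -> R} => g F)}.
  have /cvg_sup/(_ F) pF : p --> p by exact: cvg_id.
  move=> A; move=> /(@initial_continuous _ _ (fun g : Cb M -> R => g F) p).
  exact: pF.
pose I (mu : probability (borel M) R) : {ptws Cb M -> R} :=
  fun f : Cb M => \int[mu]_x (sval f x).
move=> mu A /(evF (I mu)).
exact: (@initial_continuous (probability (borel M) R) {ptws Cb M -> R}
  I mu).
Qed.

Lemma near_integral_gt (X : Type) (F : set_system X) (k : X -> probability (borel M) R)
    mu f : Filter F ->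
  (forall U : set M, open U -> forall d : R, 0 < d ->
    \forall x \near F, fine (mu U) - d < fine (k x U)) ->
  continuous f -> bounded_fun f ->
  forall e : R, 0 < e -> \forall x \near F, \int[mu]_y f y - e < \int[k x]_y f y.
Proof.
move=> FF lsc cf bf e e0.
have [c c0 fc] : exists2 c : R, 0 < c & forall x, `|f x| <= c.
  have /ex_strict_bound_gt0[c c0 fc] := bf.
  by exists c => // x; exact/ltW/fc.
pose e' := e / 3; have e'0 : 0 < e' by rewrite divr_gt0.
pose h x := (f x + c) / e'.
have ch : continuous h.
  by move=> x; apply: cvgM; [apply: cvgD; [exact: cf|exact: cvg_cst]|exact: cvg_cst].
have h0 x : 0 <= h x.
  by rewrite divr_ge0 ?(ltW e'0)// -lerBlDr sub0r; have := fc x; rewrite ler_norml => /andP[].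
have [N hN] : exists N : nat, forall x, h x <= N%:R.
  exists (Num.truncn ((c + c) / e')).+1 => x.
  apply: le_trans (ltW (Num.Theory.truncnS_gt _)).
  by rewrite ler_pM2r ?invr_gt0// lerD2r; have := fc x; rewrite ler_norml => /andP[].
pose U i := [set x | i%:R < h x].
have oU i : open (U i).
  rewrite (_ : U i = h @^-1` [set y | i%:R < y])//; apply: open_comp; last exact: open_gt.
  by move=> + _; exact: ch.
have mU i : measurable (U i : set (borel M)) by exact: sub_sigma_algebra.
pose s n x : R := \sum_(i < n) \1_(U i) x.
have sP n x : [/\ Num.min (h x) n%:R <= s n x, s n x <= h x + 1 & s n x <= n%:R].
  elim: n => [|n [IH1 IH2 IH3]].
    by rewrite /s big_ord0 ge_min lexx orbT; split => //; rewrite addr_ge0.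
  rewrite /s big_ord_recr/= -/(s n x) indicE.
  have [hn|hn] := ltP n%:R (h x).
  - rewrite mem_set//= -natr1; split; last by rewrite lerD2r.
    + rewrite ge_min; apply/orP; right; rewrite lerD2r.
      by move: IH1; rewrite min_r// ltW.
    + by rewrite lerD2r (le_trans IH3)// ltW.
  - rewrite memNset/=; last by rewrite /U/= ltNge hn.
    rewrite addr0 -natr1; split => //.
    + by rewrite ge_min; apply/orP; left; move: IH1; rewrite min_l.
    + by rewrite (le_trans IH3)// lerDl.
have hs x : h x <= s N x by have [+ _ _] := sP N x; rewrite min_l.
have sh x : s N x <= h x + 1 by have [] := sP N x.
have fE x : f x = e' * h x - c by rewrite mulrC divfK ?gt_eqF// addrK.
have intU (nu : probability (borel M) R) i : nu.-integrable [set: borel M] (EFin \o \1_(U i)).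
  exact: integrable_indic.
have ints (nu : probability (borel M) R) n : nu.-integrable [set: borel M] (EFin \o s n).
  elim: n => [|n IH].
    apply: (eq_integrable measurableT (cst 0%E)); last exact: integrable0.
    by move=> x _; rewrite /s /= big_ord0.
  have -> : EFin \o s n.+1 = (fun x => (EFin \o s n) x + (EFin \o \1_(U n)) x)%E.
    by apply/funext => x; rewrite /s /= big_ord_recr.
  exact: (integrableD measurableT IH (intU nu n)).
have intsE (nu : probability (borel M) R) n :
    \int[nu]_x s n x = \sum_(i < n) fine (nu (U i)).
  elim: n => [|n IH].
    rewrite big_ord0; under eq_Rintegral do rewrite /s big_ord0.
    by rewrite Rintegral_cst// mul0r.
  rewrite big_ord_recr/= -IH.
  have -> : s n.+1 = (fun x => s n x + \1_(U n) x).
    by apply/funext => x; rewrite /s big_ord_recr.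
  rewrite (RintegralD measurableT (ints nu n) (intU nu n)).
  by congr (_ + _); rewrite /Rintegral integral_indic// setIT.
have intl (nu : probability (borel M) R) a b n :
    nu.-integrable [set: borel M] (EFin \o (fun x => a * s n x)) /\
    nu.-integrable [set: borel M] (EFin \o (fun x => a * s n x + b)).
  have h1 : nu.-integrable [set: borel M] (EFin \o (fun x => a * s n x)).
    exact: (integrableZl measurableT a (ints nu n)).
  split=> //.
  exact: (integrableD measurableT h1 (finite_measure_integrable_cst nu b measurableT)).
have intlE (nu : probability (borel M) R) a b :
    \int[nu]_x (a * s N x + b) = a * (\sum_(i < N) fine (nu (U i))) + b.
  have [h1 h2] := intl nu a b N.
  rewrite (RintegralD measurableT h1 (finite_measure_integrable_cst nu b measurableT)).
  by rewrite (RintegralZl _ measurableT (ints nu N)) intsE Rintegral_cst//= probability_setT mulr1.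
have fU (nu : probability (borel M) R) : \int[nu]_x f x <= e' * (\sum_(i < N) fine (nu (U i))) + (- c).
  rewrite -intlE; apply: le_Rintegral => //; first exact: integrable_Cb.
    by have [] := intl nu e' (- c) N.
  by move=> x _; rewrite fE lerD2r ler_pM2l.
have fL (nu : probability (borel M) R) :
    e' * (\sum_(i < N) fine (nu (U i))) + (- e' - c) <= \int[nu]_x f x.
  rewrite -intlE; apply: le_Rintegral => //; last 2 first.
    exact: integrable_Cb.
    move=> x _; rewrite fE addrA lerD2r lerBlDr -{3}(mulr1 e') -mulrDr.
    by rewrite ler_pM2l.
  by have [] := intl nu e' (- e' - c) N.
have : \forall x \near F, forall i : 'I_N,
    fine (mu (U i)) - N.+1%:R^-1 < fine (k x (U i)).
  by apply: filter_forall => i; apply: lsc.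
apply: filterS => x kx.
have : \sum_(i < N) fine (mu (U i)) - 1 <= \sum_(i < N) fine (k x (U i)).
  have : \sum_(i < N) (fine (mu (U i)) - N.+1%:R^-1) <= \sum_(i < N) fine (k x (U i)).
    by apply: ler_sum => i _; exact/ltW/kx.
  apply: le_trans; rewrite sumrB lerD2l lerN2 sumr_const card_ord.
  by rewrite -[leLHS]mulr_natl ler_pdivrMr// mul1r ler_nat.
have := fU mu; have := fL (k x).
have -> : e = 3 * e' by rewrite /e' mulrC divfK.
move: e'0; clear.
nra.
Qed.

Lemma Cb_approx_open (U : set M) : open U ->
  exists f : nat -> M -> R, [/\ forall n, continuous (f n),
    forall n x, 0 <= f n x <= 1,
    forall x, {homo f ^~ x : m n / (m <= n)%N >-> m <= n} &
    forall x, f n x @[n --> \oo] --> (\1_U x : R)].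
Proof.
move=> oU; have [U0|] := eqVneq (~` U) set0.
  exists (fun _ _ => 1); split => //.
  - by move=> n x; exact: cvg_cst.
  - by rewrite lexx ler01.
  - by move=> x m n _.
  - by move=> x; rewrite indicE -[U]setCK U0 setC0 in_setT; exact: cvg_cst.
move=> /set0P[a Ua].
pose g x := fine (edist_inf (~` U) x).
have gfin x : edist_inf (~` U) x \is a fin_num.
  rewrite ge0_fin_numE ?edist_inf_ge0//; apply: le_lt_trans.
    by apply: ereal_inf_lbound; exists a.
  rewrite -ge0_fin_numE ?edist_ge0//; apply/edist_finP => /=.
  exists (mdist x a + 1); first by rewrite ltr_wpDl// mdist_ge0.
  by rewrite ballEmdist/= ltrDl.
have cg : continuous g.
  by move=> x; apply: fine_cvg; rewrite fineK//; exact: edist_inf_continuous.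
have g0 x : 0 <= g x by rewrite fine_ge0// edist_inf_ge0.
have gU x : ~ U x -> g x = 0 by move=> Ux; rewrite /g edist_inf0.
have gU0 x : U x -> 0 < g x.
  move=> Ux; rewrite lt_neqAle g0 andbT eq_sym; apply/eqP => gx0.
  have /nbhs_ballP[e /= e0 eU] : nbhs x U by exact: open_nbhs_nbhs.
  have : (edist_inf (~` U) x < e%:E)%E by rewrite -(fineK (gfin x)) -/(g x) gx0 lte_fin.
  move=> /ereal_inf_lt[_ [y Uy <-]] xy; apply: Uy; apply: eU.
  exact: (edist_lt_ball xy).
exists (fun n x => Num.min (g x * n%:R) 1); split.
- move=> n x; apply: (@continuous_min _ _ (fun x => g x * n%:R) (cst 1)).
    by apply: cvgM; [exact: cg|exact: cvg_cst].
  exact: cvg_cst.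
- by move=> n x; rewrite le_min ler01 mulr_ge0//= ge_min lexx orbT.
- move=> x m n mn; rewrite le_min !ge_min lexx orbT andbT.
  by rewrite ler_wpM2l// ?ler_nat.
- move=> x; rewrite indicE; have [Ux|Ux] := boolP (x \in U).
    apply: cvg_near_cst; exists (Num.trunc (g x)^-1).+1 => // n /= nx.
    have gx0 : 0 < g x by apply: gU0; rewrite inE in Ux.
    rewrite min_r// -ler_pdivrMl// mulr1 (le_trans (ltW (Num.Theory.truncnS_gt _)))// ler_nat//.
  have gx0 : g x = 0 by apply: gU; rewrite notin_setE in Ux.
  by rewrite (_ : (fun _ => _) = cst 0); [exact: cvg_cst|
    apply/funext => n; rewrite gx0 mul0r min_l].
Qed.

Lemma measurable_prob_ev (A : set (borel M)) : measurable A ->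
  measurable_fun [set: prob M] (fun mu : prob M => (mu : probability (borel M) R) A).
Proof.
move: A; apply: (@dynkin_induction _ (borel M) (@open M) (fun A => measurable_fun
  [set: prob M] (fun mu : prob M => (mu : probability (borel M) R) A))) => //.
- exact: openI.
- apply: (eq_measurable_fun (cst 1%E)) => // mu _.
  by rewrite /= (probability_setT (mu : probability (borel M) R)).
- move=> U oU.
  have [f [cf f01 ndf fU]] := Cb_approx_open oU.
  have mf n : measurable_fun [set: borel M] (EFin \o f n).
    apply/measurable_EFinP; exact: (@continuous_measurable_borel M _ (cf n)).
  have bf n : bounded_fun (f n).
    exists 1; split; first exact: num_real.
    move=> z z1 x _ /=; have /andP[f0 f1] := f01 n x.
    by rewrite ger0_norm// (le_trans f1)// ltW.
  apply: (emeasurable_fun_cvg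
    (fun n (mu : prob M) => (\int[(mu : probability (borel M) R)]_x (f n x))%:E)).
    by move=> n; apply/measurable_EFinP; exact: measurable_weak_integral.
  move=> mu _.
  have -> : (mu : probability (borel M) R) U =
      (\int[(mu : probability (borel M) R)]_x limn (fun n => (f n x)%:E))%E.
    rewrite -[in LHS](setIT U) -integral_indic//; last exact: sub_sigma_algebra.
    apply: eq_integral => x _; apply/esym/cvg_lim => //.
    by apply: cvg_EFin; [exact: nearW|exact: fU].
  rewrite (_ : (fun _ => _) = fun n =>
      (\int[(mu : probability (borel M) R)]_x (f n x)%:E)%E); last first.
    apply/funext => n; rewrite fineK//; apply: integrable_fin_num => //.
    exact: integrable_Cb.
  apply: cvg_monotone_convergence => //.
  + by move=> n x _; rewrite lee_fin; have /andP[] := f01 n x.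
  + by move=> x _ m n mn; rewrite lee_fin; exact: ndf.
- move=> A mA IH.
  apply: (eq_measurable_fun (fun mu : prob M => 1 - (mu : probability (borel M) R) A)%E).
    by move=> mu _; rewrite (probability_setC (mu : probability (borel M) R)).
  exact: emeasurable_funB.
- move=> F mF tF IH.
  apply: (eq_measurable_fun (fun mu : prob M =>
      \sum_(0 <= i <oo) (mu : probability (borel M) R) (F i))%E).
    by move=> mu _; rewrite measure_semi_bigcup//; exact: bigcup_measurable.
  exact: ge0_emeasurable_sum.
Qed.


Lemma countable_open_base : exists V : nat -> set M,
  (forall i, open (V i)) /\
  forall U, open U -> U = \bigcup_(i in [set i | V i `<=` U]) V i.
Proof.
have [D cD dD] := @separableT R M.
have [d dD'] : exists d : nat -> M, D `<=` range d.
  move: cD => /pfcard_geP[->|[d]]; first by exists (fun=> point).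
  exists d => x Dx; have [n _ <-] := 'surj_d Dx; by exists n.
pose r (k : nat) : R := k.+1%:R^-1.
pose V0 (p : nat * nat) := (ball (d p.1) (r p.2))^°.
pose V i := if unpickle i is Some p then V0 p else set0.
exists V; split.
  by move=> i; rewrite /V; case: unpickle => [p|]; [exact: open_interior|exact: open0].
move=> U oU; apply/seteqP; split; last by move=> x [i iU Vx]; exact: iU.
move=> x Ux.
have /nbhs_ballP[e /= e0 eU] : nbhs x U by exact: open_nbhs_nbhs.
pose k := Num.trunc (2 / e).
have re : r k < e / 2.
  by rewrite /r invf_plt ?posrE ?divr_gt0// invf_div Num.Theory.truncnS_gt.
have r0 : 0 < r k by rewrite /r invr_gt0.
have r20 : 0 < r k / 2 by rewrite divr_gt0.
have [y [xy Dy]] : (ball x (r k / 2))^° `&` D !=set0.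
  apply: dD; last exact: open_interior.
  by exists x; exact: nbhsx_ballx.
have [n _ ny] := dD' _ Dy.
have xy' := interior_subset xy.
have V0U : V0 (n, k) `<=` U.
  move=> z /interior_subset /= zn; apply: eU.
  rewrite (splitr e); apply: (@ball_triangle _ _ (d n)).
    by rewrite ny; apply: (le_ball _ xy'); lra.
  by apply: (le_ball _ zn); exact: ltW.
exists (pickle (n, k)); first by rewrite /= /V pickleK.
rewrite /V pickleK /V0 /interior /=.
apply/nbhs_ballP; exists (r k / 2) => //= z xz.
by rewrite (splitr (r k)) ny; apply: ball_triangle xz; exact: ball_sym.
Qed.

Lemma measurable_fun_prob d (X : measurableType d) (k : X -> prob M) :
  (forall A : set (borel M), measurable A ->
    measurable_fun [set: X] (fun x => (k x : probability (borel M) R) A)) ->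
  measurable_fun [set: X] k.
Proof.
move=> mk.
pose P (x : X) : probability (borel M) R := k x.
have [V [oV UV]] := countable_open_base.
have mV i : measurable (V i : set (borel M)) by exact: sub_sigma_algebra.
pose W (l : seq nat) : set (borel M) := \big[setU/set0]_(i <- l) V i.
have mW l : measurable (W l) by apply: bigsetU_measurable => i _; exact: mV.
pose S (p : seq nat * rat) := [set x | ratr p.2 < fine (P x (W p.1))].
have mS p : measurable (S p).
  rewrite (_ : S p = (fine \o (fun x => P x (W p.1))) @^-1` `]ratr p.2, +oo[).
    rewrite -[X in measurable X]setTI.
    by apply: (measurableT_comp (@fine_measurable _ _ measurableT) (mk _ (mW p.1))).
  by apply/seteqP; split=> x; rewrite /= in_itv/= andbT.
pose B (s : seq (seq nat * rat)) := [set x | forall p, p \in s -> S p x].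
have mB s : measurable (B s).
  elim: s => [|p s IH].
    by rewrite (_ : B [::] = setT)//; apply/seteqP; split.
  rewrite (_ : B (p :: s) = S p `&` B s); first exact: measurableI.
  apply/seteqP; split=> [x Bx|x [px sx] q].
    by split=> [|q qs]; apply: Bx; rewrite inE ?eqxx ?qs ?orbT.
  by rewrite inE => /orP[/eqP ->//|]; exact: sx.
pose F x := filter_from [set s | B s x] B.
have FF x : Filter (F x).
  apply: filter_from_filter; first by exists [::] => p.
  move=> s t Bs Bt; exists (s ++ t).
    by move=> p; rewrite mem_cat => /orP[]; [exact: Bs|exact: Bt].
  by move=> y By; split=> p pl; apply: By; rewrite mem_cat pl ?orbT.
have lsc x (U : set M) : open U -> forall e : R, 0 < e ->
    \forall y \near F x, fine (P x U) - e < fine (P y U).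
  move=> oU e e0.
  pose l n := [seq i <- iota 0 n | `[< V i `<=` U >]].
  have WU : U = \bigcup_n W (l n).
    apply/seteqP; split=> [y|y [n _]].
      rewrite [in X in X -> _](UV _ oU) => -[i iU Vy]; exists i.+1 => //.
      rewrite /W -bigcup_seq; exists i => //=.
      by rewrite mem_filter mem_iota/= add0n leqnn andbT; exact/asboolP.
    rewrite /W -bigcup_seq => -[i /=].
    by rewrite mem_filter => /andP[/asboolP iU _]; exact: iU.
  have ndW : nondecreasing_seq (fun n => W (l n)).
    move=> m n mn; apply/subsetPset; rewrite /W -!bigcup_seq.
    apply: bigcup_sub => i /=; rewrite mem_filter mem_iota => /andP[iU /andP[_ im]].
    apply: (@bigcup_sup _ _ i) => /=.
    by rewrite mem_filter iU mem_iota/= add0n (leq_trans im).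
  have := @nondecreasing_cvg_mu _ (borel M) R (P x) (fun n => W (l n)) (fun n => mW (l n)).
  have mU : measurable (U : set (borel M)) by exact: sub_sigma_algebra.
  rewrite -WU => /(_ mU ndW) cvW.
  have finP y (A : set (borel M)) : measurable A -> P y A \is a fin_num by exact: fin_num_measure.
  have /fine_cvgP[_ /cvgrPdist_lt/(_ _ e0)] :
    (P x \o (fun n => W (l n))) @ \oo --> (fine (P x U))%:E by rewrite fineK//; exact: finP.
  move=> [n _ /(_ n) /= /(_ (leqnn n)) nU].
  have : fine (P x U) - e < fine (P x (W (l n))).
    by rewrite ltrBlDr addrC -ltrBlDr; exact: le_lt_trans (ler_norm _) nU.
  move=> /rat_in_itvoo[q]; rewrite in_itv/= => /andP[eq qW].
  exists [:: (l n, q)].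
    by move=> p; rewrite inE => /eqP ->.
  move=> y /(_ (l n, q)); rewrite inE eqxx => /(_ isT) qy.
  apply: (lt_trans eq); apply: (lt_le_trans qy).
  rewrite fine_le ?finP//; apply: le_measure; rewrite ?inE//.
  by rewrite WU => z Wz; exists n.
have cvgI x (f : Cb M) : \int[P y]_z (sval f z) @[y --> F x] --> \int[P x]_z (sval f z).
  case: f => f [cf bf] /=.
  have near_lt (g : M -> R) (e : R) : continuous g -> bounded_fun g -> 0 < e ->
      \forall y \near F x, \int[P x]_z g z - e < \int[P y]_z g z.
    by move=> cg bg e0; apply: near_integral_gt => //; exact: lsc.
  apply/cvgrPdist_lt => e e0.
  have cNf : continuous (fun z => - f z) by move=> z; apply: cvgN; exact: cf.
  have bNf : bounded_fun (fun z => - f z).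
    by have [c [cR fc]] := bf; exists c; split => // z cz y _; rewrite /= normrN; exact: fc.
  have h1 := near_lt _ _ cf bf e0; have h2 := near_lt _ _ cNf bNf e0.
  have intN y : \int[P y]_z (- f z) = - \int[P y]_z f z.
    rewrite -[RHS]mulN1r -(RintegralZl _ measurableT (integrable_Cb (P y) cf bf)).
    by apply: eq_Rintegral => z _; rewrite mulN1r.
  near=> y.
  have : \int[P x]_z f z - e < \int[P y]_z f z by near: y.
  have : \int[P x]_z (- f z) - e < \int[P y]_z (- f z) by near: y.
  by rewrite !intN => ? ?; rewrite ltr_norml; apply/andP; split; lra.
pose I (mu : probability (borel M) R) : {ptws Cb M -> R} :=
  fun f : Cb M => \int[mu]_x (sval f x).
have cvgP x : (I \o P) @ F x --> I (P x).
  apply/cvg_sup => f; rewrite cvg_image; last first.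
    by apply/seteqP; split=> // r _; exists (fun _ => r).
  move=> A /= /(cvgI x f) IA.
  exists ((fun g : Cb M -> R => g f) @^-1` A) => //.
  by apply/seteqP; split=> [_ [g gA <-]//|r Ar]; exists (fun _ => r).
apply: (measurability (@open (weak_probability M) : set (set (prob M)))) => //.
move=> _ [G oG <-]; rewrite setTI.
rewrite (_ : _ @^-1` G = \bigcup_s (if `[< B s `<=` k @^-1` G >] then B s else set0)).
  apply: countable_bigcupT_measurable => [|s]; first exact: countableP.
  by case: ifP.
apply/seteqP; split=> [x Ox|x [s _]]; last by case: ifPn => // /asboolP; apply.
have [A oA AO] := oG.
have : F x (k @^-1` G).
  rewrite -AO; apply: (cvgP x A); apply: open_nbhs_nbhs; split => //.
  by move: Ox; rewrite -AO.
move=> [s Bsx sO]; exists s => //.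
by case: ifPn => // /asboolP.
Unshelve. all: by end_near.
Qed.
End measurability.

Section kernels.
Context {R : realType} (M : lcsMetricType R).

Definition kernels : Type := {mfun borel M >-> prob M}.

HB.instance Definition _ := Choice.on kernels.
HB.instance Definition _ := isPointed.Build kernels (cst point).

Definition kernel_ev (x : M) (K : kernels) : prob M := K x.

Definition kernel_cylinders : set (set kernels) :=
  \bigcup_x preimage_set_system [set: kernels] (kernel_ev x) measurable.

HB.instance Definition _ :=
  @isMeasurable.Build (sigma_display kernel_cylinders) kernels
    <<s kernel_cylinders >> (@sigma_algebra0 _ setT _) (@sigma_algebraC _ _)
    (@sigma_algebra_bigcup _ setT _).

(* The measure K(x, dy). *)
Definition kernel_at (K : kernels) (x : M) : probability (borel M) R := K x.

Definition kernel_eq (K L : kernels) : Prop :=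
  forall x, kernel_at K x ≡μ kernel_at L x.

Definition kernel_int (K : kernels) (f : M -> R) (x : M) : R :=
  \int[kernel_at K x]_y f y.

End kernels.

Section kernel_composition.
Context {R : realType} {M : lcsMetricType R}.
Local Open Scope ereal_scope.

Lemma measurable_kernel_at (K : kernels M) (A : set (borel M)) : measurable A ->
  measurable_fun [set: borel M] (fun x : borel M => kernel_at K x A).
Proof.
move=> mA; have mK : measurable_fun [set: borel M] (K : borel M -> prob M).
  exact: measurable_funPT.
exact: measurableT_comp (measurable_prob_ev mA) mK.
Qed.

Section at_point.
Variables (K1 K2 : kernels M) (x : M).

Definition kernel_comp_at (A : set (borel M)) : \bar R :=
  \int[kernel_at K1 x]_y kernel_at K2 y A.

Let comp0 : kernel_comp_at set0 = 0.
Proof.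
rewrite /kernel_comp_at (eq_integral (cst 0)) ?integral0// => y _.
by rewrite measure0.
Qed.

Let comp_ge0 A : 0 <= kernel_comp_at A. Proof. exact: integral_ge0. Qed.

Let comp_sigma_additive : semi_sigma_additive kernel_comp_at.
Proof.
move=> U mU tU mUU; rewrite [X in _ --> X](_ : _ =
    \int[kernel_at K1 x]_y (\sum_(n <oo) kernel_at K2 y (U n))); last first.
  apply: eq_integral => y _.
  by apply/esym/cvg_lim => //; exact/measure_semi_sigma_additive.
apply/cvg_closeP; split.
  by apply: is_cvg_nneseries => n _ _; exact: integral_ge0.
rewrite closeE// integral_nneseries// => n.
exact: measurable_kernel_at.
Qed.

HB.instance Definition _ := isMeasure.Build _ _ _ kernel_comp_at
  comp0 comp_ge0 comp_sigma_additive.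

Let compT : kernel_comp_at [set: borel M] = 1.
Proof.
transitivity (\int[kernel_at K1 x]_y 1%:E).
  by apply: eq_integral => y _; exact: probability_setT.
by rewrite integral_cst// mul1e; exact: probability_setT.
Qed.

HB.instance Definition _ := Measure_isProbability.Build _ _ _ kernel_comp_at
  compT.

End at_point.

Definition kernel_comp_fun (K1 K2 : kernels M) (x : borel M) : prob M :=
  (kernel_comp_at K1 K2 x : probability (borel M) R).

Lemma measurable_kernel_comp (K1 K2 : kernels M) :
  measurable_fun [set: borel M] (kernel_comp_fun K1 K2).
Proof.
apply: measurable_fun_prob => A mA.
apply: (@measurable_fun_integral_kernel _ _ (borel M) (borel M) R
  (fun x => kernel_at K1 x) _ (fun y => kernel_at K2 y A)) => //.
  by move=> U mU; exact: measurable_kernel_at.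
exact: measurable_kernel_at.
Qed.

HB.instance Definition _ (K1 K2 : kernels M) :=
  isMeasurableFun.Build _ _ _ _ (kernel_comp_fun K1 K2)
    (measurable_kernel_comp K1 K2).

(* K1K2(x) = \int K2(y) K1(x,dy) *)
Definition kernel_comp (K1 K2 : kernels M) : kernels M := kernel_comp_fun K1 K2.

End kernel_composition.

Section continuous_functions.
Context {R : realType} {M : lcsMetricType R}.

(* Convergence "as y tends to infinity"; when M is compact this filter contains
   the empty set and every statement about limits at infinity holds. *)
Definition at_infinity : set_system M := filter_from compact (fun C => ~` C).

Definition C0 (f : M -> R) : Prop :=
  continuous f /\ f y @[y --> at_infinity] --> (0 : R).

End continuous_functions.

Section convolution_semigroups.
Context {R : realType} {M : lcsMetricType R}.
Implicit Types (nu : probability (kernels M) R) (p : kernels M -> kernels M).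

Definition measurable_presentation nu p : Prop :=
  measurable_fun [set: kernels M * borel M]
    (fun Kx => kernel_ev Kx.2 (p Kx.1)) /\
  forall x, {ae nu, forall K, kernel_at (p K) x ≡μ kernel_at K x}.

Definition regular nu : Prop := exists p, measurable_presentation nu p.

(* [p] is meant to be a measurable presentation of [nu2]. *)
Definition convolution nu1 nu2 p : set (kernels M) -> \bar R :=
  pushforward (nu1 \x nu2)%E (fun K => kernel_comp K.1 (p K.2)).

(* Only the measures [nu t] with [0 <= t] are relevant. *)
Record feller_convolution_semigroup (nu : R -> probability (kernels M) R) :
    Prop := FellerConvolutionSemigroup {
  semigroup_regular : forall t, 0 <= t -> regular (nu t);
  semigroup_convolution : forall t s p, 0 <= t -> 0 <= s ->
    measurable_presentation (nu s) p ->
    forall A, measurable A -> convolution (nu t) (nu s) p A = nu (t + s) A;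
  semigroup_continuous : forall f eps, C0 f -> 0 < eps ->
    ereal_sup (range (fun x : M =>
      nu t [set K | eps <= `|kernel_int K f x - f x|])) @[t --> 0^'+]
      --> 0%E;
  semigroup_feller : forall f t x eps, C0 f -> 0 <= t -> 0 < eps ->
    nu t [set K | eps <= `|kernel_int K f y - kernel_int K f x|] @[y --> x]
      --> 0%E;
  semigroup_feller_infinity : forall f t eps, C0 f -> 0 <= t -> 0 < eps ->
    nu t [set K | eps <= `|kernel_int K f y|] @[y --> at_infinity] --> 0%E
}.

End convolution_semigroups.

Section flows.
Context d {Omega : measurableType d} {R : realType} (P : probability Omega R).

Definition mutually_independent d' (T : measurableType d') n
    (X : 'I_n -> {RV P >-> T}) : Prop :=
  forall A : 'I_n -> set T, (forall i, measurable (A i)) ->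
    P (\bigcap_i (X i @^-1` A i)) = (\prod_(i < n) P (X i @^-1` A i))%E.

Context {M : lcsMetricType R}.

(* Only the random kernels [K s t] with [s <= t] are relevant. *)
Record stochastic_flow (K : R -> R -> {RV P >-> kernels M}) : Prop :=
    StochasticFlow {
  flow_regular : forall s t, s <= t -> regular (distribution P (K s t));
  flow_stationary : forall s t, s <= t ->
    distribution P (K s t) ≡μ distribution P (K 0 (t - s));
  flow_composition : forall r s t x p, r <= s -> s <= t ->
    measurable_presentation (distribution P (K s t)) p ->
    {ae P, forall w, kernel_at (K r t w) x ≡μ
                     kernel_at (kernel_comp (K r s w) (p (K s t w))) x};
  flow_independent : forall n (t : nat -> R),
    (forall i, (i < n)%N -> t i <= t i.+1) ->
    mutually_independent (fun i : 'I_n => K (t i) (t i.+1));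
  flow_continuous : forall f eps, C0 f -> 0 < eps ->
    ereal_sup (range (fun x : M =>
      P [set w | eps <= `|kernel_int (K 0 t w) f x - f x|])) @[t --> 0^'+]
      --> 0%E;
  flow_feller : forall f t x eps, C0 f -> 0 <= t -> 0 < eps ->
    P [set w | eps <= `|kernel_int (K 0 t w) f y - kernel_int (K 0 t w) f x|]
      @[y --> x] --> 0%E;
  flow_feller_infinity : forall f t eps, C0 f -> 0 <= t -> 0 < eps ->
    P [set w | eps <= `|kernel_int (K 0 t w) f y|] @[y --> at_infinity] --> 0%E
}.

End flows.

(* Main.v *)
(** For a finite set of times a flow is built by adjoining the times one by one, in
    increasing order, each time composing with an independent kernel and applying [p].
    These finite flows are then glued without Kolmogorov's theorem, which would need a
    standard Borel structure on [E]: along an ultrafilter on the finite sets of times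
    containing all the sets [{T | s \in T}] one takes their ultraproduct with its Loeb
    probability, on which every event about finitely many times keeps its probability.

    A probability measure on [M] is a measurable function of its integrals against
    countably many functions [f_k] in [C_0(M)]. On the Loeb space let [Y_k(s, t, x)] be
    the standard part of the internal variable [K_{s,t} f_k(x)]. The Feller property
    makes [Y_k] continuous in probability in [(s, t, x)], hence it has a jointly
    measurable modification. Decoding the modifications gives, jointly measurably in
    [(s, t, w)], a kernel which for fixed [(s, t)] almost surely lies in a given
    measurable set if and only if the internal kernels do; laws, independence and
    composition are thus inherited from the finite flows. Applying [p] once more, and
    putting the identity on the diagonal, gives the properties required for all [w]. *)

Require Import Defs.
From mathcomp Require Import all_boot all_order all_algebra.
From mathcomp Require Import all_classical all_reals all_analysis giry.
From mathcomp Require Import measurable_realfun lra.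
From HB Require Import structures.
Import Order.TTheory GRing.Theory Num.Theory.
Import numFieldNormedType.Exports.
Set Implicit Arguments.
Unset Strict Implicit.
Unset Printing Implicit Defensive.
Local Open Scope classical_set_scope.
Local Open Scope ring_scope.

(** * Kernels *)

(** The sigma-field on [kernels M] constrains a kernel at countably many points only, so evaluation
    need not be jointly measurable, and a composition need not depend measurably on its factors; it
    does once [p] is applied to the right factor. For the same reason two versions of a kernel agree
    almost surely at each point, with an exceptional set that depends on the point, and exchanging
    them inside a composition rests on independence and Fubini.

    The obstacle on the Loeb space is that internal events do not commute with countable unions.
    They do so almost surely along internal variables whose laws all equal one countably additive
    measure, here derived from [nu (t - s)], since the remainders of the union then have uniformly
    small probability. This carries the exact laws over to the standard parts and excludes loss of
    mass at infinity.

    The semigroup axioms bound deviations in probability. For functions with values in the unit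
    interval these become bounds in mean, which can be added along a path of parameters and hold
    with the same constants in every finite flow, hence in the limit. *)

Section kernel_measurability.
Context {R : realType} {M : lcsMetricType R}.
Local Open Scope ereal_scope.

(** Changes only the sigma-field: from the Borel field of the weak topology to the one generated by
    evaluations, for which the operations of the Giry monad are measurable. *)
Definition prob_giry (mu : prob M) : giry (borel M) R :=
  (mu : probability (borel M) R).

Lemma measurable_prob_giry : measurable_fun [set: prob M] prob_giry.
Proof.
apply: measurable_giry_codensity => // B mB; exact: measurable_prob_ev.
Qed.

(** The dependence of the integrand on [x] is moved into the measure: [g] is integrated against the
    product of the Dirac mass at [x] with [k x], and this product depends measurably on [x]. *)
Lemma measurable_kernel_integral d (X : measurableType d) (k : X -> prob M)
    (g : X * borel M -> \bar R) :
  measurable_fun [set: X] k -> measurable_fun [set: X * borel M] g ->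
  (forall z, 0 <= g z) ->
  measurable_fun [set: X]
    (fun x => \int[(k x : probability (borel M) R)]_y g (x, y)).
Proof.
move=> mk mg g0.
have -> : (fun x => \int[(k x : probability (borel M) R)]_y g (x, y)) =
  (fun x => giry_int (giry_prod ((giry_ret x : giry X R), prob_giry (k x))) g).
  apply/funext => x; rewrite giry_int_prod1// giry_int_ret//.
  by apply: (measurable_fun_fubini_tonelli_F (m2 := prob_giry (k x))).
apply: (measurableT_comp (measurable_giry_int mg g0)).
apply: (measurableT_comp measurable_giry_prod).
apply: measurable_fun_pair; first exact: measurable_giry_ret.
exact: measurableT_comp measurable_prob_giry mk.
Qed.

Lemma measurable_fun_kernels d (X : measurableType d) (f : X -> kernels M) :
  (forall x A, measurable A -> measurable_fun [set: X] (fun w => kernel_at (f w) x A)) ->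
  measurable_fun [set: X] f.
Proof.
move=> mf; apply: (measurability (@kernel_cylinders R M)) => //.
move=> _ [_ [x _ [B mB <-]] <-]; rewrite setTI.
have h : measurable_fun [set: X] (fun w => kernel_ev x (f w)).
  by apply: measurable_fun_prob => A mA; exact: mf.
have := h measurableT B mB; rewrite setTI.
by rewrite setTI.
Qed.

Lemma measurable_kernel_ev (x : M) : measurable_fun [set: kernels M] (kernel_ev x).
Proof.
move=> _ B mB; apply: sub_sigma_algebra.
by exists x => //; exists B.
Qed.

End kernel_measurability.

(** * Countable determination of a measure *)

Section measure_determining.
Context {R : realType} {M : lcsMetricType R}.

(** Finite intersections of a countable base form a countable pi-system generating the Borel sets.
    Equality of two measures thereby becomes a countable condition, hence a measurable event. *)
Lemma countable_pi_base : exists B : seq nat -> set (borel M),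
  (forall l, measurable (B l)) /\
  forall mu nu : probability (borel M) R, (forall l, mu (B l) = nu (B l)) ->
    mu ≡μ nu.
Proof.
have [V [oV UV]] := countable_open_base M.
pose B (l : seq nat) : set (borel M) := \bigcap_(i in [set` l]) V i.
have mV i : measurable (V i : set (borel M)) by exact: sub_sigma_algebra.
have mB l : measurable (B l).
  by apply: bigcap_measurableType => i _; exact: mV.
exists B; split=> // mu nu munu A mA.
have BI : setI_closed (range B).
  move=> _ _ [l _ <-] [l' _ <-]; exists (l ++ l') => //.
  apply/seteqP; split=> x /=.
    by move=> h; split=> i /= il; apply: h; rewrite /= mem_cat il ?orbT.
  by move=> [h1 h2] i /=; rewrite mem_cat => /orP[]; [exact: h1|exact: h2].
apply: (measure_unique (range B) (fun=> setT)) => //.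
- apply/seteqP; split.
    apply: smallest_sub; first exact: smallest_sigma_algebra.
    move=> U oU; rewrite (UV _ oU).
    rewrite bigcup_mkcond; apply: sigma_algebra_bigcup => i.
    case: ifPn => _; last exact: sigma_algebra0.
    apply: sub_sigma_algebra; exists [:: i] => //.
    by apply/seteqP; split=> x /=; [apply; rewrite /= inE|move=> ? j /=; rewrite inE => /eqP ->].
  apply: smallest_sub; first exact: sigma_algebra_measurable.
  by move=> _ [l _ <-]; exact: mB.
- move=> _; exists [::] => //; apply/seteqP; split => x //= _ i.
- by rewrite bigcup_const//.
- by move=> _ [l _ <-]; exact: munu.
- move=> k; rewrite /=.
  by rewrite [ltLHS](@probability_setT _ _ _ mu) ltry.
Qed.

End measure_determining.

(** * Composition of kernels *)

Section kernel_algebra.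
Context {R : realType} {M : lcsMetricType R}.
Local Open Scope ereal_scope.

(** Stronger in general than measurability into [kernels M], whose sigma-field looks at one point at
    a time. A measurable presentation has this property by definition. *)
Definition jointly_measurable d (X : measurableType d) (L : X -> kernels M) :=
  measurable_fun [set: X * borel M] (fun z => kernel_ev z.2 (L z.1)).

Lemma jointly_measurable_fun d (X : measurableType d) (L : X -> kernels M) :
  jointly_measurable L -> measurable_fun [set: X] L.
Proof.
move=> mL; apply: measurable_fun_kernels => x A mA.
apply: (measurableT_comp (measurable_prob_ev mA)).
have mx : measurable_fun [set: X] (fun w => (w, x : borel M)).
  exact: measurable_fun_pair.
exact: measurableT_comp mL mx.
Qed.

(** The left factor is evaluated at the single point [x], the right one is integrated over all
    points; hence the asymmetry of the hypotheses. *)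
Lemma measurable_kernel_comp_joint d (X : measurableType d) (K L : X -> kernels M) :
  measurable_fun [set: X] K -> jointly_measurable L ->
  measurable_fun [set: X] (fun w => kernel_comp (K w) (L w)).
Proof.
move=> mK mL; apply: measurable_fun_kernels => x A mA.
apply: (@measurable_kernel_integral _ _ _ _ (fun w => kernel_ev x (K w))
  (fun z => kernel_at (L z.1) z.2 A)) => //.
- exact: measurableT_comp (measurable_kernel_ev x) mK.
- exact: measurableT_comp (measurable_prob_ev mA) mL.
Qed.

Lemma jointly_measurable_comp d (X : measurableType d) (K L : X -> kernels M) :
  jointly_measurable K -> jointly_measurable L ->
  jointly_measurable (fun w => kernel_comp (K w) (L w)).
Proof.
move=> mK mL; apply: measurable_fun_prob => A mA.
apply: (@measurable_kernel_integral _ _ _ _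
  (fun z : X * borel M => kernel_ev z.2 (K z.1))
  (fun z => kernel_at (L z.1.1) z.2 A)) => //.
apply: (measurableT_comp (measurable_prob_ev mA)).
have mx : measurable_fun [set: X * borel M * borel M] (fun z => (z.1.1, z.2)).
  by apply: measurable_fun_pair => //; exact: measurableT_comp.
exact: measurableT_comp mL mx.
Qed.

(** On measurable sets the composed measure is the Giry bind of [K x] with [L], whose integrals are
    iterated integrals. *)
Lemma integral_kernel_comp (K L : kernels M) x (f : borel M -> \bar R) :
  measurable_fun [set: borel M] f -> (forall y, 0 <= f y) ->
  \int[kernel_at (kernel_comp K L) x]_y f y =
  \int[kernel_at K x]_y \int[kernel_at L y]_z f z.
Proof.
move=> mf f0.
pose l y : giry (borel M) R := prob_giry (kernel_at L y).
have ml : measurable_fun [set: borel M] l.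
  apply: (measurableT_comp measurable_prob_giry); exact: measurable_funPT.
have := giry_int_bind (prob_giry (kernel_at K x)) ml mf f0.
rewrite /giry_int => <-.
apply: eq_measure_integral => A mA _.
have me := @measurable_giry_ev _ (borel M) R A mA.
exact/esym/(giry_int_map ml (prob_giry (kernel_at K x)) me).
Qed.

Lemma kernel_compA (K L N : kernels M) :
  kernel_eq (kernel_comp (kernel_comp K L) N) (kernel_comp K (kernel_comp L N)).
Proof.
move=> x A mA; rewrite [LHS](integral_kernel_comp K L)//.
exact: measurable_kernel_at.
Qed.

Lemma kernel_comp_eqr (K L L' : kernels M) :
  kernel_eq L L' -> kernel_eq (kernel_comp K L) (kernel_comp K L').
Proof. by move=> LL' x A mA; apply: eq_integral => y _; exact: LL'. Qed.

Lemma kernel_comp_eql (K K' L : kernels M) x :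
  kernel_at K x ≡μ kernel_at K' x ->
  kernel_at (kernel_comp K L) x ≡μ kernel_at (kernel_comp K' L) x.
Proof. by move=> KK' A mA; apply: eq_measure_integral => B mB _; exact: KK'. Qed.

Definition kernel_id_fun (x : borel M) : prob M := (\d_x : probability (borel M) R).

Lemma measurable_kernel_id : measurable_fun [set: borel M] kernel_id_fun.
Proof.
apply: measurable_fun_prob => A mA.
apply/measurable_EFinP; exact: measurable_indic.
Qed.

HB.instance Definition _ := isMeasurableFun.Build _ _ _ _ kernel_id_fun measurable_kernel_id.

Definition kernel_id : kernels M := kernel_id_fun.

Lemma kernel_comp_idl (L : kernels M) : kernel_eq (kernel_comp kernel_id L) L.
Proof.
move=> x A mA; rewrite /= /kernel_comp_at /= integral_dirac//.
  by rewrite diracT mul1e.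
exact: measurable_kernel_at.
Qed.

Lemma kernel_comp_idr (L : kernels M) : kernel_eq (kernel_comp L kernel_id) L.
Proof.
move=> x A mA; rewrite /= /kernel_comp_at /=.
rewrite /dirac/= integral_indic// setIT//.
Qed.

Lemma measurable_kernel_eq_at d (X : measurableType d) (k l : X -> prob M) :
  measurable_fun [set: X] k -> measurable_fun [set: X] l ->
  measurable [set x | (k x : probability (borel M) R) ≡μ (l x : probability (borel M) R)].
Proof.
move=> mk ml; have [B [mB BP]] := @countable_pi_base R M.
rewrite (_ : [set x | _] = \bigcap_s [set x | (k x : probability (borel M) R) (B s) =
    (l x : probability (borel M) R) (B s)]); last first.
  apply/seteqP; split=> x /= h; first by move=> s _; exact: h.
  by apply: BP => s; exact: h.
rewrite -[X in measurable X]setCK setC_bigcap; apply: measurableC.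
apply: countable_bigcupT_measurable => [|s]; first exact: countableP.
apply: measurableC; rewrite -[X in measurable X]setTI.
by apply: measurable_eqe => //; exact: (measurableT_comp (measurable_prob_ev (mB s))).
Qed.

End kernel_algebra.

(** * Almost sure versions of compositions *)

Section almost_everywhere.
Context {R : realType} {M : lcsMetricType R}.
Local Open Scope ereal_scope.

(** The null set where [L] and [L'] differ varies with the point [z]. Tonelli on the measurable set
    [N] of bad pairs exchanges the roles: for almost every pair of parameters, the measure [K] at
    [x] charges no bad [z]. This is where the independence of the two factors enters. *)
Lemma ae_kernel_comp_eqr d1 d2 (S1 : measurableType d1) (S2 : measurableType d2)
    (l1 : probability S1 R) (l2 : probability S2 R)
    (K : S1 -> kernels M) (L L' : S2 -> kernels M) x :
  measurable_fun [set: S1] K -> jointly_measurable L -> jointly_measurable L' ->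
  (forall z, {ae l2, forall y, kernel_at (L y) z ≡μ kernel_at (L' y) z}) ->
  {ae (l1 \x l2), forall w, kernel_at (kernel_comp (K w.1) (L w.2)) x ≡μ
                            kernel_at (kernel_comp (K w.1) (L' w.2)) x}.
Proof.
move=> mK mL mL' LL'.
pose N := ~` [set z : S2 * borel M | kernel_at (L z.1) z.2 ≡μ kernel_at (L' z.1) z.2].
have mN : measurable N by apply: measurableC; exact: measurable_kernel_eq_at.
have m1N : measurable_fun [set: S2 * borel M] (fun z => (\1_N z)%:E : \bar R).
  by apply/measurable_EFinP; exact: measurable_indic.
have N0 z : \int[l2]_y (\1_N (y, z))%:E = 0.
  have mNz : measurable (ysection N z) by exact: measurable_ysection.
  rewrite (eq_integral (fun y => (\1_(ysection N z) y)%:E)); last first.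
    by move=> y _; rewrite !indicE mem_ysection.
  rewrite integral_indic// setIT.
  rewrite -[_ = _]/(l2 _ = 0) -negligibleP//; apply: negligibleS (LL' z) => y.
  by rewrite /ysection/= inE.
pose h (w : S1 * S2) := \int[kernel_at (K w.1) x]_z (\1_N (w.2, z))%:E.
have h0 w : 0 <= h w by apply: integral_ge0 => z _; rewrite lee_fin.
have mh : measurable_fun [set: S1 * S2] h.
  apply: (@measurable_kernel_integral _ _ _ _ (fun w : S1 * S2 => kernel_ev x (K w.1))
    (fun z => (\1_N (z.1.2, z.2))%:E)).
  - apply: (measurableT_comp (measurable_kernel_ev x)); exact: measurableT_comp.
  - apply: (measurableT_comp m1N).
    by apply: measurable_fun_pair => //; exact: measurableT_comp.
  - by move=> z; rewrite lee_fin.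
have : \int[l1 \x l2]_w `|h w| = 0.
  under eq_integral do rewrite gee0_abs//.
  rewrite fubini_tonelli1//= /fubini_F integral0_eq// => a _.
  transitivity (\int[kernel_at (K a) x]_z \int[l2]_y (\1_N (y, z))%:E).
    apply: (@fubini_tonelli _ _ _ _ _ l2 (kernel_at (K a) x) (fun z => (\1_N z)%:E)) => //.
  by apply: integral0_eq => z _; exact: N0.
move=> /(ae_eq_integral_abs _ measurableT mh); apply: filterS => -[a b]/= /(_ I) hab A mA.
have mNb : measurable_fun [set: borel M] (fun z : borel M => (\1_N (b, z))%:E : \bar R).
  by apply: (measurableT_comp m1N); exact: measurable_fun_pair.
apply: ae_eq_integral => //; [exact: measurable_kernel_at..|].
have : \int[kernel_at (K a) x]_z `|(\1_N (b, z))%:E| = 0.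
  by rewrite -[RHS]hab; apply: eq_integral => z _; rewrite gee0_abs// lee_fin.
move=> /(ae_eq_integral_abs _ measurableT mNb); apply: filterS => z /= /(_ I) + _.
rewrite indicE; have [|Nz _] := boolP ((b, z) \in N).
  by move=> _ /eqP; rewrite eqe oner_eq0.
by move: Nz; rewrite notin_setE /N/= => /contrapT; exact.
Qed.

Lemma ae_measure_eq d (T : measurableType d) (m m' : {measure set T -> \bar R})
    (P : T -> Prop) :
  m ≡μ m' -> {ae m, forall x, P x} -> {ae m', forall x, P x}.
Proof. by move=> mm' [A [mA A0 PA]]; exists A; split=> //; rewrite -mm'. Qed.

Lemma ae_pushforward d d' (T : measurableType d) (S : measurableType d')
    (m : {measure set T -> \bar R}) (f : T -> S) (mf : measurable_fun [set: T] f)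
    (m' : {measure set S -> \bar R}) (P : S -> Prop) :
  (forall A, measurable A -> m (f @^-1` A) = m' A) ->
  {ae m', forall x, P x} -> {ae m, forall x, P (f x)}.
Proof.
move=> mE [A [mA A0 PA]]; exists (f @^-1` A); split.
- by rewrite -[X in measurable X]setTI; exact: mf.
- by rewrite mE.
- by move=> x /= Px; exact: PA.
Qed.

End almost_everywhere.

(** * Coding probability measures by sequences of integrals *)

Section function_space.
Context (I : Type) d (T : measurableType d).

Definition cylinders : set (set (I -> T)) :=
  \bigcup_i preimage_set_system [set: I -> T] (fun f => f i) measurable.

Definition fun_space := g_sigma_algebraType cylinders.

Lemma measurable_proj i : measurable_fun [set: fun_space] (fun f : fun_space => f i).
Proof. by move=> _ B mB; apply: sub_sigma_algebra; exists i => //; exists B. Qed.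

Lemma measurable_fun_space d' (X : measurableType d') (f : X -> fun_space) :
  (forall i, measurable_fun [set: X] (fun x => f x i)) -> measurable_fun [set: X] f.
Proof.
move=> mf; apply: (@measurability _ _ X fun_space setT f (cylinders : set (set fun_space))) => //.
move=> _ [_ [i _ [B mB <-]] <-]; rewrite setTI.
by have := mf i measurableT B mB; rewrite !setTI.
Qed.

End function_space.

Local Notation bits := (fun_space nat bool).

(** * Locally compact separable metric spaces as Borel subsets of the Cantor space *)

Section standard_borel.
Context {R : realType} (M : lcsMetricType R).

(** Base sets whose closure is not compact are replaced by the empty set. Regularity and local
    compactness leave enough of the others around every point. *)
Lemma relatively_compact_base : exists V : nat -> set M,
  [/\ forall i, open (V i), forall i, compact (closure (V i)) &
   forall U x, open U -> U x -> exists i, V i x /\ closure (V i) `<=` U].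
Proof.
have [V [oV UV]] := countable_open_base M.
exists (fun i => if `[< compact (closure (V i)) >] then V i else set0); split.
- by move=> i; case: ifP => // _; exact: open0.
- move=> i; case: ifPn => [/asboolP//|_]; rewrite closure0; exact: compact0.
- move=> U x oU Ux.
  have [N Nx NU] : filter_from (nbhs x) closure U.
    by apply: (@uniform_regular M x); exact: open_nbhs_nbhs.
  have := @locally_compactT R M x I.
  move=> [C]; rewrite /within/= => Cx [cC clC].
  have NCx : (N `&` C)^° x.
    by apply: filterI => //; apply: filterS Cx => y; exact.
  move: (NCx); rewrite (UV _ (@open_interior _ (N `&` C))) => -[i iN Vix].
  exists i.
  have VN : V i `<=` N by move=> y /iN /interior_subset[].
  have VC : V i `<=` C by move=> y /iN /interior_subset[].
  rewrite asboolT; first by split => //; apply: subset_trans NU; exact: closure_subset.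
  by rewrite -precompactE; apply: precompact_subset VC _; rewrite precompact_closed.
Qed.

Section coding.
Variable V : nat -> set M.
Hypotheses (oV : forall i, open (V i)) (cV : forall i, compact (closure (V i))).
Hypothesis baseV : forall U x, open U -> U x -> exists i, V i x /\ closure (V i) `<=` U.

(** Embeds [M] in the Cantor space. Local compactness, in place of completeness of the metric, makes
    the image Borel. *)
Definition code (x : borel M) : bits := fun i => `[< V i x >].

Let measurable_V i : measurable (V i : set (borel M)).
Proof. exact: sub_sigma_algebra. Qed.

Lemma measurable_code : measurable_fun [set: borel M] code.
Proof.
apply: measurable_fun_space => i; apply: (measurable_fun_bool true) => //.
rewrite setTI (_ : _ @^-1` _ = V i)//.
by apply/seteqP; split=> x /=; [move/asboolP|move/asboolP].
Qed.

Lemma code_inj x y : code x = code y -> x = y.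
Proof.
move=> xy; apply: (@metric_hausdorff R M) => A B.
move=> /nbhs_interior Ax Bx.
have [i [Vix iA]] := baseV (open_interior _) (nbhs_singleton Ax).
have : code x i by exact/asboolP.
rewrite xy => /asboolP Viy; exists y; split; last exact: nbhs_singleton.
by apply: interior_subset; apply: iA; exact: subset_closure.
Qed.

(** The condition that a bit puts on the coded point, relaxed to a closed one so that compactness
    applies. *)
Let G i (b : bool) : set M := if b then closure (V i) else ~` V i.

(* Compactness of a closure of a base set provides the point coded by [b], and the
   second condition makes its code equal to [b]. *)
Lemma range_codeE : range code =
  [set b : bits | [/\ exists i, b i,
    forall i, b i -> exists j, b j /\ closure (V j) `<=` V i &
    forall n, exists x, forall i, (i < n)%N -> G i (b i) x]].
Proof.
apply/seteqP; split=> [_ [x _ <-]|b [[i0 bi0] bb bn]].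
  split.
  - by have [i [Vix _]] := baseV openT (I : [set: M] x); exists i; exact/asboolP.
  - move=> i /asboolP Vix; have [j [Vjx ji]] := baseV (oV i) Vix.
    by exists j; split => //; exact/asboolP.
  - by move=> n; exists x => i _; rewrite /G /code; case: asboolP => // Vix; exact: subset_closure.
pose F n := [set x | closure (V i0) x /\ forall i, (i < n)%N -> G i (b i) x].
have FF : ProperFilter (filter_from [set: nat] F).
  apply: filter_from_proper; last first.
    move=> n _; have [x xn] := bn (maxn n i0.+1); exists x; split.
      by have := xn i0; rewrite leq_max ltnSn orbT /G bi0; exact.
    by move=> i im; apply: xn; rewrite leq_max im.
  apply: filter_from_filter; first by exists 0%N.
  move=> m n _ _; exists (maxn m n) => // x [x0 xmn].
  by split; split => // i im; apply: xmn; rewrite leq_max im ?orbT.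
have [|x [_ xF]] := @cV i0 _ FF; first by exists 0%N => // y [].
have Gx i : G i (b i) x.
  have cG : closed (G i (b i)).
    by rewrite /G; case: (b i); [exact: closed_closure|exact: open_closedC].
  rewrite (iffLR (closure_id _) cG) => B /xF; apply.
  by exists i.+1 => // y [_]; apply.
exists x => //; apply/funext => i; rewrite /code.
have := Gx i; rewrite /G; case: ifPn => [bi _|_ Vx].
  have [j [bj ji]] := bb _ bi; apply/asboolP; apply: ji.
  by have := Gx j; rewrite /G bj.
by apply/asboolP.
Qed.

(** In [range_codeE] the quantifier over points of [M] is uncountable, but it depends on the first
    [n] bits only; it becomes a union over the countable set of finite bit sequences. *)
Lemma measurable_range_code : measurable (range code).
Proof.
have mb i c : measurable [set b : bits | b i = c].
  rewrite -[X in measurable X]setTI.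
  by have := @measurable_proj nat _ bool i measurableT [set c]; apply.
have mor (P : Prop) (A : set bits) : measurable A -> measurable [set b | A b /\ P].
  move=> mA; have [p|np] := pselect P.
    by rewrite (_ : [set b | _] = A)//; apply/seteqP; split => [b []|b].
  by rewrite (_ : [set b | _] = set0)//; apply/seteqP; split => [b []|b].
apply: (eq_ind_r (fun A : set bits => measurable A) _ range_codeE).
rewrite (_ : [set b : bits | _] =
  (\bigcup_i [set b : bits | b i = true]) `&`
  (\bigcap_i ([set b : bits | b i = false] `|`
     \bigcup_j [set b : bits | b j = true /\ closure (V j) `<=` V i])) `&`
  (\bigcap_n \bigcup_(s : seq bool)
     ([set b : bits | (\bigcap_(i in `I_n) [set b : bits | b i = nth true s i]) b /\
       exists x, forall i, (i < n)%N -> G i (nth true s i) x]))); last first.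
  apply/seteqP; split=> [b [[i bi] bb bn]|b [[[i _ bi] bb] bn]].
    split; first split.
    - by exists i.
    - move=> j _; case E : (b j); last by left.
      by right; have [k [bk kj]] := bb _ E; exists k.
    - move=> n _; exists (mkseq b n) => //; split; last first.
        by have [x xn] := bn n; exists x => k kn; rewrite nth_mkseq//; exact: xn.
      by move=> k /= kn; rewrite nth_mkseq.
  split; first by exists i.
  - move=> j bj; have [/= bj'|[k _ [bk kj]]] := bb j I; first by rewrite bj' in bj.
    by exists k.
  - move=> n; have [s _ [bs [x xs]]] := bn n I; exists x => j jn.
    by rewrite bs//; exact: xs.
apply: measurableI; first apply: measurableI.
- exact: bigcupT_measurable.
- apply: bigcapT_measurable => i; apply: measurableU => //.
  by apply: bigcupT_measurable => j; exact: (mor _ _ (mb j true)).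
- apply: bigcapT_measurable => n.
  apply: countable_bigcupT_measurable => [|s]; first exact: countableP.
  by apply: mor; apply: bigcap_measurableType.
Qed.

Definition decode (b : bits) : borel M :=
  if pselect (exists x, code x = b) is left H then sval (cid H) else point.

Lemma codeK : cancel code decode.
Proof.
move=> x; rewrite /decode; case: pselect => [H|[]]; last by exists x.
by apply: code_inj; exact: (svalP (cid H)).
Qed.

Lemma measurable_decode : measurable_fun [set: bits] decode.
Proof.
apply: (@measurability _ _ bits (borel M) setT decode (@open M)) => //.
move=> _ [U oU <-]; rewrite setTI.
have -> : U = \bigcup_(i in [set i | V i `<=` U]) V i.
  apply/seteqP; split=> [x Ux|x [i iU]]; last exact: iU.
  have [i [Vix iU]] := baseV oU Ux; exists i => //.
  by apply: subset_trans iU; exact: subset_closure.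
rewrite preimage_bigcup; apply: bigcup_measurable => i _.
rewrite (_ : _ @^-1` _ = (range code `&` [set b : bits | b i = true]) `|`
   (~` range code `&` (if `[< V i point >] then setT else set0))).
  have mR := measurable_range_code.
  apply: measurableU; apply: measurableI => //.
  - rewrite -[X in measurable X]setTI.
    by have := @measurable_proj nat _ bool i measurableT [set true]; apply.
  - exact: measurableC.
  - by case: ifP.
apply/seteqP; split=> b /=.
- rewrite /decode; case: pselect => [H|nH].
    case: (cid H) => /= x <- Vix; left; split; first by exists x.
    by apply/asboolP.
  move=> Vp; right; split; last by rewrite asboolT.
  by move=> [x _ xb]; apply: nH; exists x.
- move=> [[[x _ <-] /asboolP Vix]|[nb]]; first by rewrite codeK.
  rewrite /decode; case: pselect => [[x xb]|_]; first by exfalso; apply: nb; exists x.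
  by case: asboolP.
Qed.

End coding.
End standard_borel.

Definition mfun_of d d' (T : measurableType d) (S : measurableType d') (f : T -> S)
    (mf : measurable_fun [set: T] f) : {mfun T >-> S} := mfun_Sub (mem_set mf).

Lemma mfun_ofE d d' (T : measurableType d) (S : measurableType d') (f : T -> S)
  (mf : measurable_fun [set: T] f) : mfun_of mf = f :> (T -> S).
Proof. exact: mfun_valP. Qed.

Lemma distribution_mfun_ofE d d' (T : measurableType d) (S : measurableType d')
    (R : realType) (P : probability T R) (f : T -> S) (mf : measurable_fun [set: T] f) A :
  distribution P (mfun_of mf) A = P (f @^-1` A).
Proof. by rewrite -[LHS]/(pushforward P (mfun_of mf) A) /pushforward mfun_ofE. Qed.

Definition cyl (s : seq bool) : set bits :=
  [set b | forall i, (i < size s)%N -> b i = nth false s i].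

Lemma measurable_cyl s : measurable (cyl s).
Proof.
rewrite (_ : cyl s = \bigcap_(i in `I_(size s)) [set b : bits | b i = nth false s i])//.
apply: bigcap_measurableType => i _.
by have := @measurable_proj nat _ bool i measurableT [set nth false s i]; rewrite setTI; apply.
Qed.

(** Two cylinders are nested or disjoint, so together with the empty set they form a generating
    pi-system. *)
Lemma cyl_measure_unique (R : realType) (m m' : probability bits R) :
  (forall s, m (cyl s) = m' (cyl s)) -> m ≡μ m'.
Proof.
move=> mm' A mA.
have G_closed : setI_closed [set A | A = set0 \/ exists s, A = cyl s].
  have key s t : (size s <= size t)%N -> cyl s `&` cyl t = set0 \/
      exists u, cyl s `&` cyl t = cyl u.
    move=> st; have [ts|ts] := eqVneq (take (size s) t) s.
      right; exists t; apply/seteqP; split=> [b []//|b bt]; split=> // i si.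
      by rewrite bt ?(leq_trans si)// -ts nth_take.
    left; apply/seteqP; split=> // b [bs bt]; move/eqP: ts; apply.
    apply: (@eq_from_nth _ false); first by rewrite size_takel.
    move=> i; rewrite size_takel// => si; rewrite nth_take// -bs// bt//.
    exact: leq_trans si st.
  move=> _ _ [->|[s ->]] [->|[t ->]]; rewrite ?setI0 ?set0I; try by left.
  have [st|/ltnW ts] := leqP (size s) (size t); first exact: key.
  by rewrite setIC; exact: key.
apply: (measure_unique [set A | A = set0 \/ exists s, A = cyl s] (fun=> setT)) => //.
- apply/seteqP; split; apply: smallest_sub; try exact: smallest_sigma_algebra.
  + move=> _ [i _ [B mB <-]]; rewrite setTI.
    rewrite (_ : _ @^-1` B = \bigcup_(s : seq bool)
      (if (size s == i.+1) && `[< B (nth false s i) >] then cyl s else set0)).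
      pose pt n := if unpickle n is Some s then
        (if (size s == i.+1) && `[< B (nth false s i) >] then cyl s else set0) else set0.
      rewrite (_ : \bigcup_(s : seq bool) _ = \bigcup_n pt n).
        apply: sigma_algebra_bigcup => n; apply: sub_sigma_algebra.
        rewrite /pt; case: (@unpickle (seq bool) n) => [s|] /=; last by left.
        by case: ifP => _ /=; [right; exists s|left].
      apply/seteqP; split=> b [n _ bn].
        by exists (pickle n) => //; rewrite /pt pickleK.
      by move: bn; rewrite /pt; case: (@unpickle (seq bool) n) => // s bs; exists s.
    apply/seteqP; split=> [b Bb|b [s _]].
      exists (mkseq b i.+1) => //; rewrite size_mkseq eqxx nth_mkseq// asboolT// => j.
      by rewrite size_mkseq => ji; rewrite nth_mkseq.
    case: ifPn => // /andP[/eqP si /asboolP Bs] /(_ i).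
    by rewrite si => /(_ (leqnn _)) /= ->.
  + by move=> _ [->|[s ->]]; [exact: sigma_algebra0|exact: measurable_cyl].
- by move=> _; right; exists [::]; apply/seteqP; split.
- by rewrite bigcup_const.
- move=> _ [->|[s ->]]; last exact: mm'.
  by rewrite !measure0.
- by move=> _; rewrite [ltLHS](@probability_setT _ _ _ m) ltry.
Qed.

(** * Random bit sequences with prescribed cylinder weights *)

Section unit_interval.
Context {R : realType}.

(** The interval is half-open because the intervals of the binary tree below are, and those of a
    given depth must partition it. *)
Definition unit_lebesgue :=
  mrestr (@lebesgue_measure R) (measurable_itv (`[0, 1[ : interval R)).

HB.instance Definition _ := Measure.on unit_lebesgue.

Let unit_lebesgueT : unit_lebesgue setT = 1%E.
Proof.
by rewrite /unit_lebesgue/mrestr setTI lebesgue_measure_itv/= lte01 oppr0 adde0.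
Qed.

HB.instance Definition _ := Measure_isProbability.Build _ _ _ unit_lebesgue unit_lebesgueT.

(* [lebesgue_measure] lives on the alias [measurableTypeR R] of [R]. *)
Lemma measurable_idTR :
  measurable_fun [set: measurableTypeR R] (idfun : measurableTypeR R -> R).
Proof. exact: (@measurable_id _ _ setT). Qed.

Definition unit_prob : probability R R := distribution unit_lebesgue (mfun_of measurable_idTR).

Lemma unit_probE A : unit_prob A = unit_lebesgue A.
Proof. exact: distribution_mfun_ofE. Qed.

End unit_interval.

(* The random branch: [u] runs down the binary tree of nested intervals whose lengths
   are the weights [m]. *)
Section branch.
Context {R : realType} (m : seq bool -> R).

(** Left end of the interval attached to [s]: each turn to the right skips the weight of the left
    sibling. *)
Definition lower (s : seq bool) : R :=
  \sum_(i < size s | nth false s i) m (rcons (take i s) false).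

Fixpoint branch_prefix (u : R) n : seq bool :=
  if n is n.+1 then
    let s := branch_prefix u n in rcons s (lower s + m (rcons s false) <= u)
  else [::].

Definition branch u : bits := fun n => nth false (branch_prefix u n.+1) n.

Lemma lower_rcons s b :
  lower (rcons s b) = lower s + (if b then m (rcons s false) else 0).
Proof.
rewrite /lower big_mkcond size_rcons big_ord_recr/= nth_rcons ltnn eqxx.
congr (_ + _); last by rewrite -[rcons s b]cats1 take_size_cat.
rewrite [RHS]big_mkcond; apply: eq_bigr => i _.
by rewrite nth_rcons ltn_ord -[rcons s b]cats1 takel_cat// ltnW.
Qed.

Lemma size_branch_prefix u n : size (branch_prefix u n) = n.
Proof. by elim: n => //= n IH; rewrite size_rcons IH. Qed.

Lemma branch_prefixE u n : branch_prefix u n = mkseq (branch u) n.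
Proof.
elim: n => // n IH; rewrite mkseqS -IH/=.
by congr rcons; rewrite /branch/= nth_rcons size_branch_prefix ltnn eqxx.
Qed.

Lemma cyl_branch u s : cyl s (branch u) <-> branch_prefix u (size s) = s.
Proof.
rewrite branch_prefixE; split=> [h|<- i].
  apply: (@eq_from_nth _ false); rewrite size_mkseq// => i si.
  by rewrite nth_mkseq// h.
by rewrite size_mkseq => si; rewrite nth_mkseq.
Qed.

Hypotheses (m0 : forall s, 0 <= m s) (m1 : m [::] = 1)
  (mD : forall s, m s = m (rcons s false) + m (rcons s true)).

Lemma lower_bound s : 0 <= lower s /\ lower s + m s <= 1.
Proof.
elim/last_ind: s => [|s b [l0 l1]]; first by rewrite /lower big_ord0 m1 add0r.
rewrite lower_rcons; have := mD s; have := m0 (rcons s true); have := m0 (rcons s false).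
by case: b; split; lra.
Qed.

Lemma branch_prefixP u s : 0 <= u < 1 ->
  branch_prefix u (size s) = s <-> lower s <= u < lower s + m s.
Proof.
move=> u01; elim/last_ind: s => [|s b IH].
  by rewrite /lower big_ord0 m1 add0r; split.
rewrite size_rcons lower_rcons/=; have := mD s.
have := m0 (rcons s true); have := m0 (rcons s false).
move=> h1 h2 h3; split.
  move=> /eqP; rewrite eqseq_rcons => /andP[/eqP bs]; rewrite bs => /eqP <-.
  move/IH: bs => /andP[? ?]; case: ifPn; [move=> ?|rewrite -ltNge => ?]; lra.
move=> h; have bs : branch_prefix u (size s) = s.
  by apply/IH; case: b h => /andP[? ?]; lra.
rewrite bs; congr rcons; case: b h => /andP[? ?]; first by lra.
apply/negbTE; rewrite -ltNge; lra.
Qed.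

Lemma unit_prob_cyl s : unit_prob [set u | cyl s (branch u)] = (m s)%:E.
Proof.
have [l0 l1] := lower_bound s; have ms := m0 s.
rewrite unit_probE /unit_lebesgue/mrestr (_ : _ `&` _ = `[lower s, lower s + m s[%classic).
  rewrite lebesgue_measure_itv/= lte_fin; case: ifPn => h.
    by rewrite -EFinD addrAC subrr add0r.
  by congr (_%:E); move: h; rewrite -leNgt; lra.
apply/seteqP; split=> u /=; rewrite !in_itv/=.
  by move=> [/cyl_branch bs u01]; exact/branch_prefixP.
move=> h; have u01 : 0 <= u < 1 by case/andP: h => ? ?; apply/andP; split; lra.
by split=> //; apply/cyl_branch/branch_prefixP.
Qed.

End branch.

Section measurable_branch.
Context {R : realType} d (X : measurableType d) (m : X -> seq bool -> R).
Hypothesis mm : forall s, measurable_fun [set: X] (m ^~ s).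

Lemma measurable_lower s : measurable_fun [set: X] (fun x => lower (m x) s).
Proof.
rewrite /lower; under eq_fun do rewrite big_mkcond/=.
by apply: measurable_sum => i; case: (nth false s i).
Qed.

(** Joint measurability, because the decoding of a measure integrates over [u] with the weights as a
    parameter. *)
Lemma measurable_branch : measurable_fun [set: X * R]
  (fun z : X * R => branch (m z.1) z.2).
Proof.
have mp n s : measurable [set z : X * R | branch_prefix (m z.1) z.2 n = s].
  elim: n s => [s|n IH s].
    have [->|/eqP s0] := eqVneq s [::].
      by rewrite (_ : [set z | _] = setT)//; apply/seteqP; split.
    by rewrite (_ : [set z | _] = set0)//; apply/seteqP; split=> // z /= /esym.
  elim/last_ind: s => [|s b _].
    rewrite (_ : [set z | _] = set0)//; apply/seteqP; split=> // z /=.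
    by move=> /eqP; rewrite -size_eq0 size_rcons.
  have mc : measurable_fun [set: X * R]
      (fun z : X * R => lower (m z.1) s + m z.1 (rcons s false) <= z.2).
    apply: measurable_fun_ler => //; apply: measurable_funD.
      exact: (measurableT_comp (measurable_lower s)).
    exact: (measurableT_comp (mm (rcons s false))).
  rewrite (_ : [set z | _] = [set z : X * R | branch_prefix (m z.1) z.2 n = s] `&`
    ((fun z : X * R => lower (m z.1) s + m z.1 (rcons s false) <= z.2) @^-1` [set b])).
    apply: measurableI => //; rewrite -[X in measurable X]setTI.
    by apply: mc.
  apply/seteqP; split=> z /=.
    by move=> /eqP; rewrite eqseq_rcons => /andP[/eqP -> /eqP ->].
  by move=> [-> ->].
apply: measurable_fun_space => n; apply: (measurable_fun_bool true) => //.
rewrite setTI (_ : _ @^-1` _ = \bigcup_(s : seq bool)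
   (if nth false s n then [set z : X * R | branch_prefix (m z.1) z.2 n.+1 = s] else set0)).
  apply: countable_bigcupT_measurable => [|s]; first exact: countableP.
  by case: ifP.
apply/seteqP; split=> z.
  by move=> h; exists (branch_prefix (m z.1) z.2 n.+1) => //; rewrite ifT.
by move=> [s _]; case: ifPn => // ns; rewrite /branch/= => ->.
Qed.

End measurable_branch.

(** * Recovering a probability measure from countably many integrals *)

Section prob_coding.
Context {R : realType} (M : lcsMetricType R).

Section masses.
Variable V : nat -> set M.
Hypotheses (oV : forall i, open (V i)) (cV : forall i, compact (closure (V i))).

(** A cylinder pulls back under [code] to the difference of this open set and [join_zeros s]; masses
    of open sets are limits of integrals of continuous functions. *)
Definition meet_ones (s : seq bool) : set M :=
  [set x | forall i, (i < size s)%N -> nth false s i -> V i x].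
Definition join_zeros (s : seq bool) : set M :=
  [set x | exists i, [/\ (i < size s)%N, ~~ nth false s i & V i x]].

Lemma open_meet_ones s : open (meet_ones s).
Proof.
rewrite (_ : meet_ones s =
    ~` \bigcup_(i in [set i | (i < size s)%N /\ nth false s i]) ~` V i).
  apply: closed_openC; apply: closed_bigcup => [|i _]; last exact: open_closedC.
  by apply: (sub_finite_set _ (finite_II (size s))) => i [].
rewrite setC_bigcup.
apply/seteqP; split=> x h i /=; first by move=> [si sn]; apply; exact: h.
by move=> si sn; have := h i (conj si sn); rewrite /= => /contrapT.
Qed.

Lemma open_join_zeros s : open (join_zeros s).
Proof.
rewrite (_ : join_zeros s =
    \bigcup_(i in [set i | (i < size s)%N /\ ~~ nth false s i]) V i).
  by apply: bigcup_open => i _.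
by apply/seteqP; split=> x [i]; [move=> []|case]; exists i.
Qed.

(** The mass of a cylinder is the mass of the piece for [true] minus that of the piece for [false].
    Both must be relatively compact for their approximants to lie in [C0]. When [s] contains no one,
    [meet_ones s] is the whole space; its mass is known to be 1, and the empty set stands in for
    it. *)
Definition piece (s : seq bool) (b : bool) : set M :=
  if b then (if has id s then meet_ones s else set0)
  else meet_ones s `&` join_zeros s.

Lemma open_piece s b : open (piece s b).
Proof.
rewrite /piece; case: b; first by case: ifP => _; [exact: open_meet_ones|exact: open0].
by apply: openI; [exact: open_meet_ones|exact: open_join_zeros].
Qed.

Lemma piece_compact s b : exists2 C, compact C & piece s b `<=` C.
Proof.
exists (\big[setU/set0]_(i < size s) closure (V i)).
  by apply: bigsetU_compact => i _.
rewrite -(bigcup_mkord _ (fun i => closure (V i))) => x; rewrite /piece; case: b => [|[_ [i [si _ Vx]]]].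
  case: ifPn => // /(has_nthP false)[i si sn] h.
  by exists i => //; apply: subset_closure; exact: h.
by exists i => //; exact: subset_closure.
Qed.

Lemma code_cyl s : (code V : borel M -> bits) @^-1` cyl s = meet_ones s `\` join_zeros s.
Proof.
apply/seteqP; split=> [x h|x [h1 h2] i si].
  split.
    by move=> i si sn; apply/asboolP; rewrite -/(code V x i) h.
  by move=> [i [si + Vx]]; rewrite -(h i si) => /negP; apply; exact/asboolP.
rewrite /code; case E : (nth false s i); first by rewrite asboolT//; exact: h1.
by rewrite asboolF// => Vx; apply: h2; exists i; rewrite E.
Qed.

Lemma probability_code_cyl (mu : probability (borel M) R) s :
  mu (code V @^-1` cyl s) =
  ((if has id s then mu (piece s true) else 1) - mu (piece s false))%E.
Proof.
have mJ : measurable (join_zeros s : set (borel M)).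
  by apply: sub_sigma_algebra; exact: open_join_zeros.
have mI : measurable (meet_ones s : set (borel M)).
  by apply: sub_sigma_algebra; exact: open_meet_ones.
rewrite code_cyl measureD//; last first.
  by rewrite -ge0_fin_numE// fin_num_measure.
rewrite /piece; case: (boolP (has id s)) => [//|h].
rewrite (_ : meet_ones s = setT); first by congr (_ - _)%E; exact: (@probability_setT _ _ _ mu).
apply/seteqP; split=> // x _ i si sn; exfalso; move/negP: h; apply.
by apply/(has_nthP false); exists i.
Qed.

End masses.

#[global] Instance at_infinity_filter : Filter (@at_infinity R M).
Proof.
apply: filter_from_filter; first by exists set0; exact: compact0.
move=> C D cC cD; exists (C `|` D); first exact: compactU.
by rewrite setCU.
Qed.

Lemma C0_vanishing_outside (f : M -> R) (C : set M) :
  continuous f -> compact C -> (forall x, ~ C x -> f x = 0) -> C0 f.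
Proof.
move=> cf cC fC; split=> //; apply: cvg_near_cst.
by exists C => // x; exact: fC.
Qed.

Definition moments (f : nat -> M -> R) (mu : probability (borel M) R) : fun_space nat R :=
  fun k => \int[mu]_x f k x.

(** Monotone limits of integrals give the cylinder masses, the random branch turns these into a law
    on bit sequences, and [decode] carries that law to [M]. Each stage is defined and measurable on
    all real sequences, whether or not they come from a measure. *)
Lemma prob_coding : exists (f : nat -> M -> R) (dec : fun_space nat R -> prob M),
  [/\ forall k, C0 (f k), forall k x, 0 <= f k x <= 1,
      measurable_fun [set: fun_space nat R] dec &
      forall mu : probability (borel M) R, (dec (moments f mu) : probability (borel M) R) ≡μ mu].
Proof.
have [V [oV cV baseV]] := relatively_compact_base M.
have /choice[F FP] : forall sb : seq bool * bool, exists f : nat -> M -> R,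
   [/\ forall n, continuous (f n),
    forall n x, 0 <= f n x <= 1,
    forall x, {homo f ^~ x : m n / (m <= n)%N >-> m <= n} &
    forall x, f n x @[n --> \oo] --> (\1_(piece V sb.1 sb.2) x : R)].
  by move=> sb; exact/Cb_approx_open/open_piece.
pose f k x : R := if unpickle k is Some (s, b, n) then F (s, b) n x else 0.
(* The upper limit exists and is measurable for every sequence; for a sequence of moments it is a
   genuine limit. *)
pose mass (a : fun_space nat R) (s : seq bool) (b : bool) : R :=
  fine (limn_esup (fun n => (a (pickle (s, b, n)))%:E)).
pose m (a : fun_space nat R) s : R := (if has id s then mass a s true else 1) - mass a s false.
have mmass s b : measurable_fun [set: fun_space nat R] (fun a => mass a s b).
  apply: (measurableT_comp (@fine_measurable _ _ measurableT)).
  apply: measurable_fun_limn_esup => n.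
  by apply/measurable_EFinP; exact: measurable_proj.
have mm s : measurable_fun [set: fun_space nat R] (m ^~ s).
  by apply: measurable_funB => //; case: (has id s).
have mpair (a : fun_space nat R) : measurable_fun [set: R] (fun u : R => (a, u)).
  exact: measurable_fun_pair.
have mb a : measurable_fun [set: R] (fun u : R => decode V (branch (m a) u)).
  apply: (measurableT_comp (measurable_decode oV cV baseV)).
  exact: measurableT_comp (measurable_branch mm) (mpair a).
pose dec a : prob M := (distribution unit_prob (mfun_of (mb a)) : probability (borel M) R).
exists f, dec; split.
- move=> k; rewrite /f; case: unpickle => [[[s b] n]|]; last first.
    apply: (@C0_vanishing_outside _ set0) => //; last exact: compact0.
    by move=> x; exact: cvg_cst.
  have [cf f01 ndf fU] := FP (s, b).
  have [C cC pC] := piece_compact cV s b.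
  apply: (@C0_vanishing_outside _ C) => // x Cx.
  apply/eqP; rewrite eq_le; have /andP[-> _] := f01 n x; rewrite andbT.
  have : F (s, b) ^~ x @ \oo --> 0.
    have := fU x; rewrite indicE memNset//= => h; exact: Cx (pC _ h).
  move=> Fx; rewrite -(cvg_lim _ Fx)//.
  by apply: nondecreasing_cvgn_le; [move=> ? ?; exact: ndf|apply/cvg_ex; exists 0].
- move=> k x; rewrite /f; case: unpickle => [[[s b] n]|]; last by rewrite lexx ler01.
  by have [_ + _ _] := FP (s, b); exact.
- apply: measurable_fun_prob => A mA.
  have mAa : measurable [set z : fun_space nat R * R | A (decode V (branch (m z.1) z.2))].
    rewrite -[X in measurable X]setTI.
    apply: (measurableT_comp (measurable_decode oV cV baseV) (measurable_branch mm)) => //.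
  have := @lebesgue_integral_fubini.measurable_fun_xsection _ _ _ _ R unit_prob _ mAa.
  apply: eq_measurable_fun => a _; apply: etrans _ (esym (distribution_mfun_ofE unit_prob (mb a) A)).
  by congr (unit_prob _); apply/seteqP; split=> u; rewrite /xsection/= inE.
- move=> mu A mA; apply: (etrans (distribution_mfun_ofE unit_prob (mb _) A)).
  have massE s b : (mass (moments f mu) s b)%:E = mu (piece V s b).
    have [cf f01 ndf fU] := FP (s, b).
    have mp : measurable (piece V s b : set (borel M)).
      by apply: sub_sigma_algebra; exact: open_piece.
    have bf n : bounded_fun (F (s, b) n).
      exists 1; split; first exact: num_real.
      move=> z z1 x _ /=; have /andP[f0 f1] := f01 n x.
      by rewrite ger0_norm// (le_trans f1)// ltW.
    have cv : (fun n => (\int[mu]_x F (s, b) n x)%:E) @ \oo --> mu (piece V s b).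
      have -> : mu (piece V s b) = (\int[mu]_x limn (fun n => (F (s, b) n x)%:E))%E.
        rewrite -[in LHS](setIT (piece V s b)) -integral_indic//.
        apply: eq_integral => x _; apply/esym/cvg_lim => //.
        by apply: cvg_EFin; [exact: nearW|exact: fU].
      rewrite (_ : (fun _ => _) = fun n => (\int[mu]_x (F (s, b) n x)%:E)%E); last first.
        apply/funext => n; rewrite fineK//; apply: integrable_fin_num => //.
        exact: integrable_Cb.
      apply: cvg_monotone_convergence => //.
      + by move=> n; apply/measurable_EFinP; exact: (@continuous_measurable_borel R M _ (cf n)).
      + by move=> n x _; rewrite lee_fin; have /andP[] := f01 n x.
      + by move=> x _ i j ij; rewrite lee_fin; exact: ndf.
    rewrite /mass (_ : (fun n => _) = (fun n => (\int[mu]_x F (s, b) n x)%:E)).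
      rewrite is_cvg_limn_esupE; last by apply/cvg_ex; exists (mu (piece V s b)).
      by rewrite (cvg_lim _ cv)// fineK// fin_num_measure.
    by apply/funext => n; rewrite /moments /f pickleK.
  have mE s : (m (moments f mu) s)%:E = mu (code V @^-1` cyl s).
    rewrite probability_code_cyl// /m EFinB massE; congr (_ - _)%E.
    by case: ifP => // _; exact: massE.
  have mc : measurable_fun [set: borel M] (code V) by exact: measurable_code.
  have mcyl s : measurable (code V @^-1` cyl s : set (borel M)).
    by rewrite -[X in measurable X]setTI; apply: mc => //; exact: measurable_cyl.
  have m0 s : 0 <= m (moments f mu) s.
    rewrite -lee_fin (mE s); exact: measure_ge0.
  have m1 : m (moments f mu) [::] = 1.
    have cT : code V @^-1` cyl [::] = setT.
      by apply/seteqP; split=> // x _ i.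
    by apply: EFin_inj; rewrite (mE [::]) cT; exact: (@probability_setT _ _ _ mu).
  have mD s : m (moments f mu) s = m (moments f mu) (rcons s false) + m (moments f mu) (rcons s true).
    have mU := measureU mu (mcyl (rcons s false)) (mcyl (rcons s true)).
    apply: EFin_inj; apply: etrans (mE s) _.
    apply: (etrans _ (congr2 adde (esym (mE (rcons s false))) (esym (mE (rcons s true))))).
    apply: (etrans _ (mU _)); last first.
      apply/seteqP; split=> // x [/(_ (size s)) + /(_ (size s))].
      by rewrite !size_rcons !nth_rcons ltnn eqxx ltnSn => /(_ isT) /= -> /(_ isT).
    congr (mu _); rewrite -preimage_setU; congr (_ @^-1` _); apply/seteqP; split=> b.
      move=> bs; have h c : b (size s) = c -> cyl (rcons s c) b.
        move=> bc i; rewrite size_rcons ltnS nth_rcons.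
        by case: ltngtP => // [si _|-> _]; [exact: bs|exact: bc].
      by case E : (b (size s)); [right|left]; exact: h.
    by move=> [] bs i si; have := bs i; rewrite size_rcons nth_rcons si ltnS (ltnW si); exact.
  have mbr : measurable_fun [set: R] (branch (m (moments f mu))).
    exact: measurableT_comp (measurable_branch mm) (mpair _).
  have eqd : distribution unit_prob (mfun_of mbr) ≡μ distribution mu (mfun_of mc).
    apply: cyl_measure_unique => s.
    apply: (etrans (distribution_mfun_ofE unit_prob mbr _)).
    apply: etrans _ (esym (distribution_mfun_ofE mu mc _)); rewrite -mE.
    exact: unit_prob_cyl.
  have mdA : measurable (decode V @^-1` A).
    by rewrite -[X in measurable X]setTI; exact: (measurable_decode oV cV baseV).
  have eqA : unit_prob (branch (m (moments f mu)) @^-1` (decode V @^-1` A)) =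
      mu (code V @^-1` (decode V @^-1` A)).
    apply: (etrans (esym (distribution_mfun_ofE unit_prob mbr _))).
    by apply: (etrans (eqd _ mdA)); exact: (distribution_mfun_ofE mu mc _).
  apply: (etrans eqA).
  by congr (mu _); apply/seteqP; split=> x /=; rewrite (codeK baseV).
Qed.

End prob_coding.

(** * Loeb spaces *)

Section ultrafilter_limits.
Context (T : Type) (U : set_system T) (UU : UltraFilter U).

Lemma ultra_fmap (S : Type) (f : T -> S) : UltraFilter (f @ U).
Proof.
split=> [|G GG FG]; first exact: fmap_proper_filter.
rewrite eqEsubset; split=> // A GA.
have [//|fA] := in_ultra_setVsetC (f @^-1` A) UU.
have /(@filter_ex _ G)[s []//] : G (A `&` ~` A) by apply: filterI => //; exact: FG.
Qed.

(** By compactness of the unit interval. This is why the test functions below take their values in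
    it. *)
Lemma ultra_cvg01 (R : realType) (g : T -> R) : (forall t, 0 <= g t <= 1) ->
  g @ U --> lim (g @ U).
Proof.
move=> g01; apply/cvg_ex; have FU := ultra_fmap g.
have := @segment_compact R 0 1; rewrite compact_ultra => /(_ _ FU)[].
  by rewrite /=; apply: (@filterE _ U) => t; rewrite /= in_itv/=.
by move=> l [_ gl]; exists l.
Qed.

End ultrafilter_limits.

Section loeb.
Context {R : realType} (T : Type) (U : set_system T) (UU : UltraFilter U).
Context (d : T -> measure_display) (Om : forall t, measurableType (d t)).
Variable P : forall t, probability (Om t) R.

Definition internal (A : forall t, set (Om t)) := forall t, measurable (A t).

(** An internal set of the ultraproduct. The points are the families themselves rather than their
    classes modulo [U]; such sets do not separate equivalent families. *)
Definition ev (A : forall t, set (Om t)) : set (forall t, Om t) :=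
  [set w | U [set t | A t (w t)]].

Lemma ev_sub A B : U [set t | A t `<=` B t] -> ev A `<=` ev B.
Proof. by move=> AB w; apply: filterS2 AB => t; exact. Qed.

Lemma evI A B : ev (fun t => A t `&` B t) = ev A `&` ev B.
Proof.
apply/seteqP; split=> w; last by move=> [h]; apply: filterS2 h => t.
by move=> h; split; apply: filterS h => t [].
Qed.

Lemma evC A : ev (fun t => ~` A t) = ~` ev A.
Proof.
apply/seteqP; split=> w /=.
  move=> h h'; have /(@filter_ex _ U)[t []//] : U ([set t | (~` A t) (w t)] `&` [set t | A t (w t)]).
  exact: filterI.
by have [//|] := in_ultra_setVsetC [set t | A t (w t)] UU.
Qed.

Lemma evU A B : ev (fun t => A t `|` B t) = ev A `|` ev B.
Proof.
have -> : (fun t => A t `|` B t) = (fun t => ~` (~` A t `&` ~` B t)).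
  by apply: functional_extensionality_dep => t; rewrite setCI !setCK.
by rewrite evC evI !evC setCI !setCK.
Qed.

Lemma evT : ev (fun=> setT) = setT.
Proof. by apply/seteqP; split=> // w _; exact: filterE. Qed.

Lemma ev0 : ev (fun=> set0) = set0.
Proof. by apply/seteqP; split=> // w /(@filter_ex _ U)[t []]. Qed.

(** If the inclusion failed along [U], a point of the difference chosen at each [t] would contradict
    the hypothesis. Thus [ev A] determines [A] modulo [U], which makes the Loeb content well
    defined. *)
Lemma ev_subP A B : ev A `<=` ev B -> U [set t | A t `<=` B t].
Proof.
move=> AB; have [//|nAB] := in_ultra_setVsetC [set t | A t `<=` B t] UU.
have H t : exists x, ~ (A t `<=` B t) -> A t x /\ ~ B t x.
  have [h|/existsNP[x /not_implyP h]] := pselect (A t `<=` B t).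
    by exists point.
  by exists x.
pose w t := sval (cid (H t)).
have wA : ev A w by apply: filterS nAB => t /(svalP (cid (H t)))[].
have wB : ev (fun t => ~` B t) w by apply: filterS nAB => t /(svalP (cid (H t)))[].
by move: wB; rewrite evC => /(_ (AB _ wA)).
Qed.

Variable rank : T -> nat.
Hypothesis rankU : forall n, U [set t | (n <= rank t)%N].

(* The ultrafilter is countably incomplete, which makes the ultraproduct saturated. *)
Lemma ev_saturated (B : nat -> forall t, set (Om t)) :
  (forall n, \bigcap_(i < n) ev (B i) !=set0) -> \bigcap_i ev (B i) !=set0.
Proof.
move=> Bn; pose S n t := exists x, forall i, (i < n)%N -> B i t x.
have SU n : U [set t | S n t].
  have [w wB] := Bn n.
  have : U [set t | forall i, (i < n)%N -> B i t (w t)].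
    elim: n wB => [_|n IH wB]; first exact: filterE.
    have h1 : U [set t | forall i, (i < n)%N -> B i t (w t)].
      by apply: IH => i /= ni; apply: wB; exact: ltnW.
    have h2 : U [set t | B n t (w t)] by apply: wB => /=.
    apply: filterS2 h1 h2 => t h1 h2 i; rewrite ltnS leq_eqVlt => /orP[/eqP ->//|].
    exact: h1.
  by apply: filterS => t h; exists (w t).
have S0 t : exists n, `[< S n t >] && (n <= rank t)%N.
  by exists 0%N; rewrite leq0n andbT; apply/asboolP; exists point.
have Sr t n : `[< S n t >] && (n <= rank t)%N -> (n <= rank t)%N by case/andP.
(* At [t] as many of the first sets are met as possible, but at most [rank t]. The bound makes the
   maximum exist, and along [U] it eventually exceeds any given [n]. *)
pose k t := ex_maxn (S0 t) (Sr t).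
have kS t : S (k t) t by rewrite /k; case: ex_maxnP => j /andP[/asboolP].
pose w t := sval (cid (kS t)).
exists w => i _.
have SRU : U ([set t | S i.+1 t] `&` [set t | (i.+1 <= rank t)%N]) by exact: filterI.
apply: filterS SRU => t [Si ir].
apply: (svalP (cid (kS t))); rewrite /k; case: ex_maxnP => j _; apply.
by rewrite ir andbT; exact/asboolP.
Qed.

Definition loeb_mass A : R := lim (fine (P t (A t)) @[t --> U]).

Lemma probability_fine01 d' (X : measurableType d') (Q : probability X R) A :
  measurable A -> 0 <= fine (Q A) <= 1.
Proof.
move=> mA; rewrite fine_ge0//=; have := probability_le1 Q mA.
by rewrite -{1}[Q A]fineK ?fin_num_measure// lee_fin.
Qed.

Lemma loeb_mass_cvg A : internal A -> fine (P t (A t)) @[t --> U] --> loeb_mass A.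
Proof. by move=> mA; apply: ultra_cvg01 => t; exact: probability_fine01. Qed.

Lemma loeb_mass_near A B : U [set t | A t = B t] -> loeb_mass A = loeb_mass B.
Proof.
move=> AB; rewrite /loeb_mass; congr (lim _); apply/seteqP.
by split=> D; rewrite /fmap/=; apply: filterS2 AB => t /= ->.
Qed.

Lemma loeb_mass_ge0 A : internal A -> 0 <= loeb_mass A.
Proof.
move=> mA; apply: limr_ge; first by apply/cvg_ex; exists (loeb_mass A); exact: loeb_mass_cvg.
by apply: filterE => t; exact: fine_ge0.
Qed.

Lemma internalU A B : internal A -> internal B -> internal (fun t => A t `|` B t).
Proof. by move=> mA mB t; exact: measurableU. Qed.

Lemma loeb_massU A B : internal A -> internal B -> U [set t | A t `&` B t = set0] ->
  loeb_mass (fun t => A t `|` B t) = loeb_mass A + loeb_mass B.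
Proof.
move=> mA mB AB; apply: (@cvg_lim _ (@Rhausdorff R)).
have h : fine (P t (A t)) + fine (P t (B t)) @[t --> U] --> loeb_mass A + loeb_mass B.
  by apply: cvgD; exact: loeb_mass_cvg.
apply: cvg_trans h; apply: near_eq_cvg; apply: filterS AB => t AB.
by rewrite measureU// fineD// fin_num_measure.
Qed.

Definition loeb_algebra := forall t, Om t.

HB.instance Definition _ := gen_eqMixin loeb_algebra.
HB.instance Definition _ := gen_choiceMixin loeb_algebra.
HB.instance Definition _ := isPointed.Build loeb_algebra (fun=> point).

Definition loeb_sets : set (set loeb_algebra) := [set X | exists A, internal A /\ X = ev A].

Let loeb_sets0 : loeb_sets set0.
Proof. by exists (fun=> set0); split=> [t|]; [exact: measurable0|rewrite ev0]. Qed.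

Let loeb_setsU : setU_closed loeb_sets.
Proof.
move=> _ _ [A [mA ->]] [B [mB ->]]; exists (fun t => A t `|` B t).
by rewrite evU; split=> //; exact: internalU.
Qed.

Let loeb_setsC : setC_closed loeb_sets.
Proof.
move=> _ [A [mA ->]]; exists (fun t => ~` A t).
by rewrite evC; split=> // t; exact: measurableC.
Qed.

Definition loeb_display : measure_display.
Proof. by constructor. Qed.

HB.instance Definition _ := @isAlgebraOfSets.Build loeb_display loeb_algebra loeb_sets
  loeb_sets0 loeb_setsU loeb_setsC.

Definition loeb_content (X : set loeb_algebra) : \bar R :=
  if pselect (exists A, internal A /\ X = ev A) is left H
  then (loeb_mass (sval (cid H)))%:E else 0%E.

Lemma loeb_contentE A : internal A -> loeb_content (ev A) = (loeb_mass A)%:E.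
Proof.
move=> mA; rewrite /loeb_content; case: pselect => [H|[]]; last by exists A.
case: (cid H) => B [mB AB] /=; congr (_%:E); apply: loeb_mass_near.
have h1 : ev A `<=` ev B by rewrite AB.
have h2 : ev B `<=` ev A by rewrite AB.
by apply: filterS2 (ev_subP h1) (ev_subP h2) => t ? ?; apply/seteqP.
Qed.

Let loeb_content0 : loeb_content set0 = 0%E.
Proof.
rewrite -ev0 loeb_contentE; last by move=> t; exact: measurable0.
congr (_%:E); apply: (@cvg_lim _ (@Rhausdorff R)); apply: cvg_near_cst.
by apply: filterE => t; rewrite measure0.
Qed.

Let loeb_content_ge0 X : (0 <= loeb_content X)%E.
Proof.
rewrite /loeb_content; case: pselect => [H|_] //.
by case: (cid H) => A [mA _] /=; rewrite lee_fin loeb_mass_ge0.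
Qed.

Let loeb_contentU X Y : measurable X -> measurable Y -> X `&` Y = set0 ->
  loeb_content (X `|` Y) = (loeb_content X + loeb_content Y)%E.
Proof.
move=> [A [mA ->]] [B [mB ->]]; rewrite -evI -evU => AB.
rewrite !loeb_contentE//; last exact: internalU.
rewrite -EFinD; congr (_%:E); apply: loeb_massU => //.
have : ev (fun t => A t `&` B t) `<=` ev (fun=> set0) by rewrite AB.
by move=> /ev_subP; apply: filterS => t /=; rewrite subset0.
Qed.

Let loeb_content_sum (F : (set loeb_algebra)^nat) n : (forall i, measurable (F i)) ->
  trivIset setT F -> loeb_content (\big[setU/set0]_(i < n) F i) = (\sum_(i < n) loeb_content (F i))%E.
Proof.
move=> mF tF; elim: n => [|n IH]; first by rewrite !big_ord0 loeb_content0.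
rewrite !big_ord_recr/= loeb_contentU ?IH//; first exact: bigsetU_measurable.
apply/seteqP; split=> // w []; rewrite -bigcup_mkord => -[i /= ni Fi] Fn.
have /trivIsetP/(_ i n I I) := tF; rewrite (ltn_eqF ni) => /(_ isT) /seteqP[h _].
exact: (h w (conj Fi Fn)).
Qed.

(** If an internal set is a countable union of internal sets, finitely many of them already cover
    it: otherwise saturation would give a point of the union lying in none of them. By disjointness
    all later sets are empty, and finite additivity suffices. *)
Let loeb_content_sigma_additive : semi_sigma_additive loeb_content.
Proof.
move=> F mF tF [C [mC CE]].
have [B BP] : exists B : nat -> forall t, set (Om t), forall i, internal (B i) /\ F i = ev (B i).
  exists (fun i => sval (cid (mF i))) => i; exact: (svalP (cid (mF i))).
have [N NP] : exists N, \bigcup_i F i `<=` \bigcup_(i < N) F i.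
  apply: contrapT => /forallNP h.
  pose D i := if i is j.+1 then (fun t => ~` B j t) else C.
  have [w wD] : \bigcap_i ev (D i) !=set0.
    apply: ev_saturated => n; have /existsNP[w /not_implyP[wF wN]] := h n.
    exists w => -[|i] /= ni; first by rewrite /D -CE.
    rewrite /D evC => wB; apply: wN; exists i; first exact: ltnW.
    by have [_ ->] := BP i.
  have : (\bigcup_i F i) w by rewrite CE; exact: (wD 0%N).
  move=> [i _]; have [_ ->] := BP i.
  by have := wD i.+1 I; rewrite /D evC; exact.
have FN i : (N <= i)%N -> F i = set0.
  move=> Ni; apply/seteqP; split=> // w Fiw.
  have [j /= jN Fjw] := NP w (ex_intro2 _ _ i I Fiw).
  have /trivIsetP/(_ j i I I) := tF; rewrite ltn_eqF ?(leq_trans jN)//.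
  by move=> /(_ isT) /seteqP[h _]; exact: (h w (conj Fjw Fiw)).
have FE n : (N <= n)%N -> \big[setU/set0]_(i < n) F i = \bigcup_i F i.
  move=> Nn; rewrite -bigcup_mkord; apply/seteqP; split; first by move=> w [i _ Fi]; exists i.
  by apply: (subset_trans NP) => w [i /= iN]; exists i => //=; exact: leq_trans Nn.
apply: cvg_near_cst; exists N => // n /= Nn.
by rewrite big_mkord -loeb_content_sum// FE.
Qed.

HB.instance Definition _ := isMeasure.Build loeb_display loeb_algebra R loeb_content
  loeb_content0 loeb_content_ge0 loeb_content_sigma_additive.

Definition loeb_space := g_sigma_algebraType (@measurable _ loeb_algebra).

Definition loeb_measure : set loeb_space -> \bar R := measure_extension loeb_content.

HB.instance Definition _ := Measure.on loeb_measure.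

Lemma measurable_ev A : internal A -> measurable (ev A : set loeb_space).
Proof. by move=> mA; apply: sub_sigma_algebra; exists A. Qed.

Lemma loeb_measureE A : internal A -> loeb_measure (ev A) = (loeb_mass A)%:E.
Proof.
move=> mA; rewrite -loeb_contentE//.
by rewrite /loeb_measure /measure_extension measurable_mu_extE//; exists A.
Qed.

Let loeb_measureT : loeb_measure setT = 1%E.
Proof.
rewrite -evT loeb_measureE//; congr (_%:E); apply: (@cvg_lim _ (@Rhausdorff R)).
by apply: cvg_near_cst; apply: filterE => t; rewrite probability_setT.
Qed.

HB.instance Definition _ := Measure_isProbability.Build _ _ _ loeb_measure loeb_measureT.

Lemma loeb_measure_cst A a : internal A -> U [set t | P t (A t) = a] ->
  loeb_measure (ev A) = a.
Proof.
move=> mA Aa; rewrite loeb_measureE//; have [t ta] := filter_ex Aa.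
rewrite -ta -[RHS]fineK ?fin_num_measure//; congr (_%:E).
apply: (@cvg_lim _ (@Rhausdorff R)); apply: cvg_near_cst; apply: filterS Aa => t' /= ->.
by rewrite -ta.
Qed.

Lemma loeb_measure_le A (a : \bar R) : internal A -> U [set t | (P t (A t) <= a)%E] ->
  (loeb_measure (ev A) <= a)%E.
Proof.
move=> mA Aa; rewrite loeb_measureE//; case: a Aa => [a| |] Aa; last 2 first.
- exact: leey.
- by have [t /= /(le_trans (measure_ge0 (P t) (A t)))] := filter_ex Aa.
rewrite lee_fin; apply: limr_le.
  by apply/cvg_ex; exists (loeb_mass A); exact: loeb_mass_cvg.
by apply: filterS Aa => t /=; rewrite -[X in (X <= _)%E]fineK ?fin_num_measure.
Qed.

End loeb.

Lemma measure_ae_eq d (T : measurableType d) (R : realType) (m : {measure set T -> \bar R})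
    (A B : set T) : measurable A -> measurable B ->
  {ae m, forall x, A x <-> B x} -> m A = m B.
Proof.
move=> mA mB AB; rewrite -(setIT A) -(setIT B) -!integral_indic//.
apply: ae_eq_integral => //.
- by apply/measurable_EFinP; exact: measurable_indic.
- by apply/measurable_EFinP; exact: measurable_indic.
- apply: filterS AB => x AB _; congr (_%:E); rewrite !indicE.
  suff -> : (x \in A) = (x \in B) by [].
  by apply/idP/idP; rewrite !inE => /AB.
Qed.

(** * Transfer of laws and standard parts to the Loeb space *)

Section transfer.
Context {R : realType} (T : Type) (U : set_system T) (UU : UltraFilter U).
Context (d : T -> measure_display) (Om : forall t, measurableType (d t)).
Variable P : forall t, probability (Om t) R.
Variables (rank : T -> nat) (rankU : forall n, U [set t | (n <= rank t)%N]).

Local Notation Q := (loeb_measure P rankU).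

Lemma ae_evP (A : forall t, set (Om t)) (B : forall t, set (Om t)) :
  internal A -> internal B -> U [set t | {ae P t, forall x, A t x <-> B t x}] ->
  {ae Q, forall w, ev U A w <-> ev U B w}.
Proof.
move=> mA mB AB.
pose D t := (A t `\` B t) `|` (B t `\` A t).
have mD : internal D by move=> t; apply: measurableU; exact: measurableD.
exists (ev U D); split.
- exact: measurable_ev.
- apply: loeb_measure_cst => //; apply: filterS AB => t ABt.
  apply/(negligibleP (P t) (mD t)); apply: negligibleS ABt => x /= [[Ax nBx]|[Bx nAx]] h.
    by apply: nBx; exact/h.
  by apply: nAx; exact/h.
- move=> w /= h; rewrite /D evU; apply: contrapT => /not_orP[h1 h2]; apply: h.
  split=> h.
    apply: contrapT => nh; apply: h1; rewrite (evI _ A (fun t => ~` B t)); split=> //.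
    by rewrite evC.
  apply: contrapT => nh; apply: h2; rewrite (evI _ B (fun t => ~` A t)); split=> //.
  by rewrite evC.
Qed.

#[global] Instance loeb_ae_filter : Filter (almost_everywhere Q).
Proof. exact: ae_filter_ringOfSetsType. Qed.

Section law.
Context d' (S : measurableType d') (l : probability S R) (Z : forall t, Om t -> S).
Arguments Z : clear implicits.
Hypothesis mZ : forall t, measurable_fun [set: Om t] (Z t).
Hypothesis lawZ : U [set t | forall A, measurable A -> P t (Z t @^-1` A) = l A].

Lemma internal_preimage A : measurable A -> internal (fun t => Z t @^-1` A).
Proof. by move=> mA t; rewrite -[X in measurable X]setTI; exact: mZ. Qed.

Lemma loeb_law A : measurable A -> Q (ev U (fun t => Z t @^-1` A)) = l A.
Proof.
move=> mA; apply: loeb_measure_cst; first exact: internal_preimage.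
by apply: filterS lawZ => t; exact.
Qed.

(** The exceptional event lies in every remainder [ev] of [B k], whose Loeb probability is
    [l (B k)]. This tends to zero because [l] is one countably additive law, the same along [U]. *)
Lemma ae_ev_bigcup (A : nat -> set S) : (forall n, measurable (A n)) ->
  {ae Q, forall w, ev U (fun t => Z t @^-1` (\bigcup_n A n)) w ->
     exists n, ev U (fun t => Z t @^-1` (A n)) w}.
Proof.
move=> mA; pose B k := \bigcup_n A n `\` \big[setU/set0]_(n < k) A n.
have mU k : measurable (\big[setU/set0]_(n < k) A n) by exact: bigsetU_measurable.
have mB k : measurable (B k).
  by apply: measurableD => //; exact: bigcup_measurable.
exists (\bigcap_k ev U (fun t => Z t @^-1` (B k))); split.
- by apply: bigcapT_measurable => k; apply: measurable_ev; exact: internal_preimage.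
- apply/eqP; rewrite eq_le measure_ge0 andbT.
  have B0 : l (B k) @[k --> \oo] --> 0%E.
    rewrite -(measure0 l) (_ : set0 = \bigcap_k B k); last first.
      apply/esym/seteqP; split=> // x Bx; have [[n _ An] _] := Bx 0%N I.
      have [_] := Bx n.+1 I; apply; rewrite -bigcup_mkord; by exists n => /=.
    apply: nonincreasing_cvg_mu => //.
    + by rewrite -ge0_fin_numE// fin_num_measure.
    + exact: bigcapT_measurable.
    + move=> m n mn; apply/subsetPset => x [h1 h2]; split=> //.
      move: h2; apply: contra_not; rewrite -!bigcup_mkord => -[i /= im Ai].
      by exists i => //=; exact: leq_trans im mn.
  rewrite -(cvg_lim _ B0)//; apply: lime_ge; first by apply/cvg_ex; exists 0%E.
  apply: nearW => k; rewrite -(loeb_law (mB k)).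
  apply: le_measure; rewrite ?inE.
  + by apply: bigcapT_measurable => i; apply: measurable_ev; exact: internal_preimage.
  + by apply: measurable_ev; exact: internal_preimage.
  + by move=> w; apply.
- move=> w /= /not_implyP[wA nA] k _.
  rewrite /B (_ : (fun t => _) = (fun t => Z t @^-1` (\bigcup_n A n) `&`
      ~` (Z t @^-1` (\big[setU/set0]_(n < k) A n)))) ?evI; last first.
    by apply: functional_extensionality_dep => t; rewrite setDE preimage_setI preimage_setC.
  split=> //; rewrite evC => wk; apply: nA.
  elim: k wk => [|k IH].
    rewrite (_ : (fun t => _) = (fun=> set0)) ?ev0//.
    by apply: functional_extensionality_dep => t; rewrite big_ord0 preimage_set0.
  rewrite (_ : (fun t => _) = (fun t => Z t @^-1` (\big[setU/set0]_(n < k) A n) `|`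
      (Z t @^-1` A k))); first by rewrite evU => -[//|Ak]; exists k.
  by apply: functional_extensionality_dep => t; rewrite big_ord_recr/= preimage_setU.
Qed.

(** [Z'] acts as a standard part of the internal variable [Z]. By [ae_ev_bigcup] the measurable sets
    on which the two agree almost surely form a sigma-field, so a generator is enough. *)
Lemma ae_ev_transfer (Z' : loeb_space UU Om -> S) (G : set (set S)) :
  measurable `<=` <<s G>> -> G `<=` measurable ->
  (forall A, G A -> {ae Q, forall w, A (Z' w) <-> ev U (fun t => Z t @^-1` A) w}) ->
  forall A, measurable A -> {ae Q, forall w, A (Z' w) <-> ev U (fun t => Z t @^-1` A) w}.
Proof.
move=> SG GS ZG A mA.
suff [] : measurable A /\ {ae Q, forall w, A (Z' w) <-> ev U (fun t => Z t @^-1` A) w} by [].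
move: A {mA} (SG _ mA); apply: smallest_sub; last first.
  by move=> A GA; split; [exact: GS|exact: ZG].
split.
- split=> //; apply: aeW => w; split=> // h.
  by move: h; rewrite (_ : (fun t => _) = (fun=> set0)) ?ev0// ;
    apply: functional_extensionality_dep => t; rewrite preimage_set0.
- move=> A [mA hA]; rewrite setTD; split; first exact: measurableC.
  apply: filterS hA => w /= h.
  by rewrite (evC _ (fun t => Z t @^-1` A)) /=; split; apply: contra_not => /h.
- move=> A hA; have mA n : measurable (A n) by have [] := hA n.
  split; first exact: bigcup_measurable.
  have h1 : {ae Q, forall w, forall n, A n (Z' w) <-> ev U (fun t => Z t @^-1` A n) w}.
    by apply: ae_foralln => n; have [] := hA n.
  apply: filterS2 h1 (ae_ev_bigcup mA) => w h1 h2.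
  split.
    move=> [n _ /h1]; apply: ev_sub; apply: filterE => t x Ax; by exists n.
  by move=> /h2[n /h1]; exists n.
Qed.

Lemma loeb_law_transfer (Z' : loeb_space UU Om -> S) (G : set (set S)) :
  measurable `<=` <<s G>> -> G `<=` measurable ->
  measurable_fun [set: loeb_space UU Om] Z' ->
  (forall A, G A -> {ae Q, forall w, A (Z' w) <-> ev U (fun t => Z t @^-1` A) w}) ->
  forall A, measurable A -> Q (Z' @^-1` A) = l A.
Proof.
move=> SG GS mZ' ZG A mA; rewrite -(loeb_law mA).
have mZA : measurable (Z' @^-1` A) by rewrite -[X in measurable X]setTI; exact: mZ'.
have mev := measurable_ev (UU := UU) (internal_preimage mA).
by apply: measure_ae_eq => //; exact: (ae_ev_transfer SG GS ZG).
Qed.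

End law.

Section standard_part.
Implicit Types y : forall t, Om t -> R.

Definition standard_part y (w : loeb_space UU Om) : R := lim (y t (w t) @[t --> U]).

Variable y : forall t, Om t -> R.
Arguments y : clear implicits.
Hypothesis my : forall t, measurable_fun [set: Om t] (y t).
Hypothesis y01 : forall t x, 0 <= y t x <= 1.

Lemma standard_part_cvg w : y t (w t) @[t --> U] --> standard_part y w.
Proof. by apply: ultra_cvg01 => t; exact: y01. Qed.

Lemma internal_gt a : internal (fun t => [set x | a < y t x]).
Proof.
move=> t; rewrite -[X in measurable X]setTI (_ : [set x | _] = y t @^-1` `]a, +oo[%classic).
  exact: my.
by apply/seteqP; split=> x /=; rewrite in_itv/= andbT.
Qed.

(** A limit turns a strict inequality into a weak one, so the event is a countable union of internal
    events with a margin rather than a single internal event. *)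
Lemma standard_part_gtP a w : a < standard_part y w <->
  exists n : nat, ev U (fun t => [set x | a + n.+1%:R^-1 < y t x]) w.
Proof.
split=> [aw|[n h]]; last first.
  have : a + n.+1%:R^-1 <= standard_part y w.
    apply: limr_ge; first by apply/cvg_ex; exists (standard_part y w); exact: standard_part_cvg.
    by apply: filterS h => t /ltW.
  by apply: lt_le_trans; rewrite ltrDl invr_gt0.
have [n an] : exists n : nat, a + n.+1%:R^-1 < standard_part y w.
  have e0 : 0 < standard_part y w - a by rewrite subr_gt0.
  exists (Num.truncn (standard_part y w - a)^-1).
  by rewrite addrC -ltrBrDr invf_plt ?posrE// Num.Theory.truncnS_gt.
exists n; have := @standard_part_cvg w => /cvgr_gt/(_ _ an); exact.
Qed.

Lemma standard_part_gt_ev a w : a < standard_part y w -> ev U (fun t => [set x | a < y t x]) w.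
Proof.
by move=> aw; have := @standard_part_cvg w => /cvgr_gt/(_ _ aw); exact.
Qed.

Lemma measurable_standard_part : measurable_fun [set: loeb_space UU Om] (standard_part y).
Proof.
apply: (measurability _ (RGenOInfty.measurableE R)) => //.
move=> _ [_ [a ->] <-]; rewrite setTI.
rewrite (_ : _ @^-1` _ = \bigcup_n ev U (fun t => [set x | a + n.+1%:R^-1 < y t x])).
  by apply: bigcupT_measurable => n; apply: measurable_ev; exact: internal_gt.
apply/seteqP; split=> w /=; rewrite in_itv/= andbT.
  by move=> /standard_part_gtP[n h]; exists n.
by move=> [n _ h]; apply/standard_part_gtP; exists n.
Qed.

End standard_part.
End transfer.

Section standard_part_law.
Context {R : realType} (T : Type) (U : set_system T) (UU : UltraFilter U).
Context (d : T -> measure_display) (Om : forall t, measurableType (d t)).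
Variable P : forall t, probability (Om t) R.
Variables (rank : T -> nat) (rankU : forall n, U [set t | (n <= rank t)%N]).

Local Notation Q := (loeb_measure P rankU).

(** A strict inequality for the limits passes to the components along [U], so the event is contained
    in an internal one. *)
Lemma standard_part_dist_le (y y' : forall t, Om t -> R) (e : R) (c : \bar R) :
  (forall t, measurable_fun [set: Om t] (y t)) -> (forall t x, 0 <= y t x <= 1) ->
  (forall t, measurable_fun [set: Om t] (y' t)) -> (forall t x, 0 <= y' t x <= 1) ->
  U [set t | (P t [set x | (e < `|y t x - y' t x|)%R] <= c)%E] ->
  (Q [set w | (e < `|standard_part (UU := UU) y w - standard_part (UU := UU) y' w|)%R] <= c)%E.
Proof.
move=> my y01 my' y01' yy'.
have mi : internal (fun t => [set x | e < `|y t x - y' t x|]).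
  move=> t; rewrite -[X in measurable X]setTI.
  rewrite (_ : [set x | _] = (fun x => `|y t x - y' t x|) @^-1` `]e, +oo[%classic).
    by apply: measurableT_comp => //; exact: measurable_funB.
  by apply/seteqP; split=> x /=; rewrite in_itv/= andbT.
have hle := loeb_measure_le UU rankU mi yy'.
apply: (@le_trans _ _ _ _ _ _ hle).
apply: le_measure; rewrite ?inE.
- rewrite -[X in measurable X]setTI (_ : [set w | _] =
    (fun w => `|standard_part (UU := UU) y w - standard_part (UU := UU) y' w|) @^-1` `]e, +oo[%classic).
    apply: measurableT_comp => //; apply: measurable_funB; exact: measurable_standard_part.
  by apply/seteqP; split=> x /=; rewrite in_itv/= andbT.
- exact: measurable_ev.
- move=> w /= ew.
  have h : `|y t (w t) - y' t (w t)| @[t --> U] -->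
      `|standard_part (UU := UU) y w - standard_part (UU := UU) y' w|.
    by apply: cvg_norm; apply: cvgB; exact: standard_part_cvg.
  by move: h => /cvgr_gt/(_ _ ew).
Qed.

Variables (l : probability (fun_space nat R) R) (Z : forall t, Om t -> fun_space nat R).
Arguments Z : clear implicits.
Hypothesis mZ : forall t, measurable_fun [set: Om t] (Z t).
Hypothesis Z01 : forall t x k, 0 <= Z t x k <= 1.
Hypothesis lawZ : U [set t | forall A, measurable A -> P t (Z t @^-1` A) = l A].

Definition standard_parts (w : loeb_space UU Om) : fun_space nat R :=
  fun k => standard_part (fun t x => Z t x k) w.

Lemma measurable_standard_parts : measurable_fun [set: loeb_space UU Om] standard_parts.
Proof.
apply: measurable_fun_space => k; apply: measurable_standard_part => //.
by move=> t; have := measurableT_comp (@measurable_proj nat _ R k) (@mZ t).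
Qed.

Definition coordinate_gt : set (set (fun_space nat R)) :=
  [set A | exists k a, A = [set f | a < f k]].

Lemma coordinate_gt_measurable : coordinate_gt `<=` measurable.
Proof.
move=> _ [k [a ->]]; rewrite -[X in measurable X]setTI.
rewrite (_ : [set f | _] = (fun f : fun_space nat R => f k) @^-1` `]a, +oo[%classic).
  exact: measurable_proj.
by apply/seteqP; split=> x /=; rewrite in_itv/= andbT.
Qed.

Lemma measurable_coordinate_gt : @measurable _ (fun_space nat R) `<=` <<s coordinate_gt >>.
Proof.
apply: smallest_sub; first exact: smallest_sigma_algebra.
move=> _ [k _ [B mB <-]].
pose S := g_sigma_algebraType coordinate_gt.
have : measurable_fun [set: S] (fun f : S => f k).
  apply: (measurability _ (RGenOInfty.measurableE R)) => //.
  move=> _ [_ [a ->] <-]; rewrite setTI; apply: sub_sigma_algebra.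
  by exists k, a; apply/seteqP; split=> x /=; rewrite in_itv/= andbT.
by move=> /(_ measurableT B mB).
Qed.

(** It suffices to treat open half-lines. Such a set is the union of the half-lines with margin
    [n.+1%:R^-1], and [ae_ev_bigcup] supplies, almost surely, the margin that passing to the
    standard part requires. *)
Lemma ae_standard_parts A : measurable A ->
  {ae Q, forall w, A (standard_parts w) <-> ev U (fun t => Z t @^-1` A) w}.
Proof.
move=> mA; apply: (ae_ev_transfer mZ lawZ (Z' := standard_parts) measurable_coordinate_gt coordinate_gt_measurable) => // {A mA}.
move=> _ [k [a ->]].
pose B n : set (fun_space nat R) := [set f | a + n.+1%:R^-1 < f k].
have mB n : measurable (B n) by apply: coordinate_gt_measurable; exists k, (a + n.+1%:R^-1).
have : [set f : fun_space nat R | a < f k] = \bigcup_n B n.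
  apply/seteqP; split=> [f af|f [n _]]; last first.
    by rewrite /B/=; apply: le_lt_trans; rewrite lerDl invr_ge0.
  have e0 : 0 < f k - a by rewrite subr_gt0.
  exists (Num.truncn (f k - a)^-1) => //; rewrite /B/=.
  by rewrite addrC -ltrBrDr invf_plt ?posrE// Num.Theory.truncnS_gt.
move=> aE; have := ae_ev_bigcup UU rankU mZ lawZ mB; rewrite -aE.
apply: filterS => w h; split=> [aw|/h[n hn]]; first exact: standard_part_gt_ev aw.
apply/standard_part_gtP => //; exists n; exact: hn.
Qed.

Lemma standard_parts_law A : measurable A -> Q (standard_parts @^-1` A) = l A.
Proof.
move=> mA; rewrite -(loeb_law UU rankU mZ lawZ mA).
apply: measure_ae_eq => //.
- by rewrite -[X in measurable X]setTI; exact: measurable_standard_parts.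
- by apply: measurable_ev; exact: internal_preimage.
- exact: ae_standard_parts.
Qed.

End standard_part_law.

(** * Measurable modifications *)

Section modification.
Context {R : realType} dX (X : measurableType dX) dO (Om : measurableType dO).
Variables (P : probability Om R) (Y : X -> Om -> R).
Hypothesis mY : forall u, measurable_fun [set: Om] (Y u).

Definition scale (n : nat) : R := 2^-1 ^+ n.

Hypothesis locally_close : forall n, exists (V : nat -> set X) (c : nat -> X),
  [/\ forall i, measurable (V i), forall u, exists i, V i u &
   forall i u, V i u ->
     (P [set w | (scale n < `|Y u w - Y (c i) w|)%R] <= (scale n)%:E)%E].

(* On each cell of a countable measurable partition of the parameter space the process
   is frozen at one parameter; Borel-Cantelli gives convergence along the scales. *)
Lemma measurable_modification : exists Y' : X * Om -> R,
  measurable_fun [set: X * Om] Y' /\ forall u, {ae P, forall w, Y' (u, w) = Y u w}.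
Proof.
have /choice[V /choice[c VcP]] := locally_close.
have mV n i : measurable (V n i) by have [] := VcP n.
have Vx n u : exists i, `[< V n i u >].
  by have [_ /(_ u)[i Vi] _] := VcP n; exists i; exact/asboolP.
(* Taking the least index turns the measurable cover into a measurable partition. *)
pose ix n u := ex_minn (Vx n u).
have Vix n u : V n (ix n u) u by rewrite /ix; case: ex_minnP => i /asboolP.
have mix n i : measurable [set u | ix n u = i].
  rewrite (_ : [set u | _] = V n i `\` \big[setU/set0]_(j < i) V n j).
    by apply: measurableD => //; exact: bigsetU_measurable.
  apply/seteqP; split=> u /=; rewrite -bigcup_mkord.
    rewrite /ix; case: ex_minnP => j /asboolP Vj jmin <-; split=> // -[k /= kj Vk].
    by have := jmin k (asboolT Vk); rewrite leqNgt kj.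
  move=> [Vi nV]; rewrite /ix; case: ex_minnP => j /asboolP Vj jmin.
  apply/eqP; rewrite eqn_leq jmin ?asboolT//= leqNgt; apply/negP => ji.
  by apply: nV; exists j.
pose Yn n (z : X * Om) : R := Y (c n (ix n z.1)) z.2.
have mYn n : measurable_fun [set: X * Om] (Yn n).
  move=> _ B mB; rewrite setTI (_ : _ @^-1` B =
      \bigcup_i ([set u | ix n u = i] `*` (Y (c n i) @^-1` B))).
    apply: bigcupT_measurable => i; apply: measurableX => //.
    by rewrite -[X in measurable X]setTI; exact: mY.
  apply/seteqP; split=> [[u w] /= h|[u w] [i _ [/= <-]]//].
  by exists (ix n u).
exists (fun z => fine (limn_esup (fun n => (Yn n z)%:E))); split.
  apply: (measurableT_comp (@fine_measurable _ _ measurableT)).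
  by apply: measurable_fun_limn_esup => n; exact/measurable_EFinP.
move=> u; pose F n := [set w | (scale n < `|Y u w - Yn n (u, w)|)%R].
have mF n : measurable (F n).
  rewrite -[X in measurable X]setTI (_ : F n = (fun w => `|Y u w - Yn n (u, w)|) @^-1` `]scale n, +oo[%classic).
    by apply: measurableT_comp => //; apply: measurable_funB => //; exact: (mY (c n (ix n u))).
  by apply/seteqP; split=> x /=; rewrite /F/= in_itv/= andbT.
have F0 : P (lim_sup_set F) = 0%E.
  apply: lim_sup_set_cvg0 => //.
  apply: (@le_lt_trans _ _ (\sum_(0 <= n <oo) (scale n)%:E)%E).
    apply: lee_nneseries => // n _.
    have [_ _ h] := VcP n; exact: h (Vix n u).
  rewrite (_ : \sum_(0 <= n <oo) _ = 2%:E)%E ?ltry//.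
  have := @cvg_geometric_eseries_half R 2 0; rewrite expr0 divr1 => /cvg_lim <- //.
  congr (limn _); apply/funext => n; apply: eq_bigr => k _; congr (_%:E).
  by rewrite /scale addn1 exprVn natrX exprS invfM mulrA divff ?mul1r.
have mL : measurable (lim_sup_set F).
  apply: bigcapT_measurable => n; exact: bigcup_measurable.
exists (lim_sup_set F); split=> // w /= nw; apply: contrapT => Lw; apply: nw.
have [n hn] : exists n, forall j, (n <= j)%N -> `|Y u w - Yn j (u, w)| <= scale j.
  apply: contrapT => /forallNP h; apply: Lw => n _.
  have /existsNP[j /not_implyP[nj /negP hj]] := h n.
  by exists j => //; rewrite /F/= ltNge.
have Yw : Yn j (u, w) @[j --> \oo] --> Y u w.
  apply/cvgrPdist_le => e e0.
  have : scale j @[j --> \oo] --> (0 : R).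
    by apply: cvg_expr; rewrite ger0_norm ?invr_ge0// invf_lt1// ltr1n.
  move=> /cvgrPdist_le/(_ _ e0) [m _ hm].
  exists (maxn n m) => // j; rewrite /= geq_max => /andP[nj mj].
  apply: (le_trans (hn _ nj)); have := hm j mj.
  by rewrite sub0r normrN; apply: le_trans; exact: ler_norm.
have YE : (Yn j (u, w))%:E @[j --> \oo] --> (Y u w)%:E by apply: cvg_EFin => //; exact: nearW.
by rewrite is_cvg_limn_esupE ?(cvg_lim _ YE)//; apply/cvg_ex; exists (Y u w)%:E.
Qed.

End modification.

(** * Estimates for the semigroup *)

Section integrals01.
Context {R : realType}.
Local Open Scope ereal_scope.

Lemma integrable01 d (T : measurableType d) (m : probability T R) (g : T -> R) :
  measurable_fun [set: T] g -> (forall x, (`|g x| <= 1)%R) ->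
  m.-integrable [set: T] (EFin \o g).
Proof.
move=> mg g1; apply: measurable_bounded_integrable => //.
  by rewrite (le_lt_trans (probability_le1 _ _)) ?ltry.
by exists 1%R; split; [exact: num_real|move=> z z1 x _ /=; exact: le_trans (g1 x) (ltW z1)].
Qed.

Lemma Rintegral01 d (T : measurableType d) (m : probability T R) (g : T -> R) :
  measurable_fun [set: T] g -> (forall x, (0 <= g x <= 1)%R) ->
  (0 <= \int[m]_x g x <= 1)%R.
Proof.
move=> mg g01; apply/andP; split.
  by apply: Rintegral_ge0 => x _; case/andP: (g01 x).
have -> : 1%R = (\int[m]_x cst 1 x)%R :> R.
  by rewrite Rintegral_cst//= probability_setT mulr1.
apply: le_Rintegral => //.
- apply: integrable01 => // x; have /andP[g0 g1] := g01 x; by rewrite ger0_norm.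
- by apply: integrable01 => // x; rewrite normr1.
- by move=> x _; case/andP: (g01 x).
Qed.

(** Turns smallness in probability, the form of the semigroup axioms, into smallness in mean: below
    the threshold [g] is at most [a], above it at most 1. *)
Lemma integral_le_threshold d (T : measurableType d) (m : probability T R) (g : T -> R) (a : R) :
  measurable_fun [set: T] g -> (forall x, (0 <= g x <= 1)%R) -> (0 <= a)%R ->
  \int[m]_x (g x)%:E <= a%:E + m [set x | (a <= g x)%R].
Proof.
move=> mg g01 a0.
have mA : measurable [set x | (a <= g x)%R].
  rewrite -[X in measurable X]setTI (_ : [set x | _] = g @^-1` `[a, +oo[%classic); first exact: mg.
  by apply/seteqP; split=> x /=; rewrite in_itv/= andbT.
have -> : a%:E + m [set x | (a <= g x)%R] = \int[m]_x (a%:E + (\1_[set x | (a <= g x)%R] x)%:E).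
  rewrite ge0_integralD//; last first.
    by apply/measurable_EFinP; exact: measurable_indic.
  rewrite integral_cst// integral_indic// setIT.
  congr (_ + _); rewrite -[LHS]mule1; congr (_ * _).
  exact/esym/(@probability_setT _ _ _ m).
apply: ge0_le_integral => //.
- by move=> x _; rewrite lee_fin; case/andP: (g01 x).
- exact/measurable_EFinP.
- by apply/measurable_EFinP; apply: measurable_funD => //; exact: measurable_indic.
- move=> x _; rewrite -EFinD lee_fin indicE; have [xA|xA] := boolP (x \in _).
    by have /andP[_ g1] := g01 x; rewrite (le_trans g1)// lerDr.
  by move: xA; rewrite notin_setE/= addr0 => /negP; rewrite -ltNge => /ltW.
Qed.

Lemma abs_Rintegral_le d (T : measurableType d) (m : probability T R) (g : T -> R) :
  measurable_fun [set: T] g -> (forall x, (`|g x| <= 1)%R) ->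
  `|(\int[m]_x g x)%R|%:E <= \int[m]_x `|g x|%:E.
Proof.
move=> mg g1; have ig := integrable01 m mg g1.
rewrite -[leLHS]/(`|(\int[m]_x g x)%R%:E|) /Rintegral fineK; last exact: integrable_fin_num.
by apply: (le_trans (le_abse_integral _ _ _)) => //; exact/measurable_EFinP.
Qed.

End integrals01.

(** * Integrals of functions against random kernels *)

Section kernel_integrals.
Context {R : realType} {M : lcsMetricType R}.
Local Open Scope ereal_scope.

Lemma measurable_Rintegral_prob d (X : measurableType d) (k : X -> prob M)
    (g : X * borel M -> R) :
  measurable_fun [set: X] k -> measurable_fun [set: X * borel M] g ->
  (forall z, (0 <= g z)%R) ->
  measurable_fun [set: X] (fun x => (\int[(k x : probability (borel M) R)]_y g (x, y))%R).
Proof.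
move=> mk mg g0; apply: (measurableT_comp (@fine_measurable _ _ measurableT)).
apply: (measurable_kernel_integral mk (g := EFin \o g)) => //.
  exact/measurable_EFinP.
Qed.

Lemma measurable_dist d (X : measurableType d) (F G : X -> R) :
  measurable_fun [set: X] F -> measurable_fun [set: X] G ->
  measurable_fun [set: X] (fun x => `|F x - G x|%:E).
Proof.
by move=> mF mG; apply/measurable_EFinP; apply: measurableT_comp => //; exact: measurable_funB.
Qed.

Section test_function.
Variable f : borel M -> R.
Hypotheses (mf : measurable_fun [set: borel M] f) (f01 : forall x, (0 <= f x <= 1)%R).
Implicit Types K L : kernels M.

Let f0 x : (0 <= f x)%R. Proof. by case/andP: (f01 x). Qed.
Let f1 x : (`|f x| <= 1)%R. Proof. by rewrite ger0_norm//; case/andP: (f01 x). Qed.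

Lemma kernel_int01 K x : (0 <= kernel_int K f x <= 1)%R.
Proof. exact: Rintegral01. Qed.

Lemma kernel_int_eq K L x : kernel_at K x ≡μ kernel_at L x ->
  kernel_int K f x = kernel_int L f x.
Proof.
by move=> KL; rewrite /kernel_int /Rintegral; congr (fine _); apply: eq_measure_integral => A mA _; exact: KL.
Qed.

Lemma measurable_kernel_int_joint d (X : measurableType d) (L : X -> kernels M) :
  jointly_measurable L -> measurable_fun [set: X * borel M] (fun z => kernel_int (L z.1) f z.2).
Proof.
move=> mL; apply: (@measurable_Rintegral_prob _ _ _ (fun z => f z.2)) => //.
exact: measurableT_comp.
Qed.

Lemma measurable_kernel_int K : measurable_fun [set: borel M] (kernel_int K f).
Proof.
apply: (@measurable_Rintegral_prob _ _ (K : borel M -> prob M) (fun z => f z.2)) => //.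
exact: measurableT_comp.
Qed.

Lemma measurable_kernel_int_at x : measurable_fun [set: kernels M] (fun K => kernel_int K f x).
Proof.
apply: (@measurable_Rintegral_prob _ _ (kernel_ev x) (fun z => f z.2)) => //.
  exact: measurable_kernel_ev.
exact: measurableT_comp.
Qed.

Lemma kernel_int_comp K L x :
  kernel_int (kernel_comp K L) f x = (\int[kernel_at K x]_y kernel_int L f y)%R.
Proof.
rewrite /kernel_int /Rintegral integral_kernel_comp//; last exact/measurable_EFinP.
congr (fine _); apply: eq_integral => y _.
by rewrite -[RHS]/(fine _)%:E fineK//; apply: integrable_fin_num => //; exact: integrable01.
Qed.

Lemma kernel_int_id x : kernel_int (@kernel_id R M) f x = f x.
Proof.
rewrite /kernel_int /Rintegral [X in fine X](_ : _ = (f x)%:E)//.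
rewrite [LHS]integral_dirac//=; last exact/measurable_EFinP.
by rewrite -[RHS]mul1e; congr (_ * _); exact: diracT.
Qed.

End test_function.

Section product_estimate.
Variables (P1 P2 : probability (kernels M) R) (x : M).
Variables (F : kernels M * kernels M -> R) (g : kernels M * borel M -> R)
  (b : borel M -> \bar R).
Hypotheses (mF : measurable_fun [set: kernels M * kernels M] F)
  (mg : measurable_fun [set: kernels M * borel M] g)
  (mb : measurable_fun [set: borel M] b)
  (Fg : forall w, `|F w|%:E <= \int[kernel_at w.1 x]_y `|g (w.2, y)|%:E)
  (gb : forall y, \int[P2]_K `|g (K, y)|%:E <= b y).

(** Tonelli lets the second kernel be averaged first, with the point [y] frozen, so that the bound
    [b] is needed one point at a time; the first kernel then integrates it. *)
Lemma product_integral_le :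
  \int[P1 \x P2]_w `|F w|%:E <= \int[P1]_K \int[kernel_at K x]_y b y.
Proof.
have mag : measurable_fun [set: kernels M * borel M] (fun z => `|g z|%:E).
  by apply/measurable_EFinP; exact: measurableT_comp.
have mag' : measurable_fun [set: kernels M * kernels M]
    (fun w => \int[kernel_at w.1 x]_y `|g (w.2, y)|%:E).
  apply: (@measurable_kernel_integral _ _ _ _ (fun w : kernels M * kernels M => kernel_ev x w.1)
    (fun z => `|g (z.1.2, z.2)|%:E)) => //.
  - exact: (measurableT_comp (measurable_kernel_ev x)).
  - apply: (measurableT_comp mag).
    by apply: measurable_fun_pair => //; exact: measurableT_comp.
have b0 y : 0 <= b y by apply: le_trans (gb y); apply: integral_ge0 => K _; rewrite lee_fin.
apply: (@le_trans _ _ (\int[P1 \x P2]_w \int[kernel_at w.1 x]_y `|g (w.2, y)|%:E)).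
  apply: ge0_le_integral => //.
  by apply/measurable_EFinP; exact: measurableT_comp.
rewrite fubini_tonelli1//; last by move=> w; apply: integral_ge0 => y _; rewrite lee_fin.
have mB : measurable_fun [set: kernels M] (fun K => \int[kernel_at K x]_y b y).
  apply: (@measurable_kernel_integral _ _ _ _ (kernel_ev x) (fun z => b z.2)) => //.
    exact: measurable_kernel_ev.
  exact: measurableT_comp.
apply: ge0_le_integral => //.
- by move=> K _; apply: integral_ge0 => L _; apply: integral_ge0 => y _; rewrite lee_fin.
- apply: measurable_fun_fubini_tonelli_F => // w.
  by apply: integral_ge0 => y _; rewrite lee_fin.
move=> K _; rewrite /fubini_F/=.
rewrite (@fubini_tonelli _ _ _ _ _ P2 (kernel_at K x) (fun z => `|g z|%:E))//.
apply: ge0_le_integral => //.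
- by move=> y _; apply: integral_ge0 => L _; rewrite lee_fin.
- by apply: (@measurable_fun_fubini_tonelli_G _ _ _ _ R P2 (fun z => `|g z|%:E)).
Qed.

End product_estimate.

Lemma ae_snd d1 d2 (S1 : measurableType d1) (S2 : measurableType d2)
    (P1 : probability S1 R) (P2 : probability S2 R) (A : S2 -> Prop) :
  {ae P2, forall y, A y} -> {ae (P1 \x P2), forall w, A w.2}.
Proof.
apply: ae_pushforward => // B mB.
rewrite (_ : _ @^-1` B = setT `*` B); last by apply/seteqP; split=> w /=; [|case].
apply: (etrans (product_measure1E P1 P2 measurableT mB)); rewrite -[RHS]mul1e; congr (_ * _).
exact: (@probability_setT _ _ _ P1).
Qed.

Lemma ae_fst d1 d2 (S1 : measurableType d1) (S2 : measurableType d2)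
    (P1 : probability S1 R) (P2 : probability S2 R) (A : S1 -> Prop) :
  {ae P1, forall y, A y} -> {ae (P1 \x P2), forall w, A w.1}.
Proof.
apply: ae_pushforward => // B mB.
rewrite (_ : _ @^-1` B = B `*` setT); last by apply/seteqP; split=> w /=; [|case].
apply: (etrans (product_measure1E P1 P2 mB measurableT)); rewrite -[RHS]mule1; congr (_ * _).
exact: (@probability_setT _ _ _ P2).
Qed.

End kernel_integrals.

Lemma ereal_cvg0_le (R : realType) (X : Type) (F : set_system X) {FF : Filter F}
    (g : X -> \bar R) (e : R) :
  g @ F --> 0%E -> 0 < e -> \forall x \near F, (g x <= e%:E)%E.
Proof.
move=> /fine_cvgP[fin /cvgrPdist_lt h] e0; near=> x.
have : `|0 - (fine \o g) x| < e by near: x; exact: h.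
have gx : g x \is a fin_num by near: x.
by rewrite sub0r normrN/= -{2}(fineK gx) lee_fin => /ltW; apply: le_trans; exact: ler_norm.
Unshelve. all: by end_near. Qed.

Section integral_helpers.
Context {R : realType}.
Local Open Scope ereal_scope.

Lemma integral_prob_cst d (T : measurableType d) (m : probability T R) (c : \bar R) :
  0 <= c -> \int[m]_x c = c.
Proof.
move=> c0; rewrite integral_cst//= [X in _ * X](_ : _ = 1%E) ?mule1//.
exact: (@probability_setT _ _ _ m).
Qed.

Lemma Rintegral_prob_cst d (T : measurableType d) (m : probability T R) (r : R) :
  (\int[m]_x r)%R = r.
Proof.
rewrite /Rintegral integral_cst//= [X in _ * X](_ : _ = 1%E) ?mule1//.
exact: (@probability_setT _ _ _ m).
Qed.

Lemma integral_dist_triangle d (T : measurableType d) (m : {measure set T -> \bar R}) (F G H : T -> R) :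
  measurable_fun [set: T] F -> measurable_fun [set: T] G -> measurable_fun [set: T] H ->
  \int[m]_x `|F x - H x|%:E <= \int[m]_x `|F x - G x|%:E + \int[m]_x `|G x - H x|%:E.
Proof.
move=> mF mG mH; rewrite -ge0_integralD//; [|exact: measurable_dist..].
apply: ge0_le_integral => //.
- exact: measurable_dist.
- by apply: emeasurable_funD; exact: measurable_dist.
- by move=> x _; rewrite -EFinD lee_fin; exact: ler_distD.
Qed.

Lemma integral_distC d (T : measurableType d) (m : {measure set T -> \bar R}) (F G : T -> R) :
  \int[m]_x `|F x - G x|%:E = \int[m]_x `|G x - F x|%:E.
Proof. by apply: eq_integral => x _; rewrite distrC. Qed.

Lemma integral_fst d1 d2 (T1 : measurableType d1) (T2 : measurableType d2)
    (m1 : probability T1 R) (m2 : probability T2 R) (F : T1 -> \bar R) :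
  measurable_fun [set: T1] F -> (forall x, 0 <= F x) ->
  \int[m1 \x m2]_w F w.1 = \int[m1]_x F x.
Proof.
move=> mF F0; rewrite fubini_tonelli1//; last exact: measurableT_comp.
by apply: eq_integral => x _; rewrite /fubini_F/= integral_prob_cst.
Qed.

End integral_helpers.

Definition kernel_conv (R : realType) (M : lcsMetricType R) (p : kernels M -> kernels M)
  (w : kernels M * kernels M) : kernels M := kernel_comp w.1 (p w.2).

(** * Mean estimates for compositions with short kernels *)

Section semigroup_estimates.
Context {R : realType} {M : lcsMetricType R}.
Variables (nu : R -> probability (kernels M) R) (p : kernels M -> kernels M).
Hypothesis nu_semigroup : feller_convolution_semigroup nu.
Hypothesis p_presentation : forall t : R, 0 <= t -> measurable_presentation (nu t) p.
Local Open Scope ereal_scope.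

Definition test (f : M -> R) := C0 f /\ forall x, (0 <= f x <= 1)%R.

Lemma measurable_test f : test f -> measurable_fun [set: borel M] f.
Proof. by move=> [[cf _] _]; exact: continuous_measurable_borel. Qed.

(** Drift and oscillation are mean forms of the continuity axioms; unlike probabilities of
    deviations they obey the triangle inequality with no loss. *)
Definition drift f h x : \bar R := \int[nu h]_K `|kernel_int K f x - f x|%:E.
Definition oscillation f t x y : \bar R :=
  \int[nu t]_K `|kernel_int K f y - kernel_int K f x|%:E.

Let jp : jointly_measurable p.
Proof. by have [] := p_presentation (lexx 0%R). Qed.

Let mp : measurable_fun [set: kernels M] p.
Proof. exact: jointly_measurable_fun. Qed.

Lemma measurable_kernel_conv : measurable_fun [set: kernels M * kernels M] (kernel_conv p).
Proof.
apply: (@measurable_kernel_comp_joint _ _ _ (kernels M * kernels M)%type fst (fun w => p w.2)) => //.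
have mx : measurable_fun [set: kernels M * kernels M * borel M] (fun z => (z.1.2, z.2)).
  by apply: measurable_fun_pair => //; exact: measurableT_comp.
exact: measurableT_comp jp mx.
Qed.

Lemma integral_convolution t s (Phi : kernels M -> \bar R) : (0 <= t)%R -> (0 <= s)%R ->
  measurable_fun [set: kernels M] Phi -> (forall K, 0 <= Phi K) ->
  \int[nu (t + s)%R]_K Phi K = \int[nu t \x nu s]_w Phi ((kernel_conv p) w).
Proof.
move=> t0 s0 mPhi Phi0.
pose m := distribution (nu t \x nu s)%E (mfun_of measurable_kernel_conv).
transitivity (\int[m]_K Phi K).
  apply: eq_measure_integral => A mA _.
  apply: etrans (esym (semigroup_convolution nu_semigroup t0 s0 (p_presentation s0) mA)) _.
  exact/esym/distribution_mfun_ofE.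
have := @ge0_integral_pushforward _ _ _ _ R (kernel_conv p) measurable_kernel_conv
  (nu t \x nu s)%E setT Phi measurableT mPhi.
by rewrite /m/=; apply => K _; exact: Phi0.
Qed.

Lemma drift_small_pos f (e : R) : test f -> (0 < e)%R ->
  exists2 d : R, (0 < d)%R & forall h x, (0 < h < d)%R -> drift f h x <= e%:E.
Proof.
move=> tf e0; have [cf f01] := tf; have mf := measurable_test tf.
have e20 : (0 < e / 2)%R by rewrite divr_gt0.
have := ereal_cvg0_le (semigroup_continuous nu_semigroup cf e20) e20.
move=> near0.
have [d /= d0 hd] := near0 _.
exists d => // h x /andP[h0 hlt].
have hsup : ereal_sup (range (fun x : M =>
    nu h [set K | (e / 2 <= `|kernel_int K f x - f x|)%R])) <= (e / 2)%:E.
  by apply: hd => //=; rewrite sub0r normrN gtr0_norm.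
apply: (le_trans (@integral_le_threshold _ _ _ _ _ (e / 2)%R _ _ (ltW e20))).
- apply: measurableT_comp => //; apply: measurable_funB => //.
  exact: (measurable_kernel_int_at mf f01).
- move=> K; rewrite normr_ge0/= ler_norml.
  by have := kernel_int01 mf f01 K x; have := f01 x; lra.
- rewrite [e in leRHS]splitr EFinD leeD2l//; apply: le_trans hsup.
  by apply: ereal_sup_ubound; exists x.
Qed.

Lemma oscillation_small f t (e : R) x : test f -> (0 <= t)%R -> (0 < e)%R ->
  \forall y \near x, oscillation f t x y <= e%:E.
Proof.
move=> tf t0 e0; have [cf f01] := tf; have mf := measurable_test tf.
have e20 : (0 < e / 2)%R by rewrite divr_gt0.
have := ereal_cvg0_le (semigroup_feller nu_semigroup x cf t0 e20) e20.
move=> /(_ _) near0; apply: filterS near0 => y hy.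
apply: (le_trans (@integral_le_threshold _ _ _ _ _ (e / 2)%R _ _ (ltW e20))).
- by apply: measurableT_comp => //; apply: measurable_funB; exact: (measurable_kernel_int_at mf f01).
- move=> K; rewrite normr_ge0/= ler_norml.
  by have := kernel_int01 mf f01 K x; have := kernel_int01 mf f01 K y; lra.
- by rewrite [e in leRHS]splitr EFinD leeD2l.
Qed.

Lemma convolution_right_le f a h x (c : R) : test f -> (0 <= a)%R -> (0 <= h)%R ->
  (forall y, drift f h y <= c%:E) ->
  \int[nu a \x nu h]_w `|kernel_int ((kernel_conv p) w) f x - kernel_int w.1 f x|%:E <= c%:E.
Proof.
move=> tf a0 h0 dc; have [cf f01] := tf; have mf := measurable_test tf.
have [_ ph] := p_presentation h0.
have mk1 := measurable_kernel_int_at mf f01 x.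
have mg : measurable_fun [set: kernels M * borel M]
    (fun z => kernel_int (p z.1) f z.2 - f z.2)%R.
  by apply: measurable_funB; [exact: measurable_kernel_int_joint|exact: measurableT_comp].
have := @product_integral_le R M (nu a) (nu h) x
  (fun w => kernel_int ((kernel_conv p) w) f x - kernel_int w.1 f x)%R
  (fun z => kernel_int (p z.1) f z.2 - f z.2)%R (cst c%:E).
move=> /(_ _ mg) h1; apply: (le_trans (h1 _ _ _ _)) => //.
- apply: measurable_funB; last exact: measurableT_comp mk1 measurable_fst.
  exact: measurableT_comp mk1 measurable_kernel_conv.
- move=> w; rewrite kernel_int_comp// /kernel_int -RintegralB//.
  + apply: abs_Rintegral_le.
      apply: measurable_funB => //; exact: (measurable_kernel_int mf f01).
    move=> y; rewrite ler_norml -/(kernel_int _ _ _).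
    by have := kernel_int01 mf f01 (p w.2) y; have := f01 y; lra.
  + apply: integrable01; first exact: (measurable_kernel_int mf f01).
    by move=> y; have /andP[k0 k1] := kernel_int01 mf f01 (p w.2) y; rewrite ger0_norm.
  + by apply: integrable01 => // y; have /andP[k0 k1] := f01 y; rewrite ger0_norm.
- move=> y; apply: le_trans (dc y); rewrite le_eqVlt; apply/orP; left; apply/eqP.
  apply: ae_eq_integral => //.
  + apply: (@measurable_dist _ _ _ (fun K => kernel_int (p K) f y) (fun=> f y)) => //.
    exact: measurableT_comp (measurable_kernel_int_at mf f01 y) mp.
  + by apply: (@measurable_dist _ _ _ (fun K => kernel_int K f y) (fun=> f y)) => //; exact: (measurable_kernel_int_at mf f01).
  + by apply: filterS (ph y) => K hK _; rewrite (kernel_int_eq f hK).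
- rewrite (eq_integral (cst c%:E)); first by rewrite integral_prob_cst// (le_trans _ (dc x))//; exact: integral_ge0.
  by move=> K _; rewrite /= integral_prob_cst// (le_trans _ (dc x))//; exact: integral_ge0.
Qed.

Let mconv_at f x : test f ->
  measurable_fun [set: kernels M * kernels M] (fun w => kernel_int ((kernel_conv p) w) f x).
Proof.
move=> tf; have [_ f01] := tf.
exact: measurableT_comp (measurable_kernel_int_at (measurable_test tf) f01 x) measurable_kernel_conv.
Qed.

Let mfst_at f x : test f ->
  measurable_fun [set: kernels M * kernels M] (fun w => kernel_int w.1 f x).
Proof.
move=> tf; have [_ f01] := tf.
exact: measurableT_comp (measurable_kernel_int_at (measurable_test tf) f01 x) measurable_fst.
Qed.

Let msnd_at f x : test f ->
  measurable_fun [set: kernels M * kernels M] (fun w => kernel_int w.2 f x).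
Proof.
move=> tf; have [_ f01] := tf.
exact: measurableT_comp (measurable_kernel_int_at (measurable_test tf) f01 x) measurable_snd.
Qed.

(* [nu 0 * nu h = nu h], and both [nu h] and the right factor are close to the identity. *)
Lemma drift0 f x : test f -> drift f 0 x = 0.
Proof.
move=> tf; apply/eqP; rewrite eq_le integral_ge0// andbT.
have [_ f01] := tf; have mf := measurable_test tf.
have mKx := measurable_kernel_int_at mf f01 x.
apply/lee_addgt0Pr => e e0; rewrite add0e.
have e20 : (0 < e / 2)%R by rewrite divr_gt0.
have [d d0 hd] := drift_small_pos tf e20.
have h0 : (0 < d / 2)%R by rewrite divr_gt0.
have hd' y : drift f (d / 2) y <= (e / 2)%:E by apply: hd; rewrite h0 ltr_pdivrMr// ltr_pMr// ltr1n.
rewrite /drift -(@integral_fst _ _ _ _ _ (nu 0) (nu (d / 2)%R)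
  (fun K => `|kernel_int K f x - f x|%:E))//; last exact: measurable_dist.
apply: le_trans (integral_dist_triangle _ (mfst_at x tf) (mconv_at x tf) (measurable_cst _)) _.
rewrite [e in leRHS]splitr EFinD; apply: leeD.
  by rewrite integral_distC; apply: convolution_right_le => //; exact: ltW.
have := integral_convolution (lexx 0%R) (ltW h0) (measurable_dist mKx (measurable_cst (f x))).
rewrite add0r => <- //; exact: hd'.
Qed.

Lemma drift_small f (e : R) : test f -> (0 < e)%R ->
  exists2 d : R, (0 < d)%R & forall h x, (0 <= h < d)%R -> drift f h x <= e%:E.
Proof.
move=> tf e0; have [d d0 hd] := drift_small_pos tf e0; exists d => // h x /andP[h0 hlt].
move: h0; rewrite le_eqVlt => /orP[/eqP <-|h0]; last by apply: hd; rewrite h0.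
by rewrite drift0// lee_fin ltW.
Qed.

(** Lengthening the time by [h] is a composition on the right, which moves each of the two compared
    values by at most [c] in mean. *)
Lemma oscillation_add f a h x y (c : R) : test f -> (0 <= a)%R -> (0 <= h)%R ->
  (forall z, drift f h z <= c%:E) ->
  oscillation f (a + h) x y <= oscillation f a x y + (2 * c)%:E /\
  oscillation f a x y <= oscillation f (a + h) x y + (2 * c)%:E.
Proof.
move=> tf a0 h0 dc; have [_ f01] := tf; have mf := measurable_test tf.
have mK z := measurable_kernel_int_at mf f01 z.
have cle z := convolution_right_le z tf a0 h0 dc.
rewrite (_ : (2 * c)%:E = c%:E + c%:E); last by rewrite -EFinD; congr (_%:E); lra.
have -> : oscillation f (a + h) x y = \int[nu a \x nu h]_w
    `|kernel_int ((kernel_conv p) w) f y - kernel_int ((kernel_conv p) w) f x|%:E.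
  exact: (integral_convolution a0 h0 (measurable_dist (mK y) (mK x))).
have -> : oscillation f a x y = \int[nu a \x nu h]_w `|kernel_int w.1 f y - kernel_int w.1 f x|%:E.
  exact/esym/(integral_fst (nu a) (nu h) (measurable_dist (mK y) (mK x))).
split.
- apply: le_trans (integral_dist_triangle (nu a \x nu h)%E (mconv_at y tf) (mfst_at y tf) (mconv_at x tf)) _.
  rewrite [leRHS]addeCA; apply: leeD; first exact: cle.
  apply: le_trans (integral_dist_triangle (nu a \x nu h)%E (mfst_at y tf) (mfst_at x tf) (mconv_at x tf)) _.
  by apply: leeD => //; rewrite integral_distC; exact: cle.
- apply: le_trans (integral_dist_triangle (nu a \x nu h)%E (mfst_at y tf) (mconv_at y tf) (mfst_at x tf)) _.
  rewrite [leRHS]addeCA; apply: leeD; first by rewrite integral_distC; exact: cle.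
  apply: le_trans (integral_dist_triangle (nu a \x nu h)%E (mconv_at y tf) (mconv_at x tf) (mfst_at x tf)) _.
  by apply: leeD => //; exact: cle.
Qed.

(* Composing with a short kernel on the left is controlled by testing that kernel
   against a bump [phi] supported where [f] oscillates little. *)
Lemma convolution_left_le f phi a h x (e : R) : test f -> test phi -> (0 <= a)%R -> (0 <= h)%R ->
  (0 <= e)%R -> (forall y, phi y != 0%R -> oscillation f a x y <= e%:E) ->
  \int[nu h \x nu a]_w `|kernel_int ((kernel_conv p) w) f x - kernel_int w.2 f x|%:E <=
    (e + (1 - phi x))%:E + drift phi h x.
Proof.
move=> tf tphi a0 h0 e0 small; have [_ f01] := tf; have mf := measurable_test tf.
have [_ phi01] := tphi; have mphi := measurable_test tphi.
have [_ pa] := p_presentation a0.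
have mp_at z : measurable_fun [set: kernels M] (fun K => kernel_int (p K) f z).
  exact: measurableT_comp (measurable_kernel_int_at mf f01 z) mp.
have mg : measurable_fun [set: kernels M * borel M]
    (fun z => kernel_int (p z.1) f z.2 - kernel_int (p z.1) f x)%R.
  apply: measurable_funB; first exact: measurable_kernel_int_joint.
  exact: measurableT_comp (mp_at x) measurable_fst.
have mp2 : measurable_fun [set: kernels M * kernels M] (fun w => kernel_int (p w.2) f x).
  exact: measurableT_comp (mp_at x) measurable_snd.
have -> : \int[nu h \x nu a]_w `|kernel_int ((kernel_conv p) w) f x - kernel_int w.2 f x|%:E =
    \int[nu h \x nu a]_w `|kernel_int ((kernel_conv p) w) f x - kernel_int (p w.2) f x|%:E.
  apply: ae_eq_integral => //.
  - by apply: measurable_dist; [exact: mconv_at|exact: msnd_at].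
  - by apply: measurable_dist; [exact: mconv_at|].
  - apply: filterS (ae_snd (nu h) (pa x)) => w hw _.
    by rewrite (kernel_int_eq f hw).
(* Where [phi] is nonzero the oscillation is at most [e]; elsewhere it is at most 1, which is
   [1 - phi y] there. *)
pose b (y : borel M) : \bar R := (e + (1 - phi y))%:E.
have mb : measurable_fun [set: borel M] b.
  by apply/measurable_EFinP; apply: measurable_funD => //; exact: measurable_funB.
have := @product_integral_le R M (nu h) (nu a) x
  (fun w => kernel_int ((kernel_conv p) w) f x - kernel_int (p w.2) f x)%R
  (fun z => kernel_int (p z.1) f z.2 - kernel_int (p z.1) f x)%R b.
move=> /(_ _ mg mb) h1; apply: (le_trans (h1 _ _ _)) => //.
- by apply: measurable_funB => //; exact: mconv_at.
- move=> w; rewrite kernel_int_comp//.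
  have -> : ((\int[kernel_at w.1 x]_y kernel_int (p w.2) f y) - kernel_int (p w.2) f x)%R =
     (\int[kernel_at w.1 x]_y (kernel_int (p w.2) f y - kernel_int (p w.2) f x))%R.
    rewrite RintegralB//.
    + by congr (_ - _)%R; rewrite (Rintegral_prob_cst (kernel_at w.1 x)).
    + apply: integrable01; first exact: measurable_kernel_int.
      by move=> y; have /andP[k0 k1] := kernel_int01 mf f01 (p w.2) y; rewrite ger0_norm.
    + apply: integrable01 => //.
      by move=> y; have /andP[k0 k1] := kernel_int01 mf f01 (p w.2) x; rewrite ger0_norm.
  apply: abs_Rintegral_le.
    by apply: measurable_funB => //; exact: measurable_kernel_int.
  move=> y; rewrite ler_norml.
  by have := kernel_int01 mf f01 (p w.2) y; have := kernel_int01 mf f01 (p w.2) x; lra.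
- move=> y; apply: (@le_trans _ _ (oscillation f a x y)).
    rewrite le_eqVlt; apply/orP; left; apply/eqP; apply: ae_eq_integral => //.
    + exact: (measurable_dist (mp_at y) (mp_at x)).
    + by apply: (@measurable_dist _ _ _ (fun K => kernel_int K f y) (fun K => kernel_int K f x));
        exact: measurable_kernel_int_at.
    + apply: filterS2 (pa y) (pa x) => K hy hx _.
      by rewrite (kernel_int_eq f hy) (kernel_int_eq f hx).
  have [phiy|phiy] := eqVneq (phi y) 0%R; last first.
    apply: le_trans (small y phiy) _; rewrite lee_fin.
    by have := phi01 y; lra.
  apply: (@le_trans _ _ 1).
    rewrite -[leRHS](integral_prob_cst (nu a) (c := 1))//; apply: ge0_le_integral => //.
      by apply: (@measurable_dist _ _ _ (fun K => kernel_int K f y) (fun K => kernel_int K f x));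
        exact: measurable_kernel_int_at.
    move=> K _; rewrite lee_fin ler_norml.
    by have := kernel_int01 mf f01 K y; have := kernel_int01 mf f01 K x; lra.
  by rewrite lee_fin phiy; lra.
- rewrite -[X in X + _](integral_prob_cst (nu h) (c := (e + (1 - phi x))%:E)); last first.
    by rewrite lee_fin; have := phi01 x; lra.
  rewrite -ge0_integralD//; last 2 first.
  + by move=> K _; rewrite lee_fin; have := phi01 x; lra.
  + by apply: (@measurable_dist _ _ _ (fun K => kernel_int K phi x) (fun=> phi x)) => //;
      exact: measurable_kernel_int_at.
  apply: ge0_le_integral => //.
  + by move=> K _; apply: integral_ge0 => y _; rewrite lee_fin; have := phi01 y; lra.
  + apply: (@measurable_kernel_integral _ _ _ _ (kernel_ev x) (fun z => b z.2)) => //.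
    * exact: measurable_kernel_ev.
    * exact: measurableT_comp.
    * by move=> z; rewrite lee_fin; have := phi01 z.2; lra.
  + apply: emeasurable_funD => //.
    by apply: (@measurable_dist _ _ _ (fun K => kernel_int K phi x) (fun=> phi x)) => //;
      exact: measurable_kernel_int_at.
  + move=> K _.
    (* Since [b] is affine in [phi], its integral exceeds [e + (1 - phi x)] by at most the distance
       of [kernel_int K phi x] from [phi x], whose mean is the drift of [phi]. *)
    have -> : \int[kernel_at K x]_y b y = (e + (1 - kernel_int K phi x))%:E.
      have ib : (kernel_at K x).-integrable [set: borel M] (EFin \o phi).
        by apply: integrable01 => // y; have /andP[k0 k1] := phi01 y; rewrite ger0_norm.
      have ic r := finite_measure_integrable_cst (kernel_at K x) r measurableT.
      rewrite -[LHS]fineK; last first.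
        apply: integrable_fin_num => //.
        rewrite (_ : b = EFin \o (fun y => (e + 1) - phi y)%R); last first.
          by apply/funext => y; rewrite /b/=; congr (_%:E); lra.
        exact: (integrableB measurableT (ic (e + 1)%R) ib).
      congr (_%:E); transitivity (\int[kernel_at K x]_y ((e + 1) - phi y))%R.
        by rewrite /Rintegral; congr (fine _); apply: eq_integral => y _; rewrite /b; congr (_%:E); lra.
      have hB : (\int[kernel_at K x]_y ((e + 1) - phi y) =
          \int[kernel_at K x]_y (e + 1) - \int[kernel_at K x]_y phi y)%R.
        exact: (RintegralB measurableT (ic (e + 1)%R) ib).
      by rewrite hB (Rintegral_prob_cst (kernel_at K x)) -/(kernel_int K phi x); lra.
    rewrite -EFinD lee_fin.
    by have := ler_norm (phi x - kernel_int K phi x)%R; rewrite distrC; lra.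
Qed.

End semigroup_estimates.

(** * Versions of kernels and the law at time zero *)

Section versions.
Context {R : realType} {M : lcsMetricType R}.

Lemma prob_measurable_eq (B : set (prob M)) (mu mu' : probability (borel M) R) :
  measurable B -> mu ≡μ mu' -> B mu <-> B mu'.
Proof.
move=> mB mumu'; move: B mB; apply: smallest_sub.
  split=> // [A h|F h]; first by rewrite setTD /=; split; apply: contra_not => /h.
  by split=> -[n _ /(h n)]; exists n.
move=> _ [W _ <-] /=.
suff -> : (fun f : Cb M => \int[mu]_x (sval f x)) = (fun f : Cb M => \int[mu']_x (sval f x)) by [].
apply/funext => f; rewrite /Rintegral; congr (fine _).
by apply: eq_measure_integral => A mA _; exact: mumu'.
Qed.

(* The sigma-field on kernels only sees countably many points at a time. *)
Lemma ae_kernel_version d (Om : measurableType d) (P : probability Om R)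
    (K L : Om -> kernels M) (A : set (kernels M)) :
  (forall x, {ae P, forall w, kernel_at (K w) x ≡μ kernel_at (L w) x}) ->
  measurable A -> {ae P, forall w, A (K w) <-> A (L w)}.
Proof.
move=> KL; move: A; apply: smallest_sub.
  split.
  - by apply: aeW.
  - by move=> A h; apply: filterS h => w h; rewrite setTD; split; apply: contra_not => /h.
  - move=> F h; have := ae_foralln h; apply: filterS => w hw.
    by split=> -[n _ /hw]; exists n.
move=> _ [x _ [B mB <-]]; rewrite setTI; apply: filterS (KL x) => w h.
exact: (prob_measurable_eq mB h).
Qed.

Lemma law_version d (Om : measurableType d) (P : probability Om R)
    (K L : Om -> kernels M) (A : set (kernels M)) :
  measurable_fun [set: Om] K -> measurable_fun [set: Om] L ->
  (forall x, {ae P, forall w, kernel_at (K w) x ≡μ kernel_at (L w) x}) ->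
  measurable A -> P (K @^-1` A) = P (L @^-1` A).
Proof.
move=> mK mL KL mA; apply: measure_ae_eq.
- by rewrite -[X in measurable X]setTI; exact: mK.
- by rewrite -[X in measurable X]setTI; exact: mL.
- exact: ae_kernel_version.
Qed.

Variables (nu : R -> probability (kernels M) R) (p : kernels M -> kernels M).
Hypothesis nu_semigroup : feller_convolution_semigroup nu.
Hypothesis p_presentation : forall t : R, 0 <= t -> measurable_presentation (nu t) p.

(** Zero drift at time zero identifies all the coding integrals of [K x] almost surely, and they
    determine the measure. *)
Lemma ae_nu0 x : {ae nu 0, forall K, kernel_at K x ≡μ kernel_at (kernel_id : kernels M) x}.
Proof.
have [f [dec [f0 f01 mdec decK]]] := prob_coding M.
have tf k : test (f k) by split.
have : {ae nu 0, forall K, forall k, kernel_int K (f k) x = f k x}.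
  apply: ae_foralln => k.
  have mk := measurable_kernel_int_at (measurable_test (tf k)) (f01 k) x.
  have md := measurable_dist mk (measurable_cst (f k x)).
  have := drift0 nu_semigroup p_presentation x (tf k); rewrite /drift => d0.
  have : (\int[nu 0]_K `| `|kernel_int K (f k) x - f k x|%:E | = 0)%E.
    by rewrite -[RHS]d0; apply: eq_integral => K _; rewrite gee0_abs// lee_fin.
  move=> /(ae_eq_integral_abs _ measurableT md); apply: filterS => K /= /(_ I) /eqP.
  by rewrite eqe normr_eq0 subr_eq0 => /eqP.
apply: filterS => K h A mA.
rewrite -(decK (kernel_at K x) A mA) -(decK (kernel_at (kernel_id : kernels M) x) A mA).
congr ((dec _ : probability (borel M) R) A); apply/funext => k.
rewrite /moments -/(kernel_int K (f k) x) h.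
by rewrite -/(kernel_int (kernel_id : kernels M) (f k) x) kernel_int_id//; exact: measurable_test.
Qed.

Lemma nu0E A : measurable A -> nu 0 A = (\1_A (kernel_id : kernels M))%:E.
Proof.
move=> mA; have := @law_version _ _ (nu 0) id (cst (kernel_id : kernels M)) A.
rewrite preimage_id => ->//; last exact: ae_nu0.
rewrite preimage_cst indicE; case: ifPn => _; last by rewrite measure0.
exact: (@probability_setT _ _ _ (nu 0)).
Qed.

(** By [nu0E], [nu 0] is the point mass at [kernel_id], so a measurable property that holds almost
    surely under it holds at [kernel_id] itself. Hence putting the identity on the diagonal respects
    the requirement that [p] fixes the flow. *)
Lemma presentation_id : kernel_eq (p kernel_id) (kernel_id : kernels M).
Proof.
move=> x; have [jp ae_p] := p_presentation (lexx 0).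
pose S := [set K : kernels M | kernel_at (p K) x ≡μ kernel_at (kernel_id : kernels M) x].
have mS : measurable S.
  apply: measurable_kernel_eq_at => //.
  exact: measurableT_comp (measurable_kernel_ev x) (jointly_measurable_fun jp).
have : nu 0 S = 1%E.
  rewrite -[RHS](@probability_setT _ _ _ (nu 0)); apply: measure_ae_eq => //.
  apply: filterS2 (ae_p x) (ae_nu0 x) => K h1 h2; split=> // _ A mA.
  by rewrite h1// h2.
rewrite nu0E// indicE; have [+ _|_ /eqP] := boolP (_ \in S); first by rewrite inE.
by rewrite eqe eq_sym oner_eq0.
Qed.

End versions.

(** * Flows on finitely many times *)

Section finite_models.
Context {R : realType} {M : lcsMetricType R}.
Variables (nu : R -> probability (kernels M) R) (p : kernels M -> kernels M).
Hypothesis nu_semigroup : feller_convolution_semigroup nu.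
Hypothesis p_presentation : forall t : R, 0 <= t -> measurable_presentation (nu t) p.
Hypothesis p_idempotent : forall K : kernels M, kernel_eq (p (p K)) (p K).

(* [mflow_ge] makes the flow the identity when [t <= s], so [T] need not be sorted. *)
Record model (T : seq R) := Model {
  mdisp : measure_display;
  mspace : measurableType mdisp;
  mprob : probability mspace R;
  mflow : R -> R -> mspace -> kernels M;
  measurable_mflow : forall s t, measurable_fun [set: mspace] (mflow s t);
  mflow_ge : forall s t w, t <= s -> mflow s t w = kernel_id;
  mflow_p : forall s t w, s \in T -> t \in T -> kernel_eq (p (mflow s t w)) (mflow s t w);
  mflow_chain : forall n (tau : nat -> R) (A : nat -> set (kernels M)),
    (forall i, (i <= n)%N -> tau i \in T) -> (forall i, (i < n)%N -> tau i <= tau i.+1) ->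
    (forall i, measurable (A i)) ->
    mprob (\bigcap_(i in `I_n) (mflow (tau i) (tau i.+1) @^-1` A i)) =
    (\prod_(i < n) nu (tau i.+1 - tau i) (A i))%E;
  mflow_comp : forall r s t x, r \in T -> s \in T -> t \in T -> r <= s -> s <= t ->
    {ae mprob, forall w, kernel_at (mflow r t w) x ≡μ
                         kernel_at (kernel_comp (mflow r s w) (p (mflow s t w))) x}
}.

Let jp : jointly_measurable p.
Proof. by have [] := p_presentation (lexx 0%R). Qed.

Let mp : measurable_fun [set: kernels M] p.
Proof. exact: jointly_measurable_fun. Qed.

Let mconv := measurable_kernel_conv p_presentation.

Lemma law_convolution t s A : 0 <= t -> 0 <= s -> measurable A ->
  (nu t \x nu s)%E (kernel_conv p @^-1` A) = nu (t + s) A.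
Proof.
by move=> t0 s0 mA; have := semigroup_convolution nu_semigroup t0 s0 (p_presentation s0) mA.
Qed.

Lemma law_presentation t A : 0 <= t -> measurable A -> nu t (p @^-1` A) = nu t A.
Proof.
move=> t0 mA; have [_ ph] := p_presentation t0.
exact: (@law_version _ _ _ _ (nu t) p id).
Qed.

(** The composed kernel has law [nu (t + s)], which [p] presents as well. *)
Lemma ae_presentation_conv t s x : 0 <= t -> 0 <= s ->
  {ae (nu t \x nu s)%E, forall w,
    kernel_at (p (kernel_conv p w)) x ≡μ kernel_at (kernel_conv p w) x}.
Proof.
move=> t0 s0; have [_ ph] := p_presentation (addr_ge0 t0 s0).
apply: (@ae_pushforward _ _ _ _ _ _ _ mconv (nu (t + s)) (fun K => kernel_at (p K) x ≡μ kernel_at K x)); last exact: ph.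
by move=> A mA; exact: law_convolution.
Qed.

Section nil_model.

Definition nil_model : model [::].
Proof.
apply: (@Model [::] _ (kernels M) (nu 0) (fun _ _ _ => kernel_id)) => //.
by move=> n tau A /(_ 0%N (leq0n n)).
Defined.

End nil_model.

Section extension.
Variables (T : seq R) (m : model T) (h t' : R).
Hypotheses (hT : forall s, s \in T -> s <= h /\ h \in T) (ht' : h <= t')
  (Tt' : forall s, s \in T -> s < t').

Local Notation Om := (mspace m).
Local Notation P := (mprob m).
Local Notation K := (@mflow T m).
Local Notation Om' := (Om * kernels M)%type.
Local Notation P' := (P \x nu (t' - h))%E.

Let t'h0 : 0 <= t' - h. Proof. by rewrite subr_ge0. Qed.

(** All start times share the one new kernel [w.2] for the step from [h] to [t'], which is what ties
    them together in the composition rule. The outer [p] makes the result a fixed point of [p] for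
    every [w]. *)
Definition extended_flow (s t : R) (w : Om') : kernels M :=
  if t <= s then kernel_id else
  if t == t' then (if s \in T then p (kernel_conv p (K s h w.1, w.2)) else kernel_id)
  else K s t w.1.

(** With the new kernel frozen, [C] becomes an event about [K s h], to which the hypothesis on [B]
    applies; integrating over the new kernel restores the product law. The case of the full event
    shows that [b] is the probability of [B]. *)
Lemma independent_last s (B : set Om) (C : set (kernels M * kernels M)) (b : \bar R) :
  measurable B -> measurable C ->
  (forall A, measurable A -> P (B `&` K s h @^-1` A) = b * nu (h - s)%R A)%E ->
  0 <= h - s -> (0 <= b)%E ->
  P' [set w | B w.1 /\ C (K s h w.1, w.2)] = (b * (nu (h - s)%R \x nu (t' - h)%R) C)%E.
Proof.
move=> mB mC BE hs b0.
have mKw : measurable_fun [set: Om'] (fun w => (K s h w.1, w.2)).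
  by apply: measurable_fun_pair => //; apply: measurableT_comp => //; exact: measurable_mflow.
have mS : measurable [set w : Om' | B w.1 /\ C (K s h w.1, w.2)].
  apply: measurableI; rewrite -[X in measurable X]setTI; last exact: mKw.
  exact: measurable_fst.
have mi (S : set Om') : measurable S -> measurable_fun [set: Om'] (fun z => (\1_S z)%:E : \bar R).
  by move=> mS'; apply/measurable_EFinP; exact: measurable_indic.
have mCK k : measurable [set w | C (K s h w, k)].
  rewrite -[X in measurable X]setTI.
  have mk : measurable_fun [set: Om] (fun w => (K s h w, k)).
    by apply: measurable_fun_pair => //; exact: measurable_mflow.
  exact: mk.
have lhs : P' [set w | B w.1 /\ C (K s h w.1, w.2)] =
    (\int[nu (t' - h)%R]_k (b * nu (h - s)%R (ysection C k)))%E.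
  transitivity (\int[P']_z (\1_[set w : Om' | B w.1 /\ C (K s h w.1, w.2)] z)%:E)%E.
    by rewrite integral_indic// setIT.
  rewrite fubini_tonelli2//; last exact: mi.
  apply: eq_integral => k _; rewrite /fubini_G/= -BE; last exact: measurable_ysection.
  rewrite (_ : (fun w => _) = (fun w => (\1_(B `&` K s h @^-1` (ysection C k)) w)%:E)).
    rewrite integral_indic// ?setIT//; apply: measurableI => //.
    rewrite -[X in measurable X]setTI; apply: measurable_mflow => //; exact: measurable_ysection.
  apply/funext => w; congr (_%:E); rewrite !indicE.
  suff -> : ((w, k) \in [set w : Om' | B w.1 /\ C (K s h w.1, w.2)]) =
     (w \in B `&` K s h @^-1` (ysection C k)) by [].
  by apply/idP/idP; rewrite !inE /ysection/= ?inE.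
rewrite lhs; rewrite ge0_integralZl//; last exact: measurable_fun_ysection.
congr (_ * _)%E.
have mE := @product_measure_unique _ _ _ _ R (nu (h - s)) (nu (t' - h))
  (product_measure2 (nu (h - s)) (nu (t' - h))).
rewrite mE// => A1 A2 mA1 mA2; exact: product_measure2E.
Qed.

Let mKw s : measurable_fun [set: Om'] (fun w => (K s h w.1, w.2)).
Proof.
by apply: measurable_fun_pair => //; apply: measurableT_comp => //; exact: measurable_mflow.
Qed.

Lemma measurable_extended_flow s t : measurable_fun [set: Om'] (extended_flow s t).
Proof.
rewrite /extended_flow; case: (t <= s) => //; case: (t == t'); last first.
  exact: measurableT_comp (measurable_mflow _ _) measurable_fst.
case: (s \in T) => //; apply: measurableT_comp mp _.
exact: measurableT_comp mconv (mKw s).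
Qed.

Lemma extended_flow_old s t w : t != t' -> extended_flow s t w = K s t w.1.
Proof.
by move=> tt'; rewrite /extended_flow (negbTE tt'); case: ifPn => // ts; rewrite mflow_ge.
Qed.

Lemma extended_flow_new s w : s \in T ->
  extended_flow s t' w = p (kernel_conv p (K s h w.1, w.2)).
Proof. by move=> sT; rewrite /extended_flow leNgt Tt'//= eqxx sT. Qed.

Lemma extended_flow_ge s t w : t <= s -> extended_flow s t w = kernel_id.
Proof. by move=> ts; rewrite /extended_flow ts. Qed.

Lemma extended_flow_p s t w : s \in t' :: T -> t \in t' :: T ->
  kernel_eq (p (extended_flow s t w)) (extended_flow s t w).
Proof.
rewrite !inE => sT tT; have [ts|st] := leP t s.
  rewrite extended_flow_ge//; exact: presentation_id nu_semigroup p_presentation.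
have sT' : s \in T.
  case/orP: sT => // /eqP ss; move: tT st; rewrite ss => /orP[/eqP ->|/Tt']; first by rewrite ltxx.
  by move=> /lt_trans h1 /h1; rewrite ltxx.
case/orP: tT => [/eqP ->|tT]; first by rewrite extended_flow_new//; exact: p_idempotent.
by rewrite extended_flow_old ?lt_eqF ?Tt'//; exact: mflow_p.
Qed.

Lemma extended_marginal B : measurable B -> P' [set w | B w.1] = P B.
Proof.
move=> mB; rewrite (_ : [set w | B w.1] = B `*` setT); last by apply/seteqP; split=> w /=; [|case].
apply: etrans (product_measure1E P (nu (t' - h)) mB measurableT) _.
by rewrite -[RHS]mule1; congr (_ * _)%E; exact: (@probability_setT _ _ _ (nu (t' - h))).
Qed.

Let chain_event n (tau : nat -> R) (A : nat -> set (kernels M)) : set Om :=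
  \bigcap_(i in `I_n) (K (tau i) (tau i.+1) @^-1` A i).

Let measurable_chain_event n tau A : (forall i, measurable (A i)) -> measurable (chain_event n tau A).
Proof.
move=> mA; apply: bigcap_measurableType => i _.
by rewrite -[X in measurable X]setTI; exact: measurable_mflow.
Qed.

Lemma chain_tau_le n (tau : nat -> R) : (forall i, (i < n)%N -> tau i <= tau i.+1) ->
  forall i, (i <= n)%N -> tau i <= tau n.
Proof.
move=> tle; elim: n tle => [|n IH] tle i; first by rewrite leqn0 => /eqP ->.
rewrite leq_eqVlt => /orP[/eqP ->//|]; rewrite ltnS => ni.
apply: le_trans (tle n (ltnSn n)); apply: IH => // j jn; apply: tle; exact: ltnW.
Qed.

Lemma bigcap_ltnS (X : Type) (F : nat -> set X) n :
  \bigcap_(i in `I_n.+1) F i = (\bigcap_(i in `I_n) F i) `&` F n.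
Proof.
apply/seteqP; split=> x.
  by move=> Fx; split=> [i /= ni|]; apply: Fx => /=; rewrite ltnS// ltnW.
move=> [Fx Fn] i /=; rewrite ltnS leq_eqVlt => /orP[/eqP ->//|]; exact: Fx.
Qed.

Lemma extended_chain n (tau : nat -> R) (A : nat -> set (kernels M)) :
  (forall i, (i <= n)%N -> tau i \in t' :: T) -> (forall i, (i < n)%N -> tau i <= tau i.+1) ->
  (forall i, measurable (A i)) ->
  P' (\bigcap_(i in `I_n) (extended_flow (tau i) (tau i.+1) @^-1` A i)) =
  (\prod_(i < n) nu (tau i.+1 - tau i) (A i))%E.
Proof.
move=> tauT tle mA; elim: n tauT tle => [|n IH] tauT tle.
  rewrite big_ord0 (_ : \bigcap_(_ in _) _ = setT); last by apply/seteqP; split.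
  exact: (@probability_setT _ _ _ P').
have tle' i : (i < n)%N -> tau i <= tau i.+1 by move=> ni; apply: tle; exact: ltnW.
have old_event k : (forall i, (i < k)%N -> tau i.+1 != t') ->
    \bigcap_(i in `I_k) (extended_flow (tau i) (tau i.+1) @^-1` A i) =
    [set w | chain_event k tau A w.1].
  move=> kt'; apply/seteqP; split=> w Aw i ik; have := Aw i ik;
    by rewrite /= extended_flow_old//; exact: kt'.
have [tn'|tn'] := eqVneq (tau n.+1) t'; last first.
  have tT i : (i <= n.+1)%N -> tau i \in T.
    move=> ni; have := tauT i ni; rewrite inE => /orP[/eqP tit'|//].
    have := chain_tau_le tle ni; rewrite tit' => /le_lt_trans h1.
    have := tauT n.+1 (leqnn _); rewrite inE (negbTE tn')/= => /Tt'/h1.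
    by rewrite ltxx.
  rewrite old_event; last first.
    by move=> i ni; rewrite lt_eqF// Tt'// tT.
  rewrite extended_marginal; last exact: measurable_chain_event.
  exact: mflow_chain.
rewrite big_ord_recr/= bigcap_ltnS.
(* A last step of length zero at [t'] is the identity, in accordance with [nu 0], and contributes
   the factor 0 or 1. *)
have [tnt'|tnt'] := eqVneq (tau n) t'.
  rewrite tn' tnt' subrr (nu0E nu_semigroup p_presentation (mA n)) indicE -IH//; last first.
    by move=> i ni; apply: tauT; exact: leqW.
  rewrite (_ : extended_flow t' t' @^-1` A n = if `[< A n kernel_id >] then setT else set0).
    case: asboolP => AK; first by rewrite mem_set// mule1 setIT.
    by rewrite memNset// mule0 setI0 measure0.
  by apply/seteqP; split=> w /=; rewrite extended_flow_ge//; case: asboolP.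
have tT i : (i <= n)%N -> tau i \in T.
  move=> ni; have := tauT i (leqW ni); rewrite inE => /orP[/eqP tit'|//].
  have := chain_tau_le tle' ni; rewrite tit' => /le_lt_trans h1.
  have := tauT n (leqnSn n); rewrite inE (negbTE tnt')/= => /Tt'/h1.
  by rewrite ltxx.
have tnT := tT n (leqnn n); have [tnh hT0] := hT tnT.
have chainP : P (chain_event n tau A) = (\prod_(i < n) nu (tau i.+1 - tau i) (A i))%E.
  by apply: mflow_chain => //.
rewrite old_event; last by move=> i ni; rewrite lt_eqF// Tt'// tT.
pose C := (p \o kernel_conv p) @^-1` A n.
have mC : measurable C.
  by rewrite -[X in measurable X]setTI; apply: (measurableT_comp mp mconv).
rewrite (_ : _ `&` _ = [set w | chain_event n tau A w.1 /\ C (K (tau n) h w.1, w.2)]); last first.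
  by apply/seteqP; split=> w [h1 h2]; split=> //; move: h2; rewrite /= tn' extended_flow_new.
rewrite (@independent_last (tau n) _ _ (P (chain_event n tau A))) ?subr_ge0//; last 2 first.
- exact: measurable_chain_event.
- move=> B mB.
  (* The end time [t'] is replaced by [h], so that the independence of [K (tau n) h] from the
     earlier increments is an instance of [mflow_chain] in the old model. *)
  pose tau' i := if (i <= n)%N then tau i else h.
  pose A' i := if (i < n)%N then A i else B.
  have -> : chain_event n tau A `&` K (tau n) h @^-1` B =
      \bigcap_(i in `I_n.+1) (K (tau' i) (tau' i.+1) @^-1` A' i).
    rewrite bigcap_ltnS /tau' /A' leqnn ltnn; congr (_ `&` _).
    by apply: eq_bigcapr => i /= ni; rewrite ni (ltnW ni).
  rewrite mflow_chain.
  + rewrite big_ord_recr/= /tau' /A' leqnn ltnn chainP; congr (_ * _)%E.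
    by apply: eq_bigr => i _; rewrite ltn_ord (ltnW (ltn_ord i)).
  + by move=> i _; rewrite /tau'; case: ifP => // ni; exact: tT.
  + move=> i; rewrite ltnS /tau' => ni; rewrite ni; case: ifPn => ni'; first exact: tle'.
    suff -> : i = n by [].
    by apply/eqP; rewrite eqn_leq ni leqNgt.
  + by move=> i; rewrite /A'; case: ifP.
rewrite chainP; congr (_ * _)%E.
rewrite /C comp_preimage law_convolution ?subr_ge0//; last first.
  by rewrite -[X in measurable X]setTI; exact: mp.
rewrite (_ : h - tau n + (t' - h) = t' - tau n); last by lra.
by rewrite tn' law_presentation// subr_ge0 (le_trans tnh).
Qed.

Lemma extended_law s C : s \in T -> measurable C ->
  P' [set w | C (K s h w.1, w.2)] = (nu (h - s)%R \x nu (t' - h)%R)%E C.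
Proof.
move=> sT mC; have [sh hT0] := hT sT.
rewrite (_ : [set w | _] = [set w : Om' | [set: Om] w.1 /\ C (K s h w.1, w.2)]); last first.
  by apply/seteqP; split=> w //= [].
rewrite (@independent_last s setT C 1%E) ?mul1e ?subr_ge0// => A mA; rewrite setTI mul1e.
have := @mflow_chain T m 1 (fun i => if i is 0%N then s else h) (fun=> A).
rewrite bigcap_ltnS big_ord1/= (_ : \bigcap_(_ in _) _ = setT) ?setTI; last by apply/seteqP; split.
by apply=> //; case=> //.
Qed.

(** The case of substance is [t = t'] with [r < s < t']. Writing [k] for the new kernel, almost
    surely at [x] one has [p (K_rh p(k)) = K_rh p(k) = K_rs p(K_sh) p(k) = K_rs p(K_sh p(k))], by
    the three steps below. *)
Lemma extended_comp r s t x : r \in t' :: T -> s \in t' :: T -> t \in t' :: T ->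
  r <= s -> s <= t ->
  {ae P', forall w, kernel_at (extended_flow r t w) x ≡μ
    kernel_at (kernel_comp (extended_flow r s w) (p (extended_flow s t w))) x}.
Proof.
move=> rT sT tT rs st.
have [rs'|rs'] := eqVneq r s.
  rewrite rs'; apply: aeW => w A mA; rewrite [extended_flow s s w]extended_flow_ge//.
  by rewrite kernel_comp_idl// extended_flow_p.
have [st'|st'] := eqVneq s t.
  rewrite st'; apply: aeW => w A mA; rewrite [extended_flow t t w]extended_flow_ge//.
  rewrite (kernel_comp_eqr _ (presentation_id nu_semigroup p_presentation))//.
  by rewrite kernel_comp_idr.
have rlts : r < s by rewrite lt_neqAle rs'.
have sltt : s < t by rewrite lt_neqAle st'.
have in_T u v : u \in t' :: T -> v \in t' :: T -> u < v -> u \in T.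
  rewrite !inE => /orP[/eqP ->|//] /orP[/eqP ->|/Tt' h1 h2]; first by rewrite ltxx.
  by have := lt_trans h1 h2; rewrite ltxx.
have sT' := in_T _ _ sT tT sltt; have rT' := in_T _ _ rT sT rlts.
have s_ne : s != t' by rewrite lt_eqF// Tt'.
have [tt'|tt'] := eqVneq t t'; last first.
  have tT' : t \in T by move: tT; rewrite inE (negbTE tt').
  have hc := ae_fst (nu (t' - h)) (mflow_comp m x rT' sT' tT' rs st).
  apply: filterS hc => w.
  by rewrite !extended_flow_old.
have [sh hT0] := hT sT'; have [rh _] := hT rT'.
have sh0 : 0 <= h - s by rewrite subr_ge0.
have rh0 : 0 <= h - r by rewrite subr_ge0.
have sr0 : 0 <= s - r by rewrite subr_ge0.
have step1 : {ae P', forall w, kernel_at (p (kernel_conv p (K r h w.1, w.2))) x ≡μ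
    kernel_at (kernel_conv p (K r h w.1, w.2)) x}.
  apply: (@ae_pushforward _ _ _ _ _ _ _ (mKw r) (nu (h - r) \x nu (t' - h))%E
    (fun w => kernel_at (p (kernel_conv p w)) x ≡μ kernel_at (kernel_conv p w) x)).
    by move=> C mC; exact: extended_law.
  exact: ae_presentation_conv.
have step2 := ae_fst (nu (t' - h)) (mflow_comp m x rT' sT' hT0 rs sh).
pose L (y : kernels M * kernels M) := kernel_comp (p y.1) (p y.2).
pose L' (y : kernels M * kernels M) := p (kernel_conv p y).
have jp1 : jointly_measurable (fun y : kernels M * kernels M => p y.1).
  have mx : measurable_fun [set: kernels M * kernels M * borel M] (fun z => (z.1.1, z.2)).
    by apply: measurable_fun_pair => //; exact: measurableT_comp.
  exact: measurableT_comp jp mx.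
have jp2 : jointly_measurable (fun y : kernels M * kernels M => p y.2).
  have mx : measurable_fun [set: kernels M * kernels M * borel M] (fun z => (z.1.2, z.2)).
    by apply: measurable_fun_pair => //; exact: measurableT_comp.
  exact: measurableT_comp jp mx.
have jL : jointly_measurable L by exact: jointly_measurable_comp.
have jL' : jointly_measurable L'.
  have mx : measurable_fun [set: kernels M * kernels M * borel M] (fun z => (kernel_conv p z.1, z.2)).
    by apply: measurable_fun_pair => //; exact: measurableT_comp mconv measurable_fst.
  exact: measurableT_comp jp mx.
have LL' z : {ae (nu (h - s) \x nu (t' - h))%E, forall y,
    kernel_at (L y) z ≡μ kernel_at (L' y) z}.
  have [_ ps] := p_presentation sh0.
  apply: filterS2 (ae_fst (nu (t' - h)) (ps z)) (ae_presentation_conv z sh0 t'h0) => y h1 h2 A mA.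
  by rewrite /L' h2// (kernel_comp_eql (p y.2) h1 mA).
pose Psi (w : Om') := (K r s w.1, (K s h w.1, w.2)).
have mPsi : measurable_fun [set: Om'] Psi.
  apply: measurable_fun_pair; last exact: mKw.
  exact: measurableT_comp (measurable_mflow _ _) measurable_fst.
(* [L] and [L'] agree almost surely at each fixed point only. Exchanging them under the integral
   against [K r s] requires that [K r s] be independent of the pair formed by [K s h] and the new
   kernel. *)
have step3 : {ae P', forall w,
    kernel_at (kernel_comp (K r s w.1) (L (K s h w.1, w.2))) x ≡μ
    kernel_at (kernel_comp (K r s w.1) (L' (K s h w.1, w.2))) x}.
  pose lam2 : probability (kernels M * kernels M)%type R := (nu (h - s) \x nu (t' - h))%E.
  pose lam : probability (kernels M * (kernels M * kernels M))%type R := (nu (s - r) \x lam2)%E.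
  have key := @ae_kernel_comp_eqr _ _ _ _ _ _ (nu (s - r)) lam2 id L L' x
    (@measurable_id _ _ setT) jL jL' LL'.
  suff lawPsi C : measurable C -> P' (Psi @^-1` C) = lam C.
    have := @ae_pushforward _ _ _ _ _ P' Psi mPsi lam _ lawPsi key.
    by apply: filterS => w; exact.
  move=> mC.
  pose law := distribution (P' : probability _ R) (mfun_of mPsi).
  have -> : P' (Psi @^-1` C) = law C by exact/esym/distribution_mfun_ofE.
  apply/esym; apply: product_measure_unique => // A B mA mB.
  apply: etrans (distribution_mfun_ofE _ mPsi _) _.
  rewrite (_ : Psi @^-1` (A `*` B) = [set w : Om' | (K r s @^-1` A) w.1 /\ B (K s h w.1, w.2)])//.
  have mKA : measurable (K r s @^-1` A).
    by rewrite -[X in measurable X]setTI; exact: measurable_mflow.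
  have PA : P (K r s @^-1` A) = nu (s - r) A.
    have := @mflow_chain T m 1 (fun i => if i is 0%N then r else s) (fun=> A).
    rewrite bigcap_ltnS big_ord1/= (_ : \bigcap_(_ in _) _ = setT) ?setTI; last by apply/seteqP; split.
    by apply=> //; case=> //.
  have BE D : measurable D ->
      P (K r s @^-1` A `&` K s h @^-1` D) = (P (K r s @^-1` A) * nu (h - s) D)%E.
    move=> mD; rewrite PA.
    have := @mflow_chain T m 2 (fun i => if i is i.+1 then if i is 0%N then s else h else r)
      (fun i => if i is 0%N then A else D).
    rewrite !bigcap_ltnS big_ord_recr big_ord1/= (_ : \bigcap_(_ in _) _ = setT) ?setTI; last by apply/seteqP; split.
    by apply=> //; [case=> [|[|]]|case=> [|[|]]|case].
  apply: etrans (independent_last mKA mB BE sh0 (measure_ge0 P _)) _.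
  by rewrite PA.
apply: filterS3 step1 step2 step3 => w h1 h2 h3 A mA.
rewrite tt' !extended_flow_new// [extended_flow r s w]extended_flow_old// h1//.
rewrite (kernel_comp_eql (p w.2) h2 mA) kernel_compA//.
rewrite (kernel_comp_eqr _ (p_idempotent _))//.
exact: h3.
Qed.

Definition extended_model : model (t' :: T) :=
  @Model (t' :: T) _ Om' P' extended_flow measurable_extended_flow extended_flow_ge
    extended_flow_p extended_chain extended_comp.

End extension.

Lemma sorted_model (T : seq R) : sorted >%R T -> inhabited (model T).
Proof.
elim: T => [|t T IH] sT; first by constructor; exact: nil_model.
have [m] := IH (path_sorted sT).
have Tt s : s \in T -> s < t by move=> sinT; move: sT => /order_path_min/allP; apply=> //; exact: rev_trans lt_trans.
(* A decreasing list has its latest time at the head. For the empty list the default [h = t] gives a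
   first step of length zero, with law [nu 0]. *)
constructor; apply: (@extended_model T m (head t T) t) => //.
- case: T sT {IH m Tt} => // u T /= /andP[_ uT] s; rewrite inE => /orP[/eqP ->|sinT].
    by rewrite mem_head lexx.
  rewrite mem_head; split=> //; apply: ltW.
  by move: uT => /order_path_min/allP; apply=> //; exact: rev_trans lt_trans.
- by case: T sT {IH m} Tt => //= u T _ Tt; rewrite ltW// Tt// mem_head.
Qed.

Lemma finite_model (T : seq R) : inhabited (model T).
Proof.
have [m] : inhabited (model (rev (sort <=%R (undup T)))).
  apply: sorted_model; rewrite rev_sorted.
  by have := sort_lt_sorted (undup T); rewrite undup_uniq.
have TE s : (s \in rev (sort <=%R (undup T))) = (s \in T) by rewrite mem_rev mem_sort mem_undup.
constructor; apply: (@Model T _ (mspace m) (mprob m) (@mflow _ m)).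
- exact: measurable_mflow.
- exact: mflow_ge.
- by move=> s t w; rewrite -!TE; exact: mflow_p.
- by move=> n tau A tauT; apply: mflow_chain => i /tauT; rewrite TE.
- by move=> r s t x; rewrite -!TE; exact: mflow_comp.
Qed.

End finite_models.

(** * Equicontinuity in mean of the finite flows *)

Section model_estimates.
Context {R : realType} {M : lcsMetricType R}.
Variables (nu : R -> probability (kernels M) R) (p : kernels M -> kernels M).
Hypothesis nu_semigroup : feller_convolution_semigroup nu.
Hypothesis p_presentation : forall t : R, 0 <= t -> measurable_presentation (nu t) p.

Local Notation flow m := (@mflow _ _ _ _ _ m).

Lemma oscillation_shift f a a' x y (c d : R) : test f -> 0 <= a -> 0 <= a' ->
  (forall h z, 0 <= h < d -> (drift nu f h z <= c%:E)%E) -> `|a - a'| < d ->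
  (oscillation nu f a' x y <= oscillation nu f a x y + (2 * c)%:E)%E.
Proof.
move=> tf a0 a'0 dc; have [aa'|aa'] := leP a a'.
  rewrite distrC ger0_norm ?subr_ge0// => h.
  have := @oscillation_add _ _ _ _ nu_semigroup p_presentation f a (a' - a) x y c tf a0.
  by rewrite subrKC subr_ge0 => /(_ aa')[]// z; apply: dc; rewrite subr_ge0 aa'.
rewrite gtr0_norm ?subr_gt0// => h.
have := @oscillation_add _ _ _ _ nu_semigroup p_presentation f a' (a - a') x y c tf a'0.
by rewrite subrKC subr_ge0 => /(_ (ltW aa'))[]// z; apply: dc; rewrite subr_ge0 (ltW aa').
Qed.

Lemma bump x (N : set M) (c : R) : nbhs x N -> 0 < c ->
  exists phi, [/\ test phi, 1 - phi x <= c & forall y, phi y != 0 -> N y].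
Proof.
move=> Nx c0; have [V [oV cV baseV]] := relatively_compact_base M.
have [i [Vx iN]] := baseV _ _ (open_interior N) Nx.
have [f [cf f01 ndf fV]] := Cb_approx_open (oV i).
have fV0 n y : ~ V i y -> f n y = 0.
  move=> Vy; apply/eqP; rewrite eq_le; have /andP[-> _] := f01 n y; rewrite andbT.
  have fy : f n y @[n --> \oo] --> (0 : R) by have := fV y; rewrite indicE memNset.
  rewrite -(cvg_lim _ fy)//.
  by apply: nondecreasing_cvgn_le; [move=> ? ?; exact: ndf|apply/cvg_ex; exists 0].
have fx : f n x @[n --> \oo] --> (1 : R) by have := fV x; rewrite indicE mem_set.
move/cvgrPdist_lt : fx => /(_ _ c0)[n _ /(_ n (leqnn n))] fnx.
exists (f n); split.
- split=> //; apply: (@C0_vanishing_outside _ _ _ (closure (V i))) => // y Vy.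
  by apply: fV0 => /subset_closure.
- exact: le_trans (ler_norm _) (ltW fnx).
- move=> y; apply: contra_neqP => Ny; apply: fV0 => Vy; apply: Ny.
  by apply: interior_subset; apply: iN; exact: subset_closure.
Qed.

Section one_model.
Variables (T : seq R) (m : model nu p T).
Local Notation P := (mprob m).
Local Notation K := (@mflow _ _ _ _ _ m).

Lemma model_law s t A : s \in T -> t \in T -> s <= t -> measurable A ->
  P (K s t @^-1` A) = nu (t - s) A.
Proof.
move=> sT tT st mA.
have := @mflow_chain _ _ _ _ T m 1 (fun i => if i is 0%N then s else t) (fun=> A).
rewrite bigcap_ltnS big_ord1/= (_ : \bigcap_(_ in _) _ = setT) ?setTI; last by apply/seteqP; split.
by apply=> //; case=> //.
Qed.

Lemma measurable_model_pair r s t :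
  measurable_fun [set: mspace m] (fun w => (K r s w, K s t w)).
Proof. by apply: measurable_fun_pair; exact: measurable_mflow. Qed.

Lemma model_pair_law r s t C : r \in T -> s \in T -> t \in T -> r <= s -> s <= t ->
  measurable C ->
  P ((fun w => (K r s w, K s t w)) @^-1` C) = (nu (s - r) \x nu (t - s))%E C.
Proof.
move=> rT sT tT rs st mC.
pose law := distribution P (mfun_of (measurable_model_pair r s t)).
have -> : P ((fun w => (K r s w, K s t w)) @^-1` C) = law C by exact/esym/distribution_mfun_ofE.
apply/esym; apply: product_measure_unique => // A B mA mB.
apply: etrans (distribution_mfun_ofE _ (measurable_model_pair r s t) _) _.
have := @mflow_chain _ _ _ _ T m 2 (fun i => if i is i.+1 then if i is 0%N then s else t else r)
  (fun i => if i is 0%N then A else B).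
rewrite !bigcap_ltnS big_ord_recr big_ord1/= (_ : \bigcap_(_ in _) _ = setT) ?setTI; last by apply/seteqP; split.
by apply=> //; [case=> [|[|]]|case=> [|[|]]|case].
Qed.

Lemma model_integral_pair r s t (Phi : kernels M * kernels M -> \bar R) :
  r \in T -> s \in T -> t \in T -> r <= s -> s <= t ->
  measurable_fun setT Phi -> (forall w, 0 <= Phi w)%E ->
  (\int[P]_w Phi (K r s w, K s t w) = \int[nu (s - r) \x nu (t - s)]_w Phi w)%E.
Proof.
move=> rT sT tT rs st mPhi Phi0.
have := @ge0_integral_pushforward _ _ _ _ R _ (measurable_model_pair r s t) P setT Phi measurableT mPhi.
rewrite preimage_setT => <-; last by move=> w _; exact: Phi0.
by apply: eq_measure_integral => [|h C mC _]; [exact: measurable_model_pair|exact: model_pair_law].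
Qed.

Variables (f : M -> R).
Hypothesis tf : test f.

Let mf := measurable_test tf.
Let f01 := proj2 tf.

Let mKf s t x : measurable_fun [set: mspace m] (fun w => kernel_int (K s t w) f x).
Proof. exact: measurableT_comp (measurable_kernel_int_at mf f01 x) (measurable_mflow _ _). Qed.

Let mfst_at x : measurable_fun [set: kernels M * kernels M] (fun w => kernel_int w.1 f x).
Proof. exact: measurableT_comp (measurable_kernel_int_at mf f01 x) measurable_fst. Qed.

Let msnd_at x : measurable_fun [set: kernels M * kernels M] (fun w => kernel_int w.2 f x).
Proof. exact: measurableT_comp (measurable_kernel_int_at mf f01 x) measurable_snd. Qed.

Let mconv_at x : measurable_fun [set: kernels M * kernels M] (fun w => kernel_int (kernel_conv p w) f x).
Proof.
exact: measurableT_comp (measurable_kernel_int_at mf f01 x) (measurable_kernel_conv p_presentation).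
Qed.

Let integral_comp r s t x (G : mspace m -> R) : r \in T -> s \in T -> t \in T -> r <= s -> s <= t ->
  measurable_fun setT G ->
  (\int[P]_w `|kernel_int (K r t w) f x - G w|%:E =
   \int[P]_w `|kernel_int (kernel_conv p (K r s w, K s t w)) f x - G w|%:E)%E.
Proof.
move=> rT sT tT rs st mG; apply: ae_eq_integral => //.
- exact: measurable_dist.
- by apply: measurable_dist => //; exact: measurableT_comp (mconv_at x) (measurable_model_pair r s t).
- apply: filterS (mflow_comp m x rT sT tT rs st) => w hw _.
  by rewrite (kernel_int_eq f hw).
Qed.

Lemma model_right_le r s t x (c : R) : r \in T -> s \in T -> t \in T -> r <= s -> s <= t ->
  (forall y, drift nu f (t - s) y <= c%:E)%E ->
  (\int[P]_w `|kernel_int (K r t w) f x - kernel_int (K r s w) f x|%:E <= c%:E)%E.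
Proof.
move=> rT sT tT rs st dc; rewrite (integral_comp _ rT sT tT)//.
have md := measurable_dist (mconv_at x) (mfst_at x).
rewrite (model_integral_pair rT sT tT rs st md)//.

by apply: (convolution_right_le p_presentation) => //; rewrite subr_ge0.
Qed.

Lemma model_left_le (phi : M -> R) r s t x (e : R) : test phi -> r \in T -> s \in T -> t \in T ->
  r <= s -> s <= t -> 0 <= e ->
  (forall y, phi y != 0 -> (oscillation nu f (t - s) x y <= e%:E)%E) ->
  (\int[P]_w `|kernel_int (K r t w) f x - kernel_int (K s t w) f x|%:E <=
   (e + (1 - phi x))%:E + drift nu phi (s - r) x)%E.
Proof.
move=> tphi rT sT tT rs st e0 small; rewrite (integral_comp _ rT sT tT)//.
have md := measurable_dist (mconv_at x) (msnd_at x).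
rewrite (model_integral_pair rT sT tT rs st md)//.
by apply: (convolution_left_le p_presentation) => //; rewrite subr_ge0.
Qed.

Lemma model_oscillation s t x y : s \in T -> t \in T -> s <= t ->
  (\int[P]_w `|kernel_int (K s t w) f y - kernel_int (K s t w) f x|%:E =
   oscillation nu f (t - s) x y)%E.
Proof.
move=> sT tT st.
have md := measurable_dist (measurable_kernel_int_at mf f01 y) (measurable_kernel_int_at mf f01 x).
have := @ge0_integral_pushforward _ _ _ _ R _ (@measurable_mflow _ _ _ _ _ m s t) P setT _ measurableT md.
rewrite preimage_setT => <-; last by move=> w _; rewrite lee_fin.
by apply: eq_measure_integral => [|h C mC _]; [exact: measurable_mflow|exact: model_law].
Qed.

End one_model.

(* The path from [(s, t, x)] to [(s', t', x')] moves the end time up, then the start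
   time, then the point, then the end time down. *)
Lemma model_close (f : M -> R) (e s t : R) (x : M) : test f -> 0 < e ->
  exists2 d : R, 0 < d & exists2 N : set M, nbhs x N &
    forall s' t' x', `|s - s'| < d -> `|t - t'| < d -> N x' ->
    forall T (m : model nu p T), s \in T -> t \in T -> s' \in T -> t' \in T ->
    (\int[mprob m]_w `|kernel_int (flow m s' t' w) f x' - kernel_int (flow m s t w) f x|%:E
      <= e%:E)%E.
Proof.
(* The four moves cost [c], [3 * c], [5 * c] and [c]. *)
move=> tf e0; pose c := e / 10.
have c0 : 0 < c by rewrite divr_gt0.
have [d1 d10 hd1] := drift_small nu_semigroup p_presentation tf c0.
(* Replacing the end time by the maximum leaves the flow unchanged, also when [t < s], where it is
   the identity. The estimate thus covers all pairs of times, including those across the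
   diagonal. *)
pose tau := Num.max s t; pose a := tau - s.
have a0 : 0 <= a by rewrite subr_ge0 le_max lexx.
pose N := [set y | (oscillation nu f a x y <= c%:E)%E].
have Nx : nbhs x N by exact: oscillation_small.
have [phi [tphi phix phiN]] := bump Nx c0.
have [d2 d20 hd2] := drift_small nu_semigroup p_presentation tphi c0.
pose d := Num.min d1 d2 / 4.
have dd1 : 4 * d <= d1 by rewrite /d mulrC divfK// ge_min lexx.
have dd2 : 4 * d <= d2 by rewrite /d mulrC divfK// ge_min lexx orbT.
have d0 : 0 < d by rewrite divr_gt0// lt_min d10.
exists d => //; exists N => // s' t' x' ss' tt' Nx' T m sT tT s'T t'T.
pose tau' := Num.max s' t'; pose mm := Num.max tau tau'.
have flowE u v w : flow m u v w = flow m u (Num.max u v) w.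
  by case: (leP u v) => // vu; rewrite !mflow_ge// ltW.
have maxT u v : u \in T -> v \in T -> Num.max u v \in T by case: (leP u v).
have tauT : tau \in T by exact: maxT.
have tau'T : tau' \in T by exact: maxT.
have mmT : mm \in T by exact: maxT.
have stau : s <= tau by rewrite le_max lexx.
have stau' : s' <= tau' by rewrite le_max lexx.
have taumm : tau <= mm by rewrite le_max lexx.
have taumm' : tau' <= mm by rewrite le_max lexx orbT.
have [ss1 ss2] : s - s' < d /\ s' - s < d.
  by move: ss'; rewrite ltr_norml; lra.
have tautau : `|tau - tau'| < d.
  move: ss' tt'; rewrite /tau /tau' !ltr_norml.
  by case: (leP s t) => h1; case: (leP s' t') => h2; lra.
have [mm1 mm2] : mm - tau < d /\ mm - tau' < d.
  by move: tautau; rewrite ltr_norml /mm; case: (leP tau tau'); lra.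
have mKf u v y : measurable_fun [set: mspace m] (fun w => kernel_int (flow m u v w) f y).
  have [_ f01] := tf.
  exact: measurableT_comp (measurable_kernel_int_at (measurable_test tf) f01 y) (measurable_mflow _ _).
have osc b y : 0 <= mm - b -> s <= b + d -> b <= s + d -> N y ->
    (oscillation nu f (mm - b) x y <= (c + 2 * c)%:E)%E.
  move=> b0 b1 b2 Ny; rewrite EFinD.
  apply: le_trans (oscillation_shift x y tf a0 b0 (fun h z => hd1 h z) _) _.
    by rewrite ltr_norml /a; apply/andP; split; lra.
  by rewrite leeD2r.
rewrite (_ : e = c + ((c + 2 * c) + ((c + 2 * c + c + c) + c))); last by rewrite /c; lra.
have step1 : (\int[mprob m]_w `|kernel_int (flow m s' t' w) f x' -
    kernel_int (flow m s' mm w) f x'|%:E <= c%:E)%E.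
  under eq_integral do rewrite distrC (flowE s' t') -/tau'.
  by apply: model_right_le => // y; apply: hd1; apply/andP; split; lra.
have step2 : (\int[mprob m]_w `|kernel_int (flow m s' mm w) f x' -
    kernel_int (flow m s' mm w) f x|%:E <= (c + 2 * c)%:E)%E.
  rewrite model_oscillation//; last lra.
  by apply: osc => //; lra.
have left_step u v : u \in T -> v \in T -> u <= v -> v <= mm -> v - u < d -> s <= v + d ->
    v <= s + d -> (\int[mprob m]_w `|kernel_int (flow m u mm w) f x -
    kernel_int (flow m v mm w) f x|%:E <= (c + 2 * c + c + c)%:E)%E.
  move=> uT vT uv vm vud sv vs.
  have h y : phi y != 0 -> (oscillation nu f (mm - v) x y <= (c + 2 * c)%:E)%E.
    by move=> /phiN Ny; apply: osc => //; lra.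
  apply: le_trans (model_left_le m tf tphi uT vT mmT uv vm _ h) _; first lra.
  rewrite -addrA EFinD [in leRHS]EFinD EFinD EFinD addeA.
  apply: leeD; first by rewrite -!EFinD lee_fin; lra.
  by apply: hd2; apply/andP; split; lra.
have step3 : (\int[mprob m]_w `|kernel_int (flow m s' mm w) f x -
    kernel_int (flow m s mm w) f x|%:E <= (c + 2 * c + c + c)%:E)%E.
  have [h|h] := leP s s'; last by apply: left_step => //; lra.
  by rewrite integral_distC; apply: left_step => //; lra.
have step4 : (\int[mprob m]_w `|kernel_int (flow m s mm w) f x -
    kernel_int (flow m s t w) f x|%:E <= c%:E)%E.
  under eq_integral do rewrite (flowE s t) -/tau.
  by apply: model_right_le => // y; apply: hd1; apply/andP; split; lra.
rewrite EFinD; apply: le_trans (integral_dist_triangle _ (mKf _ _ _) (mKf s' mm x') (mKf _ _ _)) _.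
apply: leeD; [exact: step1|rewrite EFinD].
apply: le_trans (integral_dist_triangle _ (mKf _ _ _) (mKf s' mm x) (mKf _ _ _)) _.
apply: leeD; [exact: step2|rewrite EFinD].
apply: le_trans (integral_dist_triangle _ (mKf _ _ _) (mKf s mm x) (mKf _ _ _)) _.
by apply: leeD; [exact: step3|exact: step4].
Qed.

End model_estimates.

(** * The limit flow *)

Section kernel_generators.
Context {R : realType} {M : lcsMetricType R}.
Variables (f : nat -> M -> R) (dec : fun_space nat R -> prob M).
Hypothesis tf : forall k, test (f k).
Hypothesis mdec : measurable_fun [set: fun_space nat R] dec.
Hypothesis decK : forall mu : probability (borel M) R,
  (dec (moments f mu) : probability (borel M) R) ≡μ mu.

Lemma kernel_int_inj (K L : kernels M) x :
  (forall k, kernel_int K (f k) x = kernel_int L (f k) x) ->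
  kernel_at K x ≡μ kernel_at L x.
Proof.
move=> KL A mA; rewrite -(decK (kernel_at K x) mA) -(decK (kernel_at L x) mA).
suff -> : moments f (kernel_at K x) = moments f (kernel_at L x) by [].
by apply/funext => k; exact: KL.
Qed.

Definition kernel_gt : set (set (kernels M)) :=
  [set A | exists k x a, A = [set K | a < kernel_int K (f k) x]].

Lemma kernel_gt_measurable : kernel_gt `<=` measurable.
Proof.
move=> _ [k [x [a ->]]]; rewrite -[X in measurable X]setTI.
rewrite (_ : [set K | _] = (fun K => kernel_int K (f k) x) @^-1` `]a, +oo[%classic).
  have [_ f01] := tf k; exact: (measurable_kernel_int_at (measurable_test (tf k)) f01 x).
by apply/seteqP; split=> K /=; rewrite in_itv/= andbT.
Qed.

(** Since [dec] is measurable and inverts [moments] up to equality on measurable sets, an event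
    about [K x] is an event about its sequence of moments. *)
Lemma measurable_kernel_gt : @measurable _ (kernels M) `<=` <<s kernel_gt >>.
Proof.
apply: smallest_sub; first exact: smallest_sigma_algebra.
move=> _ [x _ [B mB <-]]; rewrite setTI.
pose S := g_sigma_algebraType kernel_gt.
have mS : measurable_fun [set: S] (fun K : S => moments f (kernel_at K x)).
  apply: measurable_fun_space => k.
  apply: (measurability _ (RGenOInfty.measurableE R)) => //.
  move=> _ [_ [a ->] <-]; rewrite setTI; apply: sub_sigma_algebra.
  by exists k, x, a; apply/seteqP; split=> K /=; rewrite in_itv/= andbT.
have := mS measurableT (dec @^-1` B); rewrite setTI.
rewrite (_ : _ @^-1` (dec @^-1` B) = kernel_ev x @^-1` B).
  by apply; rewrite -[X in measurable X]setTI; exact: mdec.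
apply/seteqP; split=> K /=.
  by move/(prob_measurable_eq mB (decK (kernel_at K x))).
by move=> BK; apply/(prob_measurable_eq mB (decK (kernel_at K x))).
Qed.

End kernel_generators.

Lemma countable_boxes (R : realType) (M : lcsMetricType R) :
  exists B : nat -> set (R * R * borel M), (forall i, measurable (B i)) /\
    forall s t x (d : R) (N : set M), 0 < d -> nbhs x N ->
    exists i, B i (s, t, x) /\
      forall u, B i u -> [/\ `|s - u.1.1| < d, `|t - u.1.2| < d & N u.2].
Proof.
have [V [oV UV]] := countable_open_base M.
pose B0 (i : rat * rat * (nat * nat)) : set (R * R * borel M) :=
  (ball (ratr i.1.1 : R) i.2.1.+1%:R^-1 `*` ball (ratr i.1.2 : R) i.2.1.+1%:R^-1) `*` V i.2.2.
pose B n := if unpickle n is Some i then B0 i else set0.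
have mball (a r : R) : measurable (ball a r : set R).
  by apply: open_measurable; exact: ball_open.
exists B; split=> [n|s t x d N d0 Nx].
  rewrite /B; case: unpickle => // i; apply: measurableX; first exact: measurableX.
  by apply: sub_sigma_algebra; exact: oV.
have [j jd] : exists j : nat, j.+1%:R^-1 < d / 2.
  have d20 : 0 < d / 2 by rewrite divr_gt0.
  by exists (Num.truncn (d / 2)^-1); rewrite invf_plt ?posrE// Num.Theory.truncnS_gt.
pose r : R := j.+1%:R^-1.
have r0 : 0 < r by rewrite invr_gt0.
have near_rat (a : R) : exists q : rat, ball (ratr q : R) r a.
  have [q] := @rat_in_itvoo R (a - r) (a + r) ltac:(lra).
  by rewrite in_itv/= => /andP[h1 h2]; exists q; rewrite /ball/= ltr_norml; apply/andP; split; lra.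
have [q1 sq] := near_rat s; have [q2 tq] := near_rat t.
have [i iN Vx] : exists2 i, V i `<=` N & V i x.
  have : N° x by [].
  rewrite (UV _ (open_interior N)) => -[i iN Vx]; exists i => //.
  exact: subset_trans iN (@interior_subset _ N).
exists (pickle (q1, q2, (j, i))); rewrite /B pickleK; split=> // u [[/= su tu] Vu].
have close q a b : ball (ratr q : R) r a -> ball (ratr q : R) r b -> `|a - b| < d.
  by rewrite /ball/= -/r !ltr_norml; move: jd; rewrite -/r; lra.
by split; [exact: close sq su|exact: close tq tu|exact: iN].
Qed.

Lemma markov_gt d (T : measurableType d) (R : realType) (m : probability T R) (g : T -> R) (e : R) :
  measurable_fun [set: T] g -> (forall x, 0 <= g x) -> 0 < e ->
  (\int[m]_x (g x)%:E <= (e * e)%:E)%E -> (m [set x | (e < g x)%R] <= e%:E)%E.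
Proof.
move=> mg g0 e0 h.
have mA : measurable [set x | e < g x].
  rewrite -[X in measurable X]setTI (_ : [set x | _] = g @^-1` `]e, +oo[%classic); first exact: mg.
  by apply/seteqP; split=> x /=; rewrite in_itv/= andbT.
rewrite -(@lee_pmul2l _ e%:E) ?lte_fin// -EFinM; apply: le_trans h.
have mI : measurable_fun [set: T] (fun x => (\1_[set x | e < g x] x : R)%:E).
  by apply/measurable_EFinP; exact: measurable_indic.
rewrite -[X in m X]setIT -integral_indic// -ge0_integralZl//; last exact: ltW.
apply: ge0_le_integral => //; [by move=> x _; rewrite -EFinM lee_fin mulr_ge0// ltW|
  exact: measurable_funeM|exact/measurable_EFinP|].
move=> x _; rewrite -EFinM lee_fin indicE; have [|_] := boolP (x \in _); last by rewrite mulr0.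
by rewrite inE /= mulr1 => /ltW.
Qed.

(** * Standard parts, their modification and their decoding *)

Section limit_flow.
Context {R : realType} {M : lcsMetricType R}.
Variables (nu : R -> probability (kernels M) R) (p : kernels M -> kernels M).
Hypothesis nu_semigroup : feller_convolution_semigroup nu.
Hypothesis p_presentation : forall t : R, 0 <= t -> measurable_presentation (nu t) p.
Hypothesis p_idempotent : forall K : kernels M, kernel_eq (p (p K)) (p K).

Variables (U : set_system (seq R)) (UU : UltraFilter U).
Hypothesis near_mem : forall s, U [set T | s \in T].
Hypothesis rankU : forall n, U [set T | (n <= size T)%N].
Variable m : forall T, model nu p T.

Local Notation space := (fun T => mspace (m T)).
Local Notation Om := (loeb_space UU space).
Local Notation Q := (loeb_measure (fun T => mprob (m T)) rankU).
Local Notation flow := (fun T => @mflow _ _ _ _ _ (m T)).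

Definition process g (u : R * R * borel M) : Om -> R :=
  standard_part (UU := UU) (fun T w => kernel_int (flow T u.1.1 u.1.2 w) g u.2).

Let mflow_int g s t x T : test g -> measurable_fun [set: space T] (fun w => kernel_int (flow T s t w) g x).
Proof.
move=> tg; have [_ g01] := tg.
exact: measurableT_comp (measurable_kernel_int_at (measurable_test tg) g01 x) (measurable_mflow _ _).
Qed.

Let flow_int01 g s t x T w : test g -> 0 <= kernel_int (flow T s t w) g x <= 1.
Proof. by move=> tg; have [_ g01] := tg; exact: kernel_int01 (measurable_test tg) g01 _ _. Qed.

Lemma measurable_process g u : test g -> measurable_fun [set: Om] (process g u).
Proof.
by move=> tg; apply: measurable_standard_part => [T|T w]; [exact: mflow_int|exact: flow_int01].
Qed.

Lemma process_close g (e : R) u : test g -> 0 < e ->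
  exists2 d : R, 0 < d & exists2 N : set M, nbhs u.2 N &
    forall v, `|u.1.1 - v.1.1| < d -> `|u.1.2 - v.1.2| < d -> N v.2 ->
    (Q [set w | (e < `|process g v w - process g u w|)%R] <= e%:E)%E.
Proof.
move=> tg e0; case: u => [[s t] x] /=.
have [d d0 [N Nx h]] := model_close nu_semigroup p_presentation s t x tg (mulr_gt0 e0 e0).
exists d => //; exists N => // -[[s' t'] x'] /= ss' tt' Nx'.
apply: standard_part_dist_le => //=; [by move=> T; exact: mflow_int|by move=> T w; exact: flow_int01|
  by move=> T; exact: mflow_int|by move=> T w; exact: flow_int01|].
have mem2 : U ([set T | s \in T] `&` [set T | t \in T]) by exact: filterI.
have mem2' : U ([set T | s' \in T] `&` [set T | t' \in T]) by exact: filterI.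
apply: filterS2 mem2 mem2' => T [sT tT] [s'T t'T].
apply: markov_gt => //.
  by apply: measurableT_comp => //; apply: measurable_funB; exact: mflow_int.
exact: h.
Qed.

(** Closeness around [u] holds on a neighbourhood that depends on [u]. Of the countably many boxes,
    those that serve for some center are kept, with one center chosen for each; the others are
    emptied. *)
Lemma process_locally_close (g : M -> R) n : test g -> exists (V : nat -> set (R * R * borel M)) c,
  [/\ forall i, measurable (V i), forall u, exists i, V i u &
   forall i u, V i u ->
     (Q [set w | (scale n < `|process g u w - process g (c i) w|)%R] <= (scale n)%:E)%E].
Proof.
move=> tg; have [B [mB BP]] := countable_boxes M.
pose good i c := forall u, B i u ->
     (Q [set w | (scale n < `|process g u w - process g c w|)%R] <= (scale n)%:E)%E.
pose V i := if pselect (exists c, good i c) then B i else set0.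
have /choice[c cP] : forall i, exists c, (exists c, good i c) -> good i c.
  move=> i; have [[c gc]|ngc] := pselect (exists c, good i c); first by exists c.
  by exists (0, 0, point) => /ngc.
exists V, c; split=> [i|u|i u].
- by rewrite /V; case: (pselect _) => ?; [exact: mB|exact: measurable0].
- have e0 : 0 < (scale n : R) by rewrite exprn_gt0// invr_gt0.
  have [d d0 [N Nu h]] := process_close u tg e0.
  have [i [Bu Bi]] := BP u.1.1 u.1.2 u.2 d N d0 Nu.
  exists i; rewrite /V; case: (pselect _) => [?|];  first by move: u Bu {h Bi Nu} => [[]].
  by case; exists u => v /Bi[h1 h2 h3]; exact: h.
- by rewrite /V; case: (pselect _) => // gi Bu; exact: cP.
Qed.

Variables (f : nat -> M -> R) (dec : fun_space nat R -> prob M).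
Hypothesis tf : forall k, test (f k).
Hypothesis mdec : measurable_fun [set: fun_space nat R] dec.
Hypothesis decK : forall mu : probability (borel M) R,
  (dec (moments f mu) : probability (borel M) R) ≡μ mu.

Variable Y : nat -> (R * R * borel M) * Om -> R.
Arguments Y : clear implicits.
Hypothesis mY : forall k, measurable_fun setT (Y k).
Hypothesis YE : forall k u, {ae Q, forall w, Y k (u, w) = process (f k) u w}.

Let f01 k := proj2 (tf k).
Let mf k := measurable_test (tf k).

Definition limit_fun s t w (x : borel M) : prob M :=
  dec (fun k => Y k ((s, t, x), w)).

Lemma measurable_limit_fun s t w : measurable_fun [set: borel M] (limit_fun s t w).
Proof.
apply: measurableT_comp mdec _; apply: measurable_fun_space => k.
by apply: measurableT_comp (mY k) _; apply: measurable_fun_pair => //; exact: measurable_fun_pair.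
Qed.

Definition limit_kernel s t w : kernels M := mfun_of (measurable_limit_fun s t w).

Lemma measurable_limit_kernel :
  measurable_fun [set: R * R * Om] (fun z => limit_kernel z.1.1 z.1.2 z.2).
Proof.
apply: measurable_fun_kernels => x A mA.
apply: measurableT_comp (measurable_prob_ev mA) _.
apply: (measurableT_comp mdec); apply: measurable_fun_space => k.
apply: measurableT_comp (mY k) _; apply: measurable_fun_pair => //.
by apply: measurable_fun_pair => //; apply: measurable_fun_pair; exact: measurableT_comp.
Qed.

Lemma measurable_moments x :
  measurable_fun [set: kernels M] (fun K => moments f (kernel_at K x) : fun_space nat R).
Proof. by apply: measurable_fun_space => k; exact: (measurable_kernel_int_at (mf k) (f01 k) x). Qed.

Let Z s t x T (w : space T) : fun_space nat R := moments f (kernel_at (flow T s t w) x).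

Let mZ s t x T : measurable_fun [set: space T] (@Z s t x T).
Proof. exact: measurableT_comp (measurable_moments x) (measurable_mflow _ _). Qed.

Let Z01 s t x T w k : 0 <= @Z s t x T w k <= 1.
Proof. exact: kernel_int01 (mf k) (f01 k) _ _. Qed.

Let law s t x := distribution (nu (t - s)) (mfun_of (measurable_moments x)).

Let mem2 s t : U [set T | s \in T /\ t \in T].
Proof. exact: filterI (near_mem s) (near_mem t). Qed.

Lemma flow_law s t : s <= t -> U [set T | forall A, measurable A ->
  mprob (m T) (flow T s t @^-1` A) = nu (t - s) A].
Proof. by move=> st; apply: filterS (mem2 s t) => T [sT tT] A mA; exact: model_law. Qed.

Let lawZ s t x : s <= t -> U [set T | forall A, measurable A ->
  mprob (m T) (@Z s t x T @^-1` A) = law s t x A].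
Proof.
move=> st; apply: filterS (flow_law st) => T h A mA.
apply: etrans (esym (distribution_mfun_ofE _ (measurable_moments x) _)).
apply: (h ((fun K => moments f (kernel_at K x) : fun_space nat R) @^-1` A)).
by rewrite -[X in measurable X]setTI; exact: measurable_moments.
Qed.

(** The set of moment sequences, written as a set of fixed points to make it visibly measurable. *)
Let Img : set (fun_space nat R) := [set v | forall k, moments f (dec v) k = v k].

Let mImg : measurable Img.
Proof.
rewrite (_ : Img = \bigcap_k [set v | moments f (dec v) k - v k = 0]); last first.
  apply/seteqP; split=> v h k; first by move=> _; rewrite /= h subrr.
  by apply/eqP; rewrite -subr_eq0; apply/eqP; exact: h.
apply: bigcapT_measurable => k.
rewrite -[X in measurable X]setTI (_ : [set v | _] =
  (fun v : fun_space nat R => moments f (dec v) k - v k) @^-1` [set 0])//.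
apply: measurable_funB => //; last exact: measurable_proj.
apply: (@measurable_Rintegral_prob _ _ _ _ dec (fun z => f k z.2)) => //.
  by apply: measurableT_comp (mf k) _.
by move=> z; have /andP[] := f01 k z.2.
Qed.

Let moments_eq (mu mu' : probability (borel M) R) k : mu ≡μ mu' -> moments f mu k = moments f mu' k.
Proof.
by move=> e; rewrite /moments /Rintegral; congr (fine _); apply: eq_measure_integral => A mA _; exact: e.
Qed.

(** A standard part of moment sequences could fail to be one, through loss of mass at infinity.
    Almost surely it does not, because its law is that of the moments of a kernel with law
    [nu (t - s)]. *)
Lemma ae_limit_moments s t x : s <= t -> {ae Q, forall w, forall k,
  kernel_int (limit_kernel s t w) (f k) x = process (f k) (s, t, x) w}.
Proof.
move=> st.
have h1 : {ae Q, forall w, Img (standard_parts (UU := UU) (@Z s t x) w)}.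
  apply: (ae_pushforward (measurable_standard_parts (@mZ s t x) (@Z01 s t x))
    (@standard_parts_law _ _ _ _ _ _ _ _ rankU _ _ (@mZ s t x) (@Z01 s t x) (lawZ x st))).
  exists (~` Img); split=> //; first exact: measurableC.
  apply: etrans (distribution_mfun_ofE _ (measurable_moments x) _) _.
  rewrite (_ : _ @^-1` _ = set0) ?measure0//; apply/seteqP; split=> // K /=; apply.
  by move=> k; apply: moments_eq; exact: decK.
have h2 : {ae Q, forall w k, Y k ((s, t, x), w) = process (f k) (s, t, x) w}.
  by apply: ae_foralln => k; exact: YE.
apply: filterS2 h1 h2 => w Iw Yw k.
rewrite -[LHS]/(moments f (dec (fun k => Y k ((s, t, x), w))) k).
rewrite (_ : (fun k => _) = standard_parts (UU := UU) (@Z s t x) w); first exact: Iw.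
by apply/funext => j; exact: Yw.
Qed.

Lemma ae_limit_kernel s t A : s <= t -> measurable A ->
  {ae Q, forall w, A (limit_kernel s t w) <-> ev U (fun T => flow T s t @^-1` A) w}.
Proof.
move=> st; apply: (ae_ev_transfer (Z := fun T => flow T s t) _ (flow_law st)
  (measurable_kernel_gt mdec decK) (kernel_gt_measurable tf)).
  by move=> T; exact: measurable_mflow.
move=> _ [k [x [a ->]]].
have ma : measurable [set v : fun_space nat R | a < v k].
  by apply: coordinate_gt_measurable; exists k, a.
have h := @ae_standard_parts _ _ _ UU _ _ _ _ rankU _ _ (@mZ s t x) (@Z01 s t x) (lawZ x st) _ ma.
by apply: filterS2 h (ae_limit_moments x st) => w hw /(_ k) /= ->.
Qed.

Definition limit_flow s t w : kernels M := if s < t then p (limit_kernel s t w) else kernel_id.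

Let jp : jointly_measurable p.
Proof. by have [] := p_presentation (lexx 0). Qed.

Let mp : measurable_fun [set: kernels M] p.
Proof. exact: jointly_measurable_fun. Qed.

Lemma measurable_limit_flow :
  measurable_fun [set: R * R * Om] (fun z => limit_flow z.1.1 z.1.2 z.2).
Proof.
apply: measurable_fun_ifT => //; last exact: measurableT_comp mp measurable_limit_kernel.
by apply: measurable_fun_ltr; exact: measurableT_comp.
Qed.

Lemma measurable_limit_flow_at s t : measurable_fun [set: Om] (limit_flow s t).
Proof.
have h : measurable_fun [set: Om] (fun w : Om => ((s, t), w)) by exact: measurable_fun_pair.
exact: measurableT_comp measurable_limit_flow h.
Qed.

Lemma limit_flow_p s t w : kernel_eq (p (limit_flow s t w)) (limit_flow s t w).
Proof.
rewrite /limit_flow; case: ifP => _; first exact: p_idempotent.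
exact: presentation_id nu_semigroup p_presentation.
Qed.

Let measurable_limit_kernel_at s t : measurable_fun [set: Om] (limit_kernel s t).
Proof.
have h : measurable_fun [set: Om] (fun w : Om => ((s, t), w)) by exact: measurable_fun_pair.
exact: measurableT_comp measurable_limit_kernel h.
Qed.

Let mflow s t T : measurable_fun [set: space T] (flow T s t).
Proof. exact: measurable_mflow. Qed.

Lemma limit_kernel_law s t A : s <= t -> measurable A -> Q (limit_kernel s t @^-1` A) = nu (t - s) A.
Proof.
move=> st mA; rewrite -(loeb_law UU rankU (mflow s t) (flow_law st) mA).
apply: measure_ae_eq; last exact: ae_limit_kernel.
- by rewrite -[X in measurable X]setTI; exact: measurable_limit_kernel_at.
- by apply: measurable_ev; exact: internal_preimage.
Qed.

Lemma ae_limit_flow s t A : s <= t -> measurable A ->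
  {ae Q, forall w, A (limit_flow s t w) <-> ev U (fun T => flow T s t @^-1` A) w}.
Proof.
rewrite le_eqVlt => /orP[/eqP <-|st] mA.
  apply: aeW => w; rewrite /limit_flow ltxx.
  split=> [h|]; first by apply: filterE => T; rewrite /= mflow_ge.
  have [//|nA] := pselect (A kernel_id); rewrite (_ : (fun T => _) = (fun=> set0)) ?ev0//.
  apply: functional_extensionality_dep => T; apply/seteqP; split=> // y /=.
  by rewrite mflow_ge.
have st0 : 0 <= t - s by rewrite subr_ge0 ltW.
have [_ ap] := p_presentation st0.
have h x : {ae Q, forall w, kernel_at (limit_flow s t w) x ≡μ kernel_at (limit_kernel s t w) x}.
  rewrite /limit_flow st.
  exact: (ae_pushforward (measurable_limit_kernel_at s t) (fun A => limit_kernel_law (ltW st)) (ap x)).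
by apply: filterS2 (ae_kernel_version h mA) (ae_limit_kernel (ltW st) mA) => w -> ->.
Qed.

Lemma limit_flow_law s t A : s <= t -> measurable A -> Q (limit_flow s t @^-1` A) = nu (t - s) A.
Proof.
move=> st mA; rewrite -(loeb_law UU rankU (mflow s t) (flow_law st) mA).
apply: measure_ae_eq; last exact: ae_limit_flow.
- by rewrite -[X in measurable X]setTI; exact: measurable_limit_flow_at.
- by apply: measurable_ev; exact: internal_preimage.
Qed.

Lemma limit_flow_chain n (tau : nat -> R) (A : nat -> set (kernels M)) :
  (forall i, (i < n)%N -> tau i <= tau i.+1) -> (forall i, measurable (A i)) ->
  Q (\bigcap_(i in `I_n) (limit_flow (tau i) (tau i.+1) @^-1` A i)) =
  (\prod_(i < n) nu (tau i.+1 - tau i)%R (A i))%E.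
Proof.
move=> tle mA.
pose E k T : set (space T) := \bigcap_(i in `I_k) (flow T (tau i) (tau i.+1) @^-1` A i).
have mE k : internal (E k).
  move=> T; apply: bigcap_measurableType => i _.
  by rewrite -[X in measurable X]setTI; exact: measurable_mflow.
have EP : U [set T | mprob (m T) (E n T) = (\prod_(i < n) nu (tau i.+1 - tau i)%R (A i))%E].
  have hU k : U [set T | forall i, (i <= k)%N -> tau i \in T].
    elim: k => [|k IH].
      by apply: filterS (near_mem (tau 0%N)) => T h i; rewrite leqn0 => /eqP ->.
    apply: filterS2 IH (near_mem (tau k.+1)) => T h h' i.
    by rewrite leq_eqVlt => /orP[/eqP ->//|]; rewrite ltnS; exact: h.
  by apply: filterS (hU n) => T h; exact: mflow_chain.
rewrite -(loeb_measure_cst UU rankU (mE n) EP).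
apply: measure_ae_eq; last 2 first.
- exact: measurable_ev.
- elim: n tle {EP} => [|n IH] tle.
    apply: aeW => w; split=> _; last by move=> i /=.
    by apply: filterE => T i /=.
  have tle' i : (i < n)%N -> tau i <= tau i.+1 by move=> ni; apply: tle; exact: ltnW.
  apply: filterS2 (IH tle') (ae_limit_flow (tle n (ltnSn n)) (mA n)) => w h1 h2.
  rewrite bigcap_ltnS (_ : E n.+1 = (fun T => E n T `&` (flow T (tau n) (tau n.+1) @^-1` A n))).
    by rewrite evI; split=> -[/h1 ? /h2 ?].
  by apply: functional_extensionality_dep => T; rewrite /E bigcap_ltnS.
- apply: bigcap_measurableType => i _.
  by rewrite -[X in measurable X]setTI; exact: measurable_limit_flow_at.
Qed.

Let pair_flow r s t T (w : space T) := (flow T r s w, flow T s t w).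
Let pair_limit r s t w := (limit_flow r s w, limit_flow s t w).

Let mpair_flow r s t T : measurable_fun [set: space T] (@pair_flow r s t T).
Proof. exact: measurable_model_pair. Qed.

Let measurable_pair_limit r s t : measurable_fun [set: Om] (pair_limit r s t).
Proof. by apply: measurable_fun_pair; exact: measurable_limit_flow_at. Qed.

Let pair_law r s t : probability (kernels M * kernels M)%type R := (nu (s - r) \x nu (t - s))%E.

Let pair_flow_law r s t : r <= s -> s <= t -> U [set T | forall C, measurable C ->
  mprob (m T) (@pair_flow r s t T @^-1` C) = pair_law r s t C].
Proof.
move=> rs st; apply: filterS2 (mem2 r s) (near_mem t) => T [rT sT] tT C mC.
exact: model_pair_law.
Qed.

Let rectangles : set (set (kernels M * kernels M)) :=
  [set C | exists2 A, measurable A & exists2 B, measurable B & A `*` B = C].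

Let measurable_rectangles : measurable `<=` <<s rectangles >>.
Proof. by rewrite measurable_prod_measurableType. Qed.

Let rectangles_measurable : rectangles `<=` measurable.
Proof. by move=> _ [A mA [B mB <-]]; exact: measurableX. Qed.

Let ae_pair_rectangle r s t : r <= s -> s <= t -> forall C, rectangles C ->
  {ae Q, forall w, C (pair_limit r s t w) <-> ev U (fun T => @pair_flow r s t T @^-1` C) w}.
Proof.
move=> rs st _ [A mA [B mB <-]].
apply: filterS2 (ae_limit_flow rs mA) (ae_limit_flow st mB) => w hA hB.
rewrite (_ : (fun T => _) = (fun T => flow T r s @^-1` A `&` (flow T s t @^-1` B))).
  by rewrite evI; split=> -[/hA ? /hB ?].
by apply: functional_extensionality_dep => T; apply/seteqP; split=> w0 [/= h1 h2]; split.
Qed.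

(** Only events transfer from the finite flows. Equality at [x] is recovered from countably many of
    them, the comparisons of each coding integral with the rationals. *)
Lemma limit_flow_conv r s t x : r <= s -> s <= t ->
  {ae Q, forall w, kernel_at (limit_flow r t w) x ≡μ
    kernel_at (kernel_conv p (limit_flow r s w, limit_flow s t w)) x}.
Proof.
move=> rs st; have mconv := measurable_kernel_conv p_presentation.
have h A : measurable A -> {ae Q, forall w, A (limit_flow r t w) <-> A (kernel_conv p (pair_limit r s t w))}.
  move=> mA; have mC : measurable (kernel_conv p @^-1` A).
    by rewrite -[X in measurable X]setTI; exact: mconv.
  have h1 := ae_ev_transfer (@mpair_flow r s t) (pair_flow_law rs st) measurable_rectangles
    rectangles_measurable (ae_pair_rectangle rs st) mC.
  (* In a finite flow the composition rule holds almost surely at each point; this suffices for an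
     event of the kernel sigma-field, by [ae_kernel_version]. *)
  have h2 : {ae Q, forall w, ev U (fun T => flow T r t @^-1` A) w <->
      ev U (fun T => @pair_flow r s t T @^-1` (kernel_conv p @^-1` A)) w}.
    apply: ae_evP.
    - by apply: internal_preimage => // T; exact: mflow.
    - by apply: internal_preimage => // T; exact: mpair_flow.
    - apply: filterS2 (mem2 r s) (near_mem t) => T [rT sT] tT.
      by apply: ae_kernel_version => // y; exact: mflow_comp.
  apply: filterS3 h1 h2 (ae_limit_flow (le_trans rs st) mA) => w e1 e2 e3.
  by rewrite e3 e2 -e1.
pose q n : R := ratr (odflt 0 (unpickle n)).
pose A k n := [set K : kernels M | q n < kernel_int K (f k) x].
have hq : {ae Q, forall w k n, A k n (limit_flow r t w) <-> A k n (kernel_conv p (pair_limit r s t w))}.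
  apply: ae_foralln => k; apply: ae_foralln => n; apply: h.
  by apply: (kernel_gt_measurable tf); exists k, x, (q n).
have qK a : q (pickle a) = ratr a by rewrite /q pickleK.
apply: filterS hq => w hw; apply: (kernel_int_inj decK) => k.
have hr a : ratr a < kernel_int (limit_flow r t w) (f k) x <->
    ratr a < kernel_int (kernel_conv p (pair_limit r s t w)) (f k) x.
  by rewrite -qK; exact: hw k (pickle a).
apply/eqP; rewrite eq_le !leNgt; apply/andP; split; apply/negP => /rat_in_itvoo[a];
  rewrite in_itv/= => /andP[a1 a2].
  by have := lt_trans a1 (proj1 (hr a) a2); rewrite ltxx.
by have := lt_trans a1 (proj2 (hr a) a2); rewrite ltxx.
Qed.

(** Two presentations of [nu (t - s)] agree almost surely at each point, and the independence of the
    two increments lets one replace the other inside the composition. *)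
Lemma limit_flow_comp r s t x (p' : kernels M -> kernels M) : r <= s -> s <= t ->
  measurable_presentation (nu (t - s)) p' ->
  {ae Q, forall w, kernel_at (limit_flow r t w) x ≡μ
    kernel_at (kernel_comp (limit_flow r s w) (p' (limit_flow s t w))) x}.
Proof.
move=> rs st [jp' ap'].
have st0 : 0 <= t - s by rewrite subr_ge0.
have [_ ap] := p_presentation st0.
have pp' z : {ae nu (t - s), forall K, kernel_at (p K) z ≡μ kernel_at (p' K) z}.
  by apply: filterS2 (ap z) (ap' z) => K h1 h2 A mA; rewrite h1// h2.
have key := @ae_kernel_comp_eqr _ _ _ _ _ _ (nu (s - r)) (nu (t - s)) id p p' x
  (@measurable_id _ _ setT) jp jp' pp'.
have lawE C : measurable C -> Q (pair_limit r s t @^-1` C) = pair_law r s t C.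
  exact: (loeb_law_transfer (@mpair_flow r s t) (pair_flow_law rs st) measurable_rectangles
    rectangles_measurable (measurable_pair_limit r s t) (ae_pair_rectangle rs st)).
have key' := ae_pushforward (measurable_pair_limit r s t) lawE key.
by apply: filterS2 key' (limit_flow_conv x rs st) => w h1 h2 A mA; rewrite h2// -h1.
Qed.

End limit_flow.

(** A list containing [n] given distinct points has size at least [n]. Thus [size] serves as the
    rank witnessing countable incompleteness. *)
Lemma fine_ultrafilter (X : eqType) (e : nat -> X) : injective e ->
  exists2 U : set_system (seq X), UltraFilter U &
    (forall x, U [set T | x \in T]) /\ forall n, U [set T | (n <= size T)%N].
Proof.
move=> inj_e; pose F := filter_from [set: seq X] (fun S => [set T : seq X | {subset S <= T}]).
have FF : ProperFilter F.
  apply: filter_from_proper; last by move=> S _; exists S.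
  apply: filter_from_filter; first by exists [::].
  by move=> S S' _ _; exists (S ++ S') => // T ST; split=> x xS; apply: ST; rewrite mem_cat xS ?orbT.
have [U [UU FU]] := ultraFilterLemma FF.
exists U => //; split=> [x|n]; apply: FU.
  by exists [:: x] => // T; apply; rewrite mem_head.
exists [seq e i | i <- iota 0 n] => // T /= ST.
by have := uniq_leq_size _ ST; rewrite size_map size_iota; apply; rewrite map_inj_uniq ?iota_uniq.
Qed.

Lemma C0_bounded (R : realType) (M : lcsMetricType R) (f : M -> R) : C0 f -> bounded_fun f.
Proof.
move=> [cf /cvgrPdist_lt/(_ _ ltr01)[C cC fC]].
have /compact_bounded[c [cr fc]] : compact (f @` C).
  by apply: continuous_compact => //; exact: continuous_subspaceT.
exists (Num.max c 1); split; first exact: num_real.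
move=> z; rewrite gt_max => /andP[cz z1] x _ /=.
have [Cx|Cx] := pselect (C x); first by apply: (fc z cz); exists x.
by have := fC x Cx; rewrite /= sub0r normrN => /lt_trans/(_ z1)/ltW.
Qed.

(** The flow axioms concern all of [C0], with no sign or size restriction; this makes the events in
    them measurable, so that they transfer by equality of laws. *)
Lemma measurable_C0_int (R : realType) (M : lcsMetricType R) (f : M -> R) x : C0 f ->
  measurable_fun [set: kernels M] (fun K => kernel_int K f x).
Proof.
move=> cf; have bf := C0_bounded cf; have [cf' _] := cf.
exact: measurableT_comp (measurable_weak_integral cf' bf) (measurable_kernel_ev x).
Qed.

(** * Assembly of the flow *)

Section flow_from_semigroup.
Context {R : realType} {M : lcsMetricType R}.
Variables (nu : R -> probability (kernels M) R) (p : kernels M -> kernels M).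
Hypothesis nu_semigroup : feller_convolution_semigroup nu.
Hypothesis p_presentation : forall t : R, 0 <= t -> measurable_presentation (nu t) p.
Hypothesis p_idempotent : forall K : kernels M, kernel_eq (p (p K)) (p K).

Lemma kernel_family : exists d (Om : measurableType d) (Q : probability Om R)
    (K : R -> R -> Om -> kernels M),
  [/\ measurable_fun [set: R * R * Om] (fun z => K z.1.1 z.1.2 z.2),
      forall s t A, s <= t -> measurable A -> Q (K s t @^-1` A) = nu (t - s) A,
      forall n (tau : nat -> R) (A : nat -> set (kernels M)),
        (forall i, (i < n)%N -> tau i <= tau i.+1) -> (forall i, measurable (A i)) ->
        Q (\bigcap_(i in `I_n) (K (tau i) (tau i.+1) @^-1` A i)) =
        (\prod_(i < n) nu (tau i.+1 - tau i)%R (A i))%E,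
      forall r s t x (p' : kernels M -> kernels M), r <= s -> s <= t ->
        measurable_presentation (nu (t - s)) p' ->
        {ae Q, forall w, kernel_at (K r t w) x ≡μ
                         kernel_at (kernel_comp (K r s w) (p' (K s t w))) x} &
      forall s t w, K s s w = kernel_id /\ kernel_eq (p (K s t w)) (K s t w)].
Proof.
have [f [dec [f0 f01 mdec decK]]] := prob_coding M.
have tf k : test (f k) by split.
have injR : injective (fun n : nat => n%:R : R) by move=> i j /eqP; rewrite eqr_nat => /eqP.
have [U UU [near_mem rankU]] := fine_ultrafilter injR.
have mT T : exists m : model nu p T, True.
  by have [m] := finite_model nu_semigroup p_presentation p_idempotent T; exists m.
pose m T := projT1 (cid (mT T)).
have /choice[Y YP] k := measurable_modification
  (fun u => measurable_process (UU := UU) (m := m) u (tf k))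
  (fun n => process_locally_close nu_semigroup p_presentation UU near_mem rankU m n (tf k)).
have mY k := proj1 (YP k); have YE k := proj2 (YP k).
exists _, _, (loeb_measure (fun T => mprob (m T)) rankU), (limit_flow mdec mY).
split.
- exact: measurable_limit_flow.
- by move=> s t A; exact: (limit_flow_law p_presentation near_mem tf mdec decK mY YE).
- by move=> n tau A; exact: (limit_flow_chain p_presentation near_mem tf mdec decK mY YE).
- by move=> r s t x p'; exact: (limit_flow_comp p_presentation near_mem tf mdec decK mY YE).
- move=> s t w; split; first by rewrite /limit_flow ltxx.
  exact: limit_flow_p.
Qed.

End flow_from_semigroup.

Theorem theorem2p2 (R : realType) (M : lcsMetricType R)
    (nu : R -> probability (kernels M) R) (p : kernels M -> kernels M)
    (nu_semigroup : feller_convolution_semigroup nu)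
    (p_presentation : forall t : R, 0 <= t -> measurable_presentation (nu t) p)
    (p_idempotent : forall K : kernels M, kernel_eq (p (p K)) (p K)) :
  exists (d : measure_display) (Omega : measurableType d)
         (P : probability Omega R) (K : R -> R -> {RV P >-> kernels M}),
    stochastic_flow K /\
    [/\ (forall s t : R, s <= t -> distribution P (K s t) ≡μ nu (t - s)),
        measurable_fun [set u : (R * R) * Omega | u.1.1 <= u.1.2]
          (fun u => K u.1.1 u.1.2 u.2),
        (forall (s : R) (w : Omega) (x : M),
           kernel_at (K s s w) x ≡μ \d_(x : borel M)) &
        (forall (s t : R) (w : Omega), s <= t ->
           kernel_eq (p (K s t w)) (K s t w))].
Proof.
have [d [Om [P [F [mF lawF chainF compF idF]]]]] :=
  kernel_family nu_semigroup p_presentation p_idempotent.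
have mFst s t : measurable_fun [set: Om] (F s t).
  have h : measurable_fun [set: Om] (fun w : Om => ((s, t), w)) by exact: measurable_fun_pair.
  exact: measurableT_comp mF h.
pose K s t : {RV P >-> kernels M} := mfun_of (mFst s t).
have lawK s t : s <= t -> distribution P (K s t) ≡μ nu (t - s).
  by move=> st A mA; apply: etrans (distribution_mfun_ofE _ (mFst s t) _) _; exact: lawF.
have dist_event eps (G : kernels M -> R) : measurable_fun setT G ->
    measurable [set L | eps <= `|G L|].
  move=> mG; rewrite -[X in measurable X]setTI.
  rewrite (_ : [set L | _] = (fun L => `|G L|) @^-1` `[eps, +oo[%classic).
    exact: measurableT_comp.
  by apply/seteqP; split=> L /=; rewrite in_itv/= andbT.
have law0 t eps (G : kernels M -> R) : 0 <= t -> measurable_fun setT G ->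
    P [set w | eps <= `|G (K 0 t w)|] = nu t [set L | eps <= `|G L|].
  by move=> t0 mG; have := lawF 0 t _ t0 (dist_event eps G mG); rewrite subr0.
exists d, Om, P, K; split; last first.
  split=> //.
  - by apply: measurable_funTS; exact: mF.
  - by move=> s w x A mA; rewrite [K s s w](proj1 (idF s s w)).
  - by move=> s t w _; exact: (proj2 (idF s t w)).
split.
- move=> s t st; exists p; have [|jp ap] := p_presentation (t - s); first by rewrite subr_ge0.
  by split=> // x; apply: (ae_measure_eq _ (ap x)) => A mA; rewrite lawK.
- move=> s t st A mA; rewrite lawK//; apply/esym/(etrans (lawK 0 (t - s) _ A mA)).
    by rewrite subr_ge0.
  by rewrite subr0.
- move=> r s t x p' rs st [jp' ap']; apply: compF => //; split=> // z.
  exact: (ae_measure_eq (lawK s t st) (ap' z)).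
- move=> n t tle A mA.
  pose A' i := if insub i is Some j then A j else setT.
  have A'E (i : 'I_n) : A' i = A i by rewrite /A' valK.
  have mA' i : measurable (A' i) by rewrite /A'; case: insub.
  rewrite (_ : \bigcap_i _ = \bigcap_(i in `I_n) (F (t i) (t i.+1) @^-1` A' i)); last first.
    apply/seteqP; split=> w h i; last by move=> _; have := h i (ltn_ord i); rewrite A'E.
    by move=> ni; have := h (Ordinal ni) I; rewrite -A'E.
  rewrite chainF//; apply: eq_bigr => i _.
  by rewrite A'E; apply/esym/lawF => //; exact: tle.
(* The three remaining axioms involve [K 0 t] through its law alone, which is [nu t]. *)
- move=> f eps cf eps0; have := semigroup_continuous nu_semigroup cf eps0.
  apply: cvg_trans; apply: near_eq_cvg; near=> t.
  congr ereal_sup; apply: eq_imagel => x _; apply/esym.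
  apply: (law0 t eps (fun L => kernel_int L f x - f x)) => //.
  by apply: measurable_funB => //; exact: measurable_C0_int.
- move=> f t x eps cf t0 eps0; have := semigroup_feller nu_semigroup x cf t0 eps0.
  apply: cvg_trans; apply: near_eq_cvg; near=> y; apply/esym.
  apply: (law0 t eps (fun L => kernel_int L f y - kernel_int L f x)) => //.
  by apply: measurable_funB; exact: measurable_C0_int.
- move=> f t eps cf t0 eps0; have := semigroup_feller_infinity nu_semigroup cf t0 eps0.
  apply: cvg_trans; apply: near_eq_cvg; near=> y; apply/esym.
  apply: (law0 t eps (fun L => kernel_int L f y)) => //.
  exact: measurable_C0_int.
Unshelve. all: by end_near. Qed.
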